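(* Let $\Omega\subset\mathbb C$ be a domain, $0\le R<\infty$, $0\le L<\infty$, $0\le M<\infty$, $0<\alpha<1$, and let $\mathcal H=\mathcal H(z,\xi)$ be a continuous complex-valued function on $\Omega\times\widehat{\mathbb C}_R$, where $\widehat{\mathbb C}_R=\{\xi : R<|\xi|\le\infty\}$, such that $$|\mathcal H(z,\xi_1)-\mathcal H(z,\xi_2)|\le L\,\Big|\frac1{\xi_1}-\frac1{\xi_2}\Big|\quad\text{for } z\in\Omega,\ \xi_1,\xi_2\in\widehat{\mathbb C}_R,$$ $$\sup_{z\in\Omega}|\mathcal H(z,\xi)|+\sup_{z_1\ne z_2}\frac{|\mathcal H(z_1,\xi)-\mathcal H(z_2,\xi)|}{|z_1-z_2|^\alpha}\le M\quad\text{for } |\xi|>R.$$ Then every solution $h\in \mathscr W^{1,2}(\Omega)$ of the equation $h_{\bar z}=\mathcal H(z,h_z)$ with nonnegative Jacobian, $J_h=|h_z|^2-|h_{\bar z}|^2\ge 0$ a.e. in $\Omega$, is locally Lipschitz continuous in $\Omega$. However, such solutions are not necessarily $\mathscr C^1$-smooth: there exist a domain $\Omega\subset\mathbb C$, constants $0\le R<\infty$, $0\le L<\infty$, $0\le M<\infty$, $0<\alpha<1$, a continuous complex-valued function $\mathcal H=\mathcal H(z,\xi)$ on $\Omega\times\widehat{\mathbb C}_R$ satisfying $$|\mathcal H(z,\xi_1)-\mathcal H(z,\xi_2)|\le L\,\Big|\frac1{\xi_1}-\frac1{\xi_2}\Big|\quad\text{for } z\in\Omega,\ \xi_1,\xi_2\in\widehat{\mathbb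 C}_R,$$ $$\sup_{z\in\Omega}|\mathcal H(z,\xi)|+\sup_{z_1\ne z_2}\frac{|\mathcal H(z_1,\xi)-\mathcal H(z_2,\xi)|}{|z_1-z_2|^\alpha}\le M\quad\text{for } |\xi|>R,$$ and a solution $h\in \mathscr W^{1,2}(\Omega)$ of $h_{\bar z}=\mathcal H(z,h_z)$ with nonnegative Jacobian which is not of class $\mathscr C^1(\Omega)$.
   Context: $\mathscr W^{1,2}(\Omega)$ is the Sobolev space of complex-valued functions in $\mathscr L^2(\Omega)$ with weak first derivatives in $\mathscr L^2(\Omega)$; functions are identified when equal a.e., so regularity statements refer to a suitable representative. $h_z=\partial h/\partial z$ and $h_{\bar z}=\partial h/\partial\bar z$ are the complex (weak) partial derivatives. The convention $1/\infty=0$ is used, and $\widehat{\mathbb C}_R$ is topologized as a subset of the Riemann sphere. A function $h\in \mathscr W^{1,2}_{\mathrm{loc}}(\Omega)$ is said to be a solution of $h_{\bar z}=\mathcal H(z,h_z)$ if $h_{\bar z}(z)=\mathcal H(z,h_z(z))$ holds for almost every $z\in\Omega$ for which $|h_z(z)|>R$ (no condition is imposed at points where $|h_z(z)|\le R$). *)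

(* Defs.v *)
From HB Require Import structures.
From mathcomp Require Import all_boot all_order all_algebra.
From mathcomp Require Import all_classical all_reals all_analysis.
From mathcomp Require Import complex.

Set Implicit Arguments.
Unset Strict Implicit.
Unset Printing Implicit Defensive.

Import Order.TTheory GRing.Theory Num.Theory.
Import numFieldNormedType.Exports.

Local Open Scope classical_set_scope.
Local Open Scope ring_scope.

(* Naming the complex numbers as a numClosedFieldType gives them the topology
   and the normed-space structure that the library attaches to such types. *)
Definition Cplx (R : realType) : numClosedFieldType := R[i].

(* The Riemann sphere, with [None] the point at infinity. *)
Definition sphere (R : realType) : topologicalType :=
  one_point_compactification (Cplx R).

(* The library norm [`|z|] on complex numbers is complex-valued. *)
Definition cabs (R : realType) (z : Cplx R) : R := complex.Re `|z|.

Definition eabs (R : realType) (xi : sphere R) : \bar R :=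
  if xi is Some z then (cabs z)%:E else +oo%E.

Definition sphere_gt (R : realType) (r : R) : set (sphere R) :=
  [set xi | (r%:E < eabs xi <= +oo)%E].

(* 1 / xi with 1 / infinity = 0. *)
Definition sphere_inv (R : realType) (xi : sphere R) : Cplx R :=
  if xi is Some z then z^-1 else 0.

Definition is_domain (R : realType) (Om : set (Cplx R)) : Prop :=
  [/\ Om !=set0, open Om & connected Om].

Definition H_continuous (R : realType) (Om : set (Cplx R)) (r : R)
    (H : Cplx R -> sphere R -> Cplx R) : Prop :=
  {within Om `*` sphere_gt r,
    continuous (fun q : Cplx R * sphere R => H q.1 q.2)}.

Definition H_lipschitz (R : realType) (Om : set (Cplx R)) (r L : R)
    (H : Cplx R -> sphere R -> Cplx R) : Prop :=
  forall z xi1 xi2, Om z -> sphere_gt r xi1 -> sphere_gt r xi2 ->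
    cabs (H z xi1 - H z xi2) <= L * cabs (sphere_inv xi1 - sphere_inv xi2).

Definition H_hoelder (R : realType) (Om : set (Cplx R)) (r M alpha : R)
    (H : Cplx R -> sphere R -> Cplx R) : Prop :=
  forall xi, sphere_gt r xi ->
    (ereal_sup [set (cabs (H z xi))%:E | z in Om] +
     ereal_sup [set (cabs (H z.1 xi - H z.2 xi) /
                       (cabs (z.1 - z.2) `^ alpha)%R)%:E
               | z in [set z : Cplx R * Cplx R |
                        [/\ Om z.1, Om z.2 & z.1 != z.2]]]
     <= M%:E)%E.

(* Measure, integration and real differentiation are done in the real
   coordinates (x, y) of z = x + i y. *)

Definition cpx (R : realType) (p : R * R) : Cplx R := (p.1 +i* p.2)%C.

Definition coords (R : realType) (A : set (Cplx R)) : set (R * R) :=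
  @cpx R @^-1` A.

Definition area (R : realType) :
    {measure set (measurableTypeR R * measurableTypeR R) -> \bar R} :=
  (@lebesgue_measure R \x @lebesgue_measure R)%E.

Definition ae_in (R : realType) (Om : set (Cplx R)) (P : Cplx R -> Prop) : Prop :=
  {ae @area R, forall p, coords Om p -> P (cpx p)}.

Definition re_part (R : realType) (f : Cplx R -> Cplx R) (p : R * R) : R :=
  complex.Re (f (cpx p)).

Definition im_part (R : realType) (f : Cplx R -> Cplx R) (p : R * R) : R :=
  complex.Im (f (cpx p)).

Definition cintegral (R : realType) (A : set (Cplx R)) (f : Cplx R -> Cplx R) :
    Cplx R :=
  (Rintegral (@area R) (coords A) (re_part f) +i*
   Rintegral (@area R) (coords A) (im_part f))%C.

Definition L1_loc (R : realType) (Om : set (Cplx R)) (f : Cplx R -> Cplx R) :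
    Prop :=
  forall K, compact K -> K `<=` Om ->
    (@area R).-integrable (coords K) (EFin \o re_part f) /\
    (@area R).-integrable (coords K) (EFin \o im_part f).

Definition L2 (R : realType) (Om : set (Cplx R)) (f : Cplx R -> Cplx R) : Prop :=
  [/\ measurable_fun (coords Om) (re_part f),
      measurable_fun (coords Om) (im_part f) &
      (\int[@area R]_(p in coords Om) (cabs (f (cpx p)) ^+ 2)%:E < +oo)%E].

(* [false] stands for the x-axis, [true] for the y-axis. *)
Definition axis (R : realType) (k : bool) : R * R :=
  if k then (0, 1) else (1, 0).

Definition partial (R : realType) (k : bool) (f : R * R -> R) : R * R -> R :=
  'D_(axis R k) f.

Definition smooth (R : realType) (f : R * R -> R) : Prop :=
  forall s : seq bool, continuous (foldr (@partial R) f s) /\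
    forall k p, derivable (foldr (@partial R) f s) p (axis R k).

Definition test_function (R : realType) (Om : set (Cplx R)) (phi : R * R -> R) :
    Prop :=
  [/\ smooth phi, compact (closure [set p | phi p != 0]) &
      closure [set p | phi p != 0] `<=` coords Om].

(* Real-valued test functions suffice, by linearity. *)
Definition is_weak_partial (R : realType) (Om : set (Cplx R)) (k : bool)
    (h g : Cplx R -> Cplx R) : Prop :=
  [/\ L1_loc Om h, L1_loc Om g &
    forall phi, test_function Om phi ->
      cintegral Om (fun z => h z *
        (partial k phi (complex.Re z, complex.Im z))%:C%C) =
      - cintegral Om (fun z => g z * (phi (complex.Re z, complex.Im z))%:C%C)].

(* Weak derivatives are unique up to a null set; [xget] picks one of them, and
   returns 0 when there is none. *)
Definition weak_partial (R : realType) (Om : set (Cplx R)) (k : bool)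
    (h : Cplx R -> Cplx R) : Cplx R -> Cplx R :=
  xget (cst 0) [set g | is_weak_partial Om k h g].

Definition dz (R : realType) (Om : set (Cplx R)) (h : Cplx R -> Cplx R)
    (z : Cplx R) : Cplx R :=
  (weak_partial Om false h z - 'i%C * weak_partial Om true h z) / 2.

Definition dzbar (R : realType) (Om : set (Cplx R)) (h : Cplx R -> Cplx R)
    (z : Cplx R) : Cplx R :=
  (weak_partial Om false h z + 'i%C * weak_partial Om true h z) / 2.

Definition Jac (R : realType) (Om : set (Cplx R)) (h : Cplx R -> Cplx R)
    (z : Cplx R) : R :=
  cabs (dz Om h z) ^+ 2 - cabs (dzbar Om h z) ^+ 2.

Definition W12 (R : realType) (Om : set (Cplx R)) (h : Cplx R -> Cplx R) : Prop :=
  L2 Om h /\ forall k, exists2 g, is_weak_partial Om k h g & L2 Om g.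

Definition W12_loc (R : realType) (Om : set (Cplx R)) (h : Cplx R -> Cplx R) :
    Prop :=
  forall U, open U -> compact (closure U) -> closure U `<=` Om -> W12 U h.

Definition solution (R : realType) (Om : set (Cplx R)) (r : R)
    (H : Cplx R -> sphere R -> Cplx R) (h : Cplx R -> Cplx R) : Prop :=
  W12_loc Om h /\
  ae_in Om (fun z => r < cabs (dz Om h z) ->
    dzbar Om h z = H z (Some (dz Om h z))).

Definition locally_lipschitz (R : realType) (Om : set (Cplx R))
    (h : Cplx R -> Cplx R) : Prop :=
  forall z, Om z -> exists2 U, nbhs z U & [lipschitz h w | w in U].

Definition class_C1 (R : realType) (Om : set (Cplx R)) (h : Cplx R -> Cplx R) :
    Prop :=
  forall f, f = re_part h \/ f = im_part h ->
  forall k p, coords Om p ->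
    derivable f p (axis R k) /\ {for p, continuous (partial k f)}.

(* Functions are identified when equal almost everywhere. *)
Definition up_to_null (R : realType) (Om : set (Cplx R))
    (P : (Cplx R -> Cplx R) -> Prop) (h : Cplx R -> Cplx R) : Prop :=
  exists2 h', ae_in Om (fun z => h' z = h z) & P h'.

(* Main.v *)
From HB Require Import structures.
Require Import Defs.
From mathcomp Require Import all_boot all_order all_algebra.
From mathcomp Require Import all_classical all_reals all_analysis.
From mathcomp Require Import measurable_realfun.
From mathcomp Require Import complex ring lra.

Set Implicit Arguments.
Unset Strict Implicit.
Unset Printing Implicit Defensive.

Import Order.TTheory GRing.Theory Num.Theory.
Import numFieldNormedType.Exports.

Local Open Scope classical_set_scope.
Local Open Scope ring_scope.

(** Write [F = h_z] and [G = h_zbar].  The bound on the nonlinearity and the sign of the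
    Jacobian make [G] bounded.  For radial mollifiers [eta r] and the compactly supported
    [phi] with [dzbar phi = c0 (eta e - eta r)], the definition of weak derivatives gives
    [c0 (eta e - eta r) * h = phi * G] and [c0 (eta e - eta r) * F = (d_z phi) * G] (with [*] for
    convolution).  An integration by parts, the [L2] isometry behind the Beurling
    transform, bounds [(d_z phi) * G] in [L2]; letting [e] tend to [0] yields a
    Campanato-type decay of the mean oscillation of [F] at the price of the oscillation of
    [G].  Since the nonlinearity is Lipschitz in [1 / xi], the oscillation of [G] is at most
    [K / |A|] times that of [F] plus [r ^ alpha] as soon as the mean [A] of [F] is large.
    Hence the sum of [|A|] and of a multiple of the mean oscillation grows by at most a
    geometric series from scale to scale, the means of [F] stay bounded, and the
    mollifications of [h] are uniformly Lipschitz; they converge since [G] is bounded.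

    For the second part, [h = max (x, 0)] on a square satisfies [|h_z| <= 1/2] and
    [J_h = 0], so with [R = 1] the equation is an empty condition. *)

(** A bound on [h_zbar] alone does not suffice: the Beurling transform maps bounded functions only
    into BMO, so the mean of [F] could drift by a fixed amount at every scale and diverge
    logarithmically. The factor [1 / |A|] stops this, since a drift can persist only while the mean
    is below a fixed threshold. The exponent [alpha] matters through the summability of
    [(t^k s0)^alpha] over the scales. The Jacobian is used exactly where the equation says nothing:
    if [|h_z| <= R], then [|h_zbar| <= |h_z| <= R]. No singular integral occurs. [phi] is the
    difference of two regularised Cauchy kernels that agree beyond radius [r], hence it is smooth
    with compact support and, once reflected and translated, a legitimate test function. Its [L2]
    bound does not depend on the inner radius [e], which permits [e] to tend to [0]. The means of
    [F] are values of [eta r * F] rather than averages over squares, so that the same kernels also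
    mollify [h]. *)

Notation mes2 f := (@measurable_fun _ _ (measurableTypeR _ * measurableTypeR _)%type _ setT f).
Notation int2 f := ((@area _).-integrable setT (EFin \o f)).

(** * Boxes and Lebesgue measure in the plane *)

(** Closed squares of half-side [r] are used instead of discs, because compactness and area then
    come from dimension one. For negative [r] the square is empty, a case that [area_box_lty] treats
    apart. *)
Definition box (R : realType) (c : R * R) (r : R) : set (R * R) :=
  `[c.1 - r, c.1 + r]%classic `*` `[c.2 - r, c.2 + r]%classic.

Lemma boxE (R : realType) (c p : R * R) (r : R) :
  box c r p <-> `|p.1 - c.1| <= r /\ `|p.2 - c.2| <= r.
Proof.
rewrite /box /= !in_itv /= !ler_norml; split => -[/andP[a b] /andP[e f]];
 split; apply/andP; lra.
Qed.

Lemma box_sub (R : realType) (c d : R * R) (r s : R) :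
  `|c.1 - d.1| <= s - r -> `|c.2 - d.2| <= s - r -> box c r `<=` box d s.
Proof.
move=> h1 h2 p /boxE[p1 p2]; apply/boxE; split.
  have -> : p.1 - d.1 = (p.1 - c.1) + (c.1 - d.1) by ring.
  by apply: (le_trans (ler_normD _ _)); lra.
have -> : p.2 - d.2 = (p.2 - c.2) + (c.2 - d.2) by ring.
by apply: (le_trans (ler_normD _ _)); lra.
Qed.

Lemma measurable_box (R : realType) (c : R * R) (r : R) :
  measurable (box c r : set (measurableTypeR R * measurableTypeR R)).
Proof. exact: measurableX. Qed.
#[global] Hint Extern 0 (measurable (box _ _)) => apply: measurable_box : core.

Lemma compact_box (R : realType) (c : R * R) (r : R) : compact (box c r).
Proof. apply: compact_setX; exact: segment_compact. Qed.

Lemma area_box (R : realType) (c : R * R) (r : R) : 0 <= r ->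
  @area R (box c r) = (4 * r ^+ 2)%:E.
Proof.
move=> r0; rewrite /box.
transitivity ((@lebesgue_measure R) [set` `[c.1 - r, c.1 + r]%R] *
              (@lebesgue_measure R) [set` `[c.2 - r, c.2 + r]%R])%E.
  exact: product_measure1E.
rewrite !lebesgue_measure_itv /= !lte_fin.
have [r1|r1] := ltP 0 r; last first.
  have -> : r = 0 by apply/eqP; rewrite eq_le r1 r0.
  by rewrite !addr0 !subr0 !ltxx mule0 expr0n /= mulr0.
have -> : c.1 - r < c.1 + r by lra.
have -> : c.2 - r < c.2 + r by lra.
rewrite -!EFinB -EFinM; congr EFin; ring.
Qed.

Lemma area_box_lty (R : realType) (c : R * R) (r : R) : (@area R (box c r) < +oo)%E.
Proof.
have [r0|r0] := leP 0 r; first by rewrite area_box// ltry.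
suff -> : box c r = set0 by rewrite measure0.
apply/seteqP; split => // p /boxE[p1 _]; have := normr_ge0 (p.1 - c.1); lra.
Qed.

Lemma nbhs_box (R : realType) (p : R * R) (A : set (R * R)) :
  nbhs p A <-> exists2 e : R, 0 < e & box p e `<=` A.
Proof.
split.
  move=> /nbhs_ballP[e /= e0 eA]; exists (e / 2); first by rewrite divr_gt0.
  move=> q /boxE[q1 q2]; apply: eA; split => /=;
    rewrite /ball /= distrC; apply: le_lt_trans; eauto; lra.
move=> [e e0 eA]; apply/nbhs_ballP; exists e => //= q [q1 q2]; apply: eA.
by apply/boxE; split; rewrite distrC ltW.
Qed.

(** The measurable sets are those of the product structure, so an open set has to be reduced to
    rectangles: it is the countable union of the squares with rational centre and radius
    [1 / (n + 1)] that it contains. *)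
Lemma open_measurable2 (R : realType) (A : set (R * R)) : open A ->
  measurable (A : set (measurableTypeR R * measurableTypeR R)).
Proof.
move=> oA.
pose D := [set q : rat * rat * nat | box (ratr q.1.1 : R, ratr q.1.2 : R) q.2.+1%:R^-1 `<=` A].
have -> : A = \bigcup_(q : rat * rat * nat)
   (if q \in D then box (ratr q.1.1 : R, ratr q.1.2 : R) q.2.+1%:R^-1 else set0).
  apply/seteqP; split => [p Ap|p [q _]]; last first.
    by case: ifPn => // /set_mem; apply.
  have : nbhs p A by apply: open_nbhs_nbhs.
  move=> /nbhs_box[e e0 eA].
  have [n hn] : exists n, (n.+1%:R^-1 : R) < e / 2.
    have : \forall n \near \oo, (n.+1%:R^-1 : R) < e / 2.
      by apply: near_infty_natSinv_lt (PosNum (_ : 0 < e / 2)); rewrite divr_gt0.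
    by move=> [n _ /(_ n (leqnn n))]; exists n.
  have n0 : 0 < (n.+1%:R^-1 : R) by rewrite invr_gt0.
  have lt1 (x : R) : x < x + n.+1%:R^-1 by rewrite ltrDl.
  have [q1 /itvP q1P] := rat_in_itvoo (lt1 p.1).
  have [q2 /itvP q2P] := rat_in_itvoo (lt1 p.2).
  have a1 : p.1 < ratr q1 by rewrite q1P.
  have a2 : ratr q1 < p.1 + n.+1%:R^-1 by rewrite q1P.
  have b1 : p.2 < ratr q2 by rewrite q2P.
  have b2 : ratr q2 < p.2 + n.+1%:R^-1 by rewrite q2P.
  exists (q1, q2, n) => //=; rewrite ifT.
    clear hn lt1 q1P q2P; move: (n.+1%:R^-1 : R) n0 a2 b2 => d n0 a2 b2.
    by apply/boxE => /=; split; rewrite ler_norml; apply/andP; lra.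
  apply/mem_set; rewrite /D /=.
  clear lt1 q1P q2P; move: (n.+1%:R^-1 : R) hn n0 a2 b2 => d hn n0 a2 b2.
  apply: subset_trans eA; apply: box_sub => /=;
   rewrite ler_norml; apply/andP; lra.
apply: countable_bigcupT_measurable => // q; case: ifPn => // _; exact: measurable_box.
Qed.

Lemma continuous_measurable2 (R : realType) (f : R * R -> R) : continuous f ->
  measurable_fun setT (f : measurableTypeR R * measurableTypeR R -> R).
Proof.
move=> /continuousP cf; apply: (measurability _ (measurable_realfun.RGenOpens.measurableE R)).
move=> _ [_ [a [b ->] <-]]; rewrite setTI.
by apply: open_measurable2; apply/cf/interval_open.
Qed.

(** * Point reflections preserve the area *)

Lemma measurable_reflect1 (R : realType) (a : R) :
  measurable_fun [set: measurableTypeR R]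
    ((fun w => a - w) : measurableTypeR R -> measurableTypeR R).
Proof. by apply: measurable_funB. Qed.

Lemma measurable_reflect (R : realType) (a : R * R) :
  measurable_fun [set: measurableTypeR R * measurableTypeR R]
    ((fun w => a - w) : _ -> measurableTypeR R * measurableTypeR R).
Proof.
apply/measurable_fun_pairP; split.
  exact: (measurableT_comp (measurable_reflect1 a.1) measurable_fst).
exact: (measurableT_comp (measurable_reflect1 a.2) measurable_snd).
Qed.

(** By uniqueness of Lebesgue measure a comparison on half-open intervals is enough, and there
    reflection only exchanges the open and the closed end. This is the change of variables behind
    the convolutions [ka (z - w)]. *)
Lemma lebesgue_measure_reflect (R : realType) (a : R) (A : set (measurableTypeR R)) :
  measurable A ->
  @lebesgue_measure R ((fun x => a - x) @^-1` A) = lebesgue_measure A.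
Proof.
move=> mA; symmetry.
pose m := measure_function_pushforward__canonical__measure_function_Measure
  (@lebesgue_measure R) (measurable_reflect1 a).
apply: (@lebesgue_measure_unique R m) => // _ [[c b] _ <-].
rewrite /= /pushforward /=.
rewrite (_ : _ @^-1` _ = [set` `[a - b, a - c[ ]); last first.
  by apply/seteqP; split => x /=; rewrite !in_itv /= => /andP[h1 h2];
    apply/andP; lra.
rewrite !lebesgue_measure_itv/=.
rewrite !lte_fin ltrD2l ltrN2; case: ifP => // _.
by rewrite -!EFinB; congr EFin; ring.
Qed.

Lemma area_reflect (R : realType) (a : R * R)
    (A : set (measurableTypeR R * measurableTypeR R)) : measurable A ->
  @area R ((fun w => a - w) @^-1` A) = @area R A.
Proof.
move=> mA; symmetry.
pose m := measure_function_pushforward__canonical__measure_function_Measure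
  (@area R) (measurable_reflect a).
apply: (@product_measure_unique _ _ _ _ _ _ _ m) => // A1 A2 mA1 mA2.
rewrite /= /pushforward /=.
rewrite (_ : _ @^-1` _ = ((fun x => a.1 - x) @^-1` A1) `*` ((fun x => a.2 - x) @^-1` A2)) //.
have m1 := measurable_reflect1 a.1 measurableT mA1.
have m2 := measurable_reflect1 a.2 measurableT mA2.
rewrite !setTI in m1 m2.
rewrite /area product_measure1E //.
by congr (_ * _)%E; apply: lebesgue_measure_reflect.
Qed.

Lemma integral_reflect (R : realType) (a : R * R) (f : R * R -> \bar R) :
  mes2 f ->
  (forall x, 0 <= f x)%E ->
  (\int[@area R]_w f (a - w)%R = \int[@area R]_w f w)%E.
Proof.
move=> mf f0.
pose m := measure_function_pushforward__canonical__measure_function_Measure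
  (@area R) (measurable_reflect a).
transitivity (\int[m]_w f w)%E.
  by rewrite (ge0_integral_pushforward (measurable_reflect a) (@area R) measurableT mf).
by apply: eq_measure_integral => A mA _; apply: area_reflect.
Qed.

Lemma integrable_reflect (R : realType) (a : R * R) (f : R * R -> R) :
  int2 f ->
  int2 (fun w => f (a - w)).
Proof.
move=> /integrableP[mf f0]; apply/integrableP; split.
  exact: (measurableT_comp mf (measurable_reflect a)).
rewrite (integral_reflect a (f := fun w => `|(f w)%:E|%E)) //.
exact: measurableT_comp.
Qed.

Lemma Rintegral_reflect (R : realType) (a : R * R) (f : R * R -> R) :
  int2 f ->
  \int[@area R]_w f (a - w) = \int[@area R]_w f w.
Proof.
move=> fi; have fa := integrable_reflect a fi.
have /integrableP[mf _] := fi.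
rewrite /Rintegral; congr fine.
pose m := measure_function_pushforward__canonical__measure_function_Measure
  (@area R) (measurable_reflect a).
transitivity (\int[m]_w (f w)%:E)%E.
  by rewrite (integral_pushforward (measurable_reflect a) mf).
by apply: eq_measure_integral => A mA _; apply: area_reflect.
Qed.

Lemma integrable_bounded_box (R : realType) (f : R * R -> R) (c : R * R) (r M : R) :
  mes2 f ->
  (forall z, `|f z| <= M) -> (forall z, ~ box c r z -> f z = 0) ->
  int2 f.
Proof.
move=> mf fM f0.
have -> : EFin \o f = (EFin \o f) \_ (box c r).
  apply/funext => z /=; rewrite patchE; case: ifPn => // /negP zb.
  by rewrite f0// => bz; apply: zb; apply/mem_set.
rewrite -integrable_mkcond; last exact: measurable_box.
apply: measurable_bounded_integrable; [exact: measurable_box|exact: area_box_lty| |].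
  exact: measurable_funTS.
exists M; split; rewrite ?num_real // => x Mx z _ /=.
by apply: le_trans (ltW Mx); apply: fM.
Qed.

Lemma continuous_box_bounded (R : realType) (f : R * R -> R) (c : R * R) (r : R) :
  continuous f -> (forall z, ~ box c r z -> f z = 0) ->
  exists2 M, 0 <= M & forall z, `|f z| <= M.
Proof.
move=> cf f0.
have [M [_ MP]] : bounded_set (f @` box c r).
  apply: compact_bounded; apply: continuous_compact; last exact: compact_box.
  exact: continuous_subspaceT.
exists (`|M| + 1) => [|z]; first by rewrite addr_ge0.
have [zb|zb] := pselect (box c r z); last by rewrite f0 // normr0 addr_ge0.
apply: (MP (`|M| + 1)); last by exists z.
by rewrite (le_lt_trans (ler_norm M))// ltrDl.
Qed.

Lemma integrable_continuous_box (R : realType) (f : R * R -> R) (c : R * R) (r : R) :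
  continuous f -> (forall z, ~ box c r z -> f z = 0) ->
  int2 f.
Proof.
move=> cf f0; have [M _ fM] := continuous_box_bounded cf f0.
exact: (integrable_bounded_box (continuous_measurable2 cf) fM f0).
Qed.

(** * Restriction to coordinate lines; integrals of partial derivatives *)

Definition supp (R : realType) (c : R * R) (r : R) (f : R * R -> R) :=
  forall z, ~ box c r z -> f z = 0.

(** The parameter is the coordinate itself rather than the displacement from [p], so that the mean
    value theorem and the fundamental theorem of calculus apply on fixed intervals. *)
Definition line (R : realType) (k : bool) (f : R * R -> R) (p : R * R) : R -> R :=
  fun t => if k then f (p.1, t) else f (t, p.2).

Definition crd (R : realType) (k : bool) (p : R * R) : R := if k then p.2 else p.1.

Lemma axisE (R : realType) (k : bool) (p : R * R) h :
  h *: axis R k + p = if k then (p.1, h + p.2) else (h + p.1, p.2).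
Proof.
case: k; rewrite /axis; apply/eqP; rewrite xpair_eqE /=; apply/andP; split;
  apply/eqP; rewrite /GRing.scale /= ?mulr1 ?mulr0 ?add0r //.
Qed.

Lemma line_quot (R : realType) (k : bool) (f : R * R -> R) (p : R * R) :
  (fun h : R => h^-1 *: (f (h *: axis R k + p) - f p)) =
  (fun h : R => h^-1 *: (line k f p (h *: 1 + crd k p) - line k f p (crd k p))).
Proof.
apply/funext => h; rewrite axisE /line /crd.
have -> : h *: (1 : R) = h by rewrite /GRing.scale /= mulr1.
by case: k; rewrite -?surjective_pairing.
Qed.

Lemma derivable_line (R : realType) (k : bool) (f : R * R -> R) (p : R * R) :
  derivable f p (axis R k) <-> derivable (line k f p) (crd k p) 1.
Proof. by rewrite /derivable -line_quot. Qed.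

Lemma partial_line (R : realType) (k : bool) (f : R * R -> R) (p : R * R) :
  partial k f p = 'D_1 (line k f p) (crd k p).
Proof. by rewrite /partial /derive -line_quot. Qed.

Lemma supp_partial (R : realType) (k : bool) (c : R * R) (r : R) (f : R * R -> R) :
  supp c r f -> supp c r (partial k f).
Proof.
move=> sf z zb; rewrite partial_line.
suff : \forall t \near crd k z, line k f z t = 0.
  move=> h; rewrite (near_eq_derive (g := cst 0)) ?derive_cst ?oner_neq0//.
have : open (~` box c r).
  rewrite openC; apply: compact_closed; first exact: norm_hausdorff.
  exact: compact_box.
move=> ob; have : nbhs z (~` box c r) by apply: open_nbhs_nbhs.
move=> /nbhs_box[e e0 eA].
near=> t; rewrite /line.
have te : `|t - crd k z| <= e.
  by rewrite distrC; near: t; apply: cvgr_dist_le => //; exact: cvg_id.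
case: (k) te => te; apply: sf; apply: eA; apply/boxE => /=; rewrite ?subrr ?normr0; split => //; exact: ltW.
Unshelve. all: by end_near. Qed.

Lemma supp_le (R : realType) (c : R * R) (r s : R) (f : R * R -> R) : r <= s ->
  supp c r f -> supp c s f.
Proof.
move=> rs sf z zb; apply: sf => zr; apply: zb; apply: box_sub zr;
 by rewrite subrr normr0 subr_ge0.
Qed.

Lemma continuous_line (R : realType) (k : bool) (f : R * R -> R) (p : R * R) :
  continuous f -> continuous (line k f p).
Proof.
move=> cf t; rewrite /line; case: k.
  apply: (@cvg_comp _ _ _ (fun t => (p.1, t)) f _ (nbhs (p.1, t)) _ _ (cf _)).
  exact: (cvg_pair (cvg_cst p.1) cvg_id).
apply: (@cvg_comp _ _ _ (fun t => (t, p.2)) f _ (nbhs (t, p.2)) _ _ (cf _)).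
exact: (cvg_pair cvg_id (cvg_cst p.2)).
Qed.

Lemma line_line (R : realType) (k : bool) (f : R * R -> R) (p : R * R) t :
  line k f (if k then (p.1, t) else (t, p.2)) = line k f p.
Proof. by case: k. Qed.

Lemma is_derive_line (R : realType) (k : bool) (f : R * R -> R) (p : R * R) (t : R) :
  (forall p, derivable f p (axis R k)) ->
  is_derive t 1 (line k f p) (line k (partial k f) p t).
Proof.
move=> df; have /derivable_line := df (if k then (p.1, t) else (t, p.2)).
have := partial_line k f (if k then (p.1, t) else (t, p.2)).
rewrite line_line => e d; split; first by case: (k) d.
by move: e; rewrite /line; case: (k) => /= ->.
Qed.

Lemma integral_line_partial (R : realType) (k : bool) (f : R * R -> R) (c : R * R)
    (r : R) p :
  supp c r f -> (forall p, derivable f p (axis R k)) -> continuous (partial k f) ->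
  (\int[@lebesgue_measure R]_t (line k (partial k f) p t)%:E = 0)%E.
Proof.
move=> sf df cdf.
(* Passing from [r] to [|r|] makes the interval [[a, b]] nondegenerate whatever the sign of [r]. *)
have := supp_le (ler_norm r) sf; move: `|r| (normr_ge0 r) => {sf}r r0 sf.
pose a := crd k c - (r + 1); pose b := crd k c + (r + 1).
have ab : a < b by rewrite /a /b; lra.
have out (g : R * R -> R) t : supp c r g -> (r < `|t - crd k c|) -> line k g p t = 0.
  move=> sg tr; rewrite /line /crd in tr *.
  by case: (k) tr => tr; apply: sg => /boxE[/=]; lra.
have -> : (\int[@lebesgue_measure R]_t (line k (partial k f) p t)%:E =
    \int[@lebesgue_measure R]_(t in `[a, b]) (line k (partial k f) p t)%:E)%E.
  rewrite [RHS]integral_mkcond; apply: eq_integral => t _.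
  rewrite patchE; case: ifPn => // /negP tab; rewrite out //; first exact: supp_partial.
  rewrite ltNge; apply/negP => h; apply: tab; apply/mem_set.
  rewrite /= in_itv /=; move: h; rewrite ler_norml => /andP[h1 h2].
  rewrite /a /b; apply/andP; lra.
have dl t := is_derive_line (k := k) p t df.
have cl := @continuous_line R k _ p cdf.
have clf : continuous (line k f p).
  by move=> t; apply: differentiable_continuous; apply/derivable1_diffP; have [] := dl t.
rewrite (@continuous_FTC2 _ _ (line k f p)) //.
- have lb : r < `|b - crd k c|.
    by rewrite /b (_ : _ - _ = r + 1) ?ger0_norm; lra.
  have la : r < `|a - crd k c|.
    by rewrite /a (_ : _ - _ = - (r + 1)) ?normrN ?ger0_norm; lra.
  by rewrite (out _ _ sf lb) (out _ _ sf la) -EFinB subrr.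
- exact: continuous_subspaceT.
- split.
  + by move=> t _; have [] := dl t.
  + by apply: cvg_at_right_filter; exact: clf.
  + by apply: cvg_at_left_filter; exact: clf.
- by move=> t _; rewrite derive1E; have [_ ->] := dl t.
Qed.

(** Fubini, with the inner integral taken in the direction of differentiation, where the fundamental
    theorem of calculus gives zero on every line. *)
Lemma integral_partial (R : realType) (k : bool) (f : R * R -> R) (c : R * R) (r : R) :
  supp c r f -> (forall p, derivable f p (axis R k)) -> continuous (partial k f) ->
  \int[@area R]_z partial k f z = 0.
Proof.
move=> sf df cdf.
have ig : int2 (partial k f) := integrable_continuous_box cdf (supp_partial k sf).
rewrite /Rintegral.
have L := integral_line_partial _ sf df cdf.
case: k df cdf ig L => df cdf ig L.
  rewrite -(integral12_prod_meas1 ig) /fubini_F integral0_eq//= => x _.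
  by have := L (x, 0).
rewrite -(integral21_prod_meas1 ig) /fubini_G integral0_eq//= => x _.
by have := L (0, x).
Qed.

(** * Smooth bump functions *)

(** A quadratic remainder is the form in which derivatives arise both for the flat function at [0]
    and for convolutions, where it replaces dominated convergence. *)
Lemma is_derive_quadratic (R : realType) (f : R -> R) (t l C : R) :
  (forall h, `|h| <= 1 -> `|f (h + t) - f t - h * l| <= C * h ^+ 2) -> is_derive t 1 f l.
Proof.
move=> H.
have C0 : 0 <= C.
  have := H 1; rewrite normr1 lexx expr1n mulr1 => /(_ isT); exact: le_trans.
have : h^-1 *: ((f \o shift t) (h *: (1 : R)) - f t) @[h --> 0^'] --> l.
  apply/subr_cvg0; apply: (@cvg_to_0_linear _ _ C 1) => // h /andP[h0 h1].
  have hn0 : h != 0 by rewrite -normr_gt0.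
  rewrite /= [h *: 1](_ : _ = h); last by rewrite /GRing.scale /= mulr1.
  rewrite [_ *: _](_ : _ = h^-1 * (f (h + t) - f t)) //.
  have -> : h^-1 * (f (h + t) - f t) - l = h^-1 * (f (h + t) - f t - h * l).
    by field.
  rewrite normrM normfV ler_pdivrMl //; apply: le_trans (H h (ltW h1)) _.
  by rewrite (_ : C * h ^+ 2 = `|h| * (C * `|h|)) // -[h ^+ 2]ger0_norm ?sqr_ge0// normrX; ring.
by move=> cv; split; [apply/cvg_ex; exists l|apply/cvg_lim].
Qed.

Lemma is_derive_add (R : realType) (f g : R -> R) (t a b : R) :
  is_derive t 1 f a -> is_derive t 1 g b ->
  is_derive t 1 (fun t => f t + g t) (a + b).
Proof. by move=> h1 h2; exact: is_deriveD. Qed.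

Lemma is_derive_mul (R : realType) (f g : R -> R) (t a b : R) :
  is_derive t 1 f a -> is_derive t 1 g b ->
  is_derive t 1 (fun t => f t * g t) (a * g t + f t * b).
Proof.
move=> h1 h2.
have D : is_derive t 1 (fun t => f t * g t) (f t *: b + g t *: a) := is_deriveM h1 h2.
apply: (is_derive_eq D); rewrite /GRing.scale /=; ring.
Qed.

Lemma is_derive_affine (R : realType) (f : R -> R) (t a b c : R) :
  is_derive (b * t + c) 1 f a -> is_derive t 1 (fun t => f (b * t + c)) (b * a).
Proof.
move=> h.
have h1 := is_derive_mul (is_derive_cst b t 1) (is_derive_id t 1).
have h2 := is_derive_add h1 (is_derive_cst c t 1).
have h3 := @is_derive1_comp R f (fun t => b * t + c) t _ _ h h2.
apply: (is_derive_eq h3); rewrite /cst; ring.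
Qed.

Lemma is_derive_exprn (R : realType) (n : nat) (t : R) :
  is_derive t 1 (fun t : R => t ^+ n) (n%:R * t ^+ n.-1).
Proof.
elim: n => [|n IH]; first by rewrite mul0r; exact: (is_derive_cst (1 : R) t 1).
have D := is_derive_mul (is_derive_id t 1) IH.
rewrite (_ : (fun t : R => t ^+ n.+1) = (fun t => t * t ^+ n)); last first.
  by apply/funext => x; rewrite exprS.
apply: (is_derive_eq D); case: n IH D => [|n] _ _ /=; rewrite ?expr0 ?exprS -?natr1; ring.
Qed.

Lemma is_derive_exprNn (R : realType) (n : nat) (t : R) : t != 0 ->
  is_derive t 1 (fun t : R => t^-1 ^+ n) (- n%:R * t^-1 ^+ n.+1).
Proof.
move=> t0; have h1 := is_deriveV t0 (is_derive_id t 1).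
have D := @is_derive1_comp R (fun t => t ^+ n) (fun t => t^-1) t _ _ (is_derive_exprn n t^-1) h1.
apply: (is_derive_eq D); rewrite /GRing.scale /=.
case: n D => [|n] _; first by rewrite !mul0r oppr0 mul0r.
rewrite -exprVn /= !exprS expr0; ring.
Qed.

(** The flat function [exp (-1/t)] with a polynomial in [1/t] in front: the polynomial closes the
    family under differentiation, [P] turning into [X^2 (P - P')]. *)
Definition expflat (R : realType) (P : {poly R}) (t : R) : R :=
  if 0 < t then P.[t^-1] * expR (- t^-1) else 0.

Lemma exprn_le_expR (R : realType) (n : nat) (s : R) : 0 <= s ->
  s ^+ n * expR (- s) <= n`!%:R.
Proof.
move=> s0; rewrite expRN ler_pdivrMr ?expR_gt0//.
case: n => [|n]; first by rewrite expr0 fact0 mul1r -expR0 ler_expR.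
have := expR_ge1Dxn n s0 => h.
have f0 : 0 < (n.+1)`!%:R :> R by rewrite ltr0n fact_gt0.
rewrite mulrC -ler_pdivrMr //; apply: le_trans h.
by rewrite lerDr.
Qed.

Lemma poly_expR_bounded (R : realType) (P : {poly R}) :
  exists2 C : R, 0 <= C & forall s : R, 0 <= s -> `|P.[s] * expR (- s)| <= C.
Proof.
exists (\sum_(i < size P) `|P`_i| * (i`!)%:R).
  by apply: sumr_ge0 => i _; rewrite mulr_ge0.
move=> s s0; rewrite horner_coef mulr_suml.
apply: le_trans (ler_norm_sum _ _ _) _; apply: ler_sum => i _.
rewrite -mulrA normrM ler_wpM2l // ger0_norm ?exprn_le_expR//.
by rewrite mulr_ge0 ?expR_ge0 ?exprn_ge0.
Qed.

Lemma is_derive_expflat (R : realType) (P : {poly R}) (t : R) :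
  is_derive t 1 (expflat P) (expflat ('X^2 * (P - P^`())) t).
Proof.
have [t0|t0|->] := ltgtP t 0.
- rewrite [expflat ('X^2 * _) t](_ : _ = 0); last by rewrite /expflat ltNge ltW.
  apply: (near_eq_is_derive _ (is_derive_cst (0 : R) t 1)).
  near=> s; rewrite /expflat ifF // /cst; apply/negbTE; rewrite -leNgt ltW//.
  by near: s; exact: lt_nbhsl.
- have tn0 : t != 0 by rewrite gt_eqF.
  have d1 : is_derive t 1 (fun t : R => t^-1) (- t^-1 ^+ 2).
    by apply: (is_derive_eq (is_derive_exprNn 1 tn0)); rewrite mulN1r.
  have d2 : is_derive t 1 (fun t : R => - t^-1) (t^-1 ^+ 2).
    by apply: (is_derive_eq (is_deriveN d1)); rewrite opprK.
  have d3 := is_derive1_comp (is_derive_poly P t^-1) d1.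
  have d4 := @is_derive1_comp R expR (fun t => - t^-1) t _ _ (is_derive_expR _) d2.
  have D : is_derive t 1 (fun t => P.[t^-1] * expR (- t^-1))
      (expflat ('X^2 * (P - P^`())) t).
    apply: (is_derive_eq (is_derive_mul d3 d4)).
    by rewrite /expflat t0 !hornerE /=; ring.
  apply: (near_eq_is_derive _ D).
  by near=> s; rewrite /expflat ifT //; near: s; exact: lt_nbhsr.
- rewrite [expflat ('X^2 * _) 0](_ : _ = 0); last by rewrite /expflat ltxx.
  (* At the origin the increment is [O(h^2)], because [P(s) s^2 exp (-s)] stays bounded at
     [s = 1/h]. *)
  have [C C0 HC] := poly_expR_bounded (P * 'X^2).
  apply: (@is_derive_quadratic _ _ _ _ C) => h _.
  rewrite addr0 mulr0 subr0 [expflat P 0](_ : _ = 0) ?subr0; last by rewrite /expflat ltxx.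
  rewrite /expflat; case: ifPn => h0; last by rewrite normr0 mulr_ge0 ?sqr_ge0.
  have hn0 : h != 0 by rewrite gt_eqF.
  have hV0 : 0 <= h^-1 by rewrite invr_ge0 ltW.
  have := HC _ hV0.
  rewrite (_ : (P * 'X^2).[h^-1] = P.[h^-1] * h^-1 ^+ 2) => [H|]; last first.
    by rewrite hornerM hornerXn.
  have -> : P.[h^-1] * expR (- h^-1) = (P.[h^-1] * h^-1 ^+ 2 * expR (- h^-1)) * h ^+ 2.
    by field.
  by rewrite normrM [`|h ^+ 2|]ger0_norm ?sqr_ge0// ler_wpM2r ?sqr_ge0.
Unshelve. all: by end_near. Qed.

(* Smoothness in the sense of the iterated partial derivatives of [Defs] is obtained once,
   for an inductive class of functions that is closed under differentiation. *)
Inductive smooth1 (R : realType) : (R -> R) -> Prop :=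
| smooth1_exp P : smooth1 (expflat P)
| smooth1_cst c : smooth1 (fun=> c)
| smooth1_add f g : smooth1 f -> smooth1 g -> smooth1 (fun t => f t + g t)
| smooth1_mul f g : smooth1 f -> smooth1 g -> smooth1 (fun t => f t * g t)
| smooth1_aff f b c : smooth1 f -> smooth1 (fun t => f (b * t + c))
| smooth1_prim f F : smooth1 f -> (forall t : R, is_derive t (1 : R) F (f t)) -> smooth1 F
| smooth1_div f n d : smooth1 f -> 0 < d -> (forall t, t < d -> f t = 0) ->
    smooth1 (fun t => f t * t^-1 ^+ n).

Lemma smooth1_derive (R : realType) (f : R -> R) : smooth1 f ->
  exists2 f', smooth1 f' & forall t : R, is_derive t (1 : R) f (f' t).
Proof.
elim=> {f} [P|c|f g _ [f' sf df] _ [g' sg dg]|f g sf0 [f' sf df] sg0 [g' sg dg]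
          |f b c _ [f' sf df]|f F sf _ dF|f n d sf0 [f' sf df] d0 fd0].
- exists (expflat ('X^2 * (P - P^`()))); first exact: smooth1_exp.
  exact: is_derive_expflat.
- exists (fun=> 0); [exact: smooth1_cst|by move=> t; exact: (is_derive_cst c t 1)].
- exists (fun t => f' t + g' t); first exact: smooth1_add.
  by move=> t; exact: is_derive_add.
- exists (fun t => f' t * g t + f t * g' t).
    by apply: smooth1_add; exact: smooth1_mul.
  by move=> t; exact: is_derive_mul.
- exists (fun t => b * f' (b * t + c)).
    by apply: (smooth1_mul (smooth1_cst b)); exact: smooth1_aff.
  by move=> t; apply: is_derive_affine.
- by exists f.
(* The numerator vanishes below [d > 0], and so does its derivative; hence the quotient rule stays
   inside the class. *)
have f'0 t : t < d -> f' t = 0.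
  move=> td; have [_ <-] := df t.
  rewrite (near_eq_derive (g := cst 0)) ?derive_cst //.
  by near=> s; apply: fd0; near: s; exact: lt_nbhsl.
exists (fun t => f' t * t^-1 ^+ n + (- n%:R) * (f t * t^-1 ^+ n.+1)).
  apply: smooth1_add; first exact: (smooth1_div _ sf d0).
  by apply: (smooth1_mul (smooth1_cst _)); exact: (smooth1_div _ sf0 d0).
move=> t; have [td|td] := ltP t d.
  rewrite f'0 // fd0 // !mul0r mulr0 addr0.
  apply: (near_eq_is_derive _ (is_derive_cst (0 : R) t 1)).
  by near=> s; rewrite fd0 ?mul0r //; near: s; exact: lt_nbhsl.
have tn0 : t != 0 by rewrite gt_eqF // (lt_le_trans d0).
apply: (is_derive_eq (is_derive_mul (df t) (is_derive_exprNn n tn0))).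
by congr (_ + _); ring.
Unshelve. all: by end_near. Qed.

Lemma smooth1_is_derive (R : realType) (f : R -> R) (t : R) : smooth1 f ->
  is_derive t (1 : R) f (f^`()%classic t).
Proof.
move=> /smooth1_derive[f' sf df]; rewrite derive1E.
by have [d e] := df t; split => //.
Qed.

Lemma smooth1_derive1 (R : realType) (f : R -> R) : smooth1 f -> smooth1 f^`()%classic.
Proof.
move=> /smooth1_derive[f' sf df]; rewrite (_ : f^`()%classic = f') //.
by apply/funext => t; rewrite derive1E; have [_ ->] := df t.
Qed.

Lemma smooth1_continuous (R : realType) (f : R -> R) : smooth1 f -> continuous f.
Proof.
move=> sf t; apply: differentiable_continuous; apply/derivable1_diffP.
by have [] := smooth1_is_derive t sf.
Qed.

(* A bump with support [[1/2, 1]]; the affine arguments have the shape of [smooth1_aff]. *)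
Definition omega (R : realType) (t : R) : R :=
  expflat 1 (1 * t - 2^-1) * expflat 1 (- 1 * t + 1).

Definition beta (R : realType) (t : R) : R :=
  if 0 < t then \int[@lebesgue_measure R]_(s in `[0, t]) omega s else 0.

(** The radial field [z gam(|z|^2)] has divergence [2 omega(|z|^2)] and, outside the unit disc,
    equals [beta 1] times [z / |z|^2], the Cauchy kernel up to conjugation. The vanishing of [omega]
    below [1/2] makes the division by [t] smooth; the exponent [1] fits [smooth1_div]. *)
Definition gam (R : realType) (t : R) : R := beta t * t^-1 ^+ 1.

Lemma smooth1_omega (R : realType) : smooth1 (@omega R).
Proof.
by apply: smooth1_mul; apply: smooth1_aff; exact: smooth1_exp.
Qed.

Lemma expflat1_ge0 (R : realType) (t : R) : 0 <= expflat 1 t.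
Proof. by rewrite /expflat; case: ifP => // _; rewrite hornerE mul1r expR_ge0. Qed.

Lemma omega_ge0 (R : realType) (t : R) : 0 <= omega t.
Proof. by rewrite mulr_ge0 ?expflat1_ge0. Qed.

Lemma omega_lt (R : realType) (t : R) : t < 2^-1 -> omega t = 0.
Proof.
by move=> t2; rewrite /omega {1}/expflat ifF ?mul0r//; apply/negbTE; rewrite -leNgt; lra.
Qed.

Lemma omega_gt (R : realType) (t : R) : 1 <= t -> omega t = 0.
Proof.
by move=> t2; rewrite /omega [X in _ * X]/expflat ifF ?mulr0//; apply/negbTE; rewrite -leNgt; lra.
Qed.

Lemma omega_gt0 (R : realType) (t : R) : 2^-1 < t < 1 -> 0 < omega t.
Proof.
move=> /andP[h1 h2]; rewrite /omega /expflat.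
rewrite (_ : 0 < 1 * t - 2^-1); last lra.
rewrite (_ : 0 < - 1 * t + 1); last lra.
have e1 (x : R) : (1 : {poly R}).[x] = 1 by rewrite hornerE.
by rewrite !e1 !mulr_gt0 ?ltr01 ?expR_gt0.
Qed.

Lemma omega_integrable (R : realType) (a b : R) :
  (@lebesgue_measure R).-integrable `[a, b] (EFin \o @omega R).
Proof.
apply: continuous_compact_integrable; first exact: segment_compact.
by apply: continuous_subspaceT; apply: smooth1_continuous; exact: smooth1_omega.
Qed.

Lemma beta_lt (R : realType) (t : R) : t < 2^-1 -> beta t = 0.
Proof.
move=> t2; rewrite /beta; case: ifP => // t0; rewrite /Rintegral integral0_eq // => s.
by rewrite /= in_itv /= => /andP[_ st]; rewrite omega_lt // (le_lt_trans st).
Qed.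

Lemma is_derive_beta (R : realType) (t : R) : is_derive t (1 : R) (@beta R) (omega t).
Proof.
have [t2|t2] := ltP t 2^-1.
  rewrite omega_lt //; apply: (near_eq_is_derive _ (is_derive_cst (0 : R) t 1)).
  by near=> s; rewrite beta_lt //; near: s; exact: lt_nbhsl.
have t0 : 0 < t by apply: lt_le_trans t2; rewrite invr_gt0.
have t1 : t < t + 1 by rewrite ltrDl.
have [d e] := continuous_FTC1_closed t1 (omega_integrable 0 (t + 1)) t0
  (smooth1_continuous (smooth1_omega R) (x := t)).
rewrite derive1E in e.
have D := derivableP d; rewrite e in D.
apply: (near_eq_is_derive _ D).
by near=> s; rewrite /beta ifT //; near: s; exact: lt_nbhsr.
Unshelve. all: by end_near. Qed.

Lemma beta_ge1 (R : realType) (t : R) : 1 <= t -> beta t = beta 1.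
Proof.
move=> t1; have t0 : 0 < t by exact: lt_le_trans t1.
rewrite /beta t0 ltr01; apply/eqP; rewrite -subr_eq0.
rewrite (Rintegral_itvB (omega_integrable 0 t)) ?bnd_simp //.
rewrite /Rintegral integral0_eq // => s; rewrite /= in_itv /= => /andP[s1 _].
by rewrite omega_gt // ltW.
Qed.

Lemma smooth1_gam (R : realType) : smooth1 (@gam R).
Proof.
have sb : smooth1 (@beta R) := smooth1_prim (smooth1_omega R) (@is_derive_beta R).
apply: (@smooth1_div R _ 1 2^-1 sb); first by rewrite invr_gt0.
exact: beta_lt.
Qed.

Lemma gam_ge1 (R : realType) (t : R) : 1 <= t -> gam t = beta 1 / t.
Proof. by move=> t1; rewrite /gam beta_ge1 // expr1. Qed.

(** This is the derivative of [t * gam t], which equals [beta t] also at [0] because [beta] vanishes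
    below [1/2]. *)
Lemma gamE (R : realType) (t : R) : gam t + t * (@gam R)^`()%classic t = omega t.
Proof.
have D := is_derive_mul (is_derive_id t 1) (smooth1_is_derive t (smooth1_gam R)).
have E : (fun t => id t * gam t) = @beta R.
  apply/funext => x; rewrite /gam expr1 /=.
  have [->|x0] := eqVneq x 0; last by field.
  by rewrite mul0r beta_lt // invr_gt0.
have [_ e1] := D; have [_ e2] := is_derive_beta t.
by rewrite -e2 -E e1 mul1r.
Qed.

(** * Kernels: sums of monomials times smooth radial functions *)

Definition mon (R : realType) (c : R) (i j : nat) (b : R -> R) : R * R -> R :=
  fun p => c * p.1 ^+ i * p.2 ^+ j * b (p.1 ^+ 2 + p.2 ^+ 2).

(** On this class differentiation is symbolic: it is closed under partial derivatives, and their
    continuity and symmetry can be read off explicit formulas. The mollifiers and the Cauchy kernels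
    all belong to it. *)
Inductive kernel (R : realType) : (R * R -> R) -> Prop :=
| kernel_mon c i j b : smooth1 b -> kernel (mon c i j b)
| kernel_add f g : kernel f -> kernel g -> kernel (fun p => f p + g p).

(** For exponent [0] the truncated predecessor is harmless, since the coefficient [i%:R] or [j%:R]
    in front of it vanishes. *)
Lemma is_derive_mon (R : realType) (k : bool) (c : R) i j b p : smooth1 b ->
  is_derive (crd k p) (1 : R) (line k (mon c i j b) p)
   (if k then mon (c * j%:R) i j.-1 b p + mon (c * 2) i j.+1 b^`()%classic p
    else mon (c * i%:R) i.-1 j b p + mon (c * 2) i.+1 j b^`()%classic p).
Proof.
move=> sb.
have dsq (x : R) (y : R) (t : R) : is_derive t (1 : R) (fun t => b (t ^+ 2 + y)) (b^`()%classic (t ^+ 2 + y) * (2 * t)).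
  have h2 := is_derive_add (is_derive_exprn 2 t) (is_derive_cst y t 1).
  have h := @is_derive1_comp R b (fun t => t ^+ 2 + y) t _ _ (smooth1_is_derive (t ^+ 2 + y) sb) h2.
  by apply: (is_derive_eq h); rewrite /= expr1; ring.
case: k; rewrite /line /crd.
  have D := is_derive_mul (is_derive_mul (is_derive_cst (c * p.1 ^+ i) p.2 1) (is_derive_exprn j p.2))
     (dsq 0 (p.1 ^+ 2) p.2).
  rewrite (_ : (fun t => mon c i j b (p.1, t)) = fun t => cst (c * p.1 ^+ i) t * t ^+ j * b (t ^+ 2 + p.1 ^+ 2)); last first.
    by apply/funext => t; rewrite /mon /cst /= [t ^+ 2 + _]addrC.
  apply: (is_derive_eq D); rewrite /mon /cst (addrC (p.2 ^+ 2)).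
  by move: (b _) (b^`()%classic _) => B B'; rewrite exprS; ring.
have D := is_derive_mul (is_derive_mul (is_derive_cst (c * p.2 ^+ j) p.1 1) (is_derive_exprn i p.1))
     (dsq 0 (p.2 ^+ 2) p.1).
rewrite (_ : (fun t => mon c i j b (t, p.2)) = fun t => cst (c * p.2 ^+ j) t * t ^+ i * b (t ^+ 2 + p.2 ^+ 2)); last first.
  by apply/funext => t; rewrite /mon /cst /=; ring.
apply: (is_derive_eq D); rewrite /mon /cst.
by move: (b _) (b^`()%classic _) => B B'; rewrite exprS; ring.
Qed.

Lemma partial_is_derive (R : realType) (k : bool) (f : R * R -> R) p l :
  is_derive (crd k p) (1 : R) (line k f p) l ->
  derivable f p (axis R k) /\ partial k f p = l.
Proof. by move=> [d e]; rewrite partial_line; split => //; apply/derivable_line. Qed.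

Lemma partial_mon (R : realType) (k : bool) (c : R) i j b : smooth1 b ->
  partial k (mon c i j b) =
   if k then (fun p => mon (c * j%:R) i j.-1 b p + mon (c * 2) i j.+1 b^`()%classic p)
    else (fun p => mon (c * i%:R) i.-1 j b p + mon (c * 2) i.+1 j b^`()%classic p).
Proof.
move=> sb; apply/funext => p.
by have [_ ->] := partial_is_derive (is_derive_mon k c i j p sb); case: k.
Qed.

Lemma partial_add (R : realType) (k : bool) (f g : R * R -> R) p :
  derivable f p (axis R k) -> derivable g p (axis R k) ->
  derivable (fun p => f p + g p) p (axis R k) /\
  partial k (fun p => f p + g p) p = partial k f p + partial k g p.
Proof. by move=> df dg; split; [exact: derivableD|exact: deriveD]. Qed.

Lemma kernel_derivable (R : realType) (k : bool) (f : R * R -> R) p : kernel f ->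
  derivable f p (axis R k).
Proof.
elim=> {f} [c i j b sb|f g _ df _ dg].
  by have [] := partial_is_derive (is_derive_mon k c i j p sb).
by have [] := partial_add df dg.
Qed.

Arguments kernel_derivable {R} k {f} p _.

Lemma kernel_partial_add (R : realType) (k : bool) (f g : R * R -> R) :
  kernel f -> kernel g ->
  partial k (fun p => f p + g p) = (fun p => partial k f p + partial k g p).
Proof.
move=> kf kg; apply/funext => p.
by have [] := partial_add (kernel_derivable k p kf) (kernel_derivable k p kg).
Qed.

Lemma kernel_partial (R : realType) (k : bool) (f : R * R -> R) : kernel f ->
  kernel (partial k f).
Proof.
elim=> {f} [c i j b sb|f g kf kf' kg kg'].
  rewrite partial_mon //; have sb' := smooth1_derive1 sb.
  by case: k; apply: kernel_add; exact: kernel_mon.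
by rewrite kernel_partial_add //; exact: kernel_add.
Qed.

Lemma kernel_partialC (R : realType) (f : R * R -> R) : kernel f ->
  partial true (partial false f) = partial false (partial true f).
Proof.
elim=> {f} [c i j b sb|f g kf e kg e']; last first.
  rewrite (kernel_partial_add false kf kg) (kernel_partial_add true kf kg).
  rewrite (kernel_partial_add true (kernel_partial false kf) (kernel_partial false kg)).
  rewrite (kernel_partial_add false (kernel_partial true kf) (kernel_partial true kg)).
  by rewrite e e'.
have sb' := smooth1_derive1 sb.
rewrite !(partial_mon _ _ _ _ sb).
rewrite !(kernel_partial_add _ (kernel_mon _ _ _ sb) (kernel_mon _ _ _ sb')).
rewrite !(partial_mon _ _ _ _ sb) !(partial_mon _ _ _ _ sb').
by apply/funext => p; rewrite /mon; ring.
Qed.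

Lemma kernel_continuous (R : realType) (f : R * R -> R) : kernel f -> continuous f.
Proof.
elim=> {f} [c i j b sb|f g _ cf _ cg] p; last exact: cvgD (cf p) (cg p).
have f1 n : (fun q : R * R => q.1 ^+ n) q @[q --> p] --> p.1 ^+ n.
  by apply: (cvg_comp fst (fun x => x ^+ n)); [exact: cvg_fst|exact: exprn_continuous].
have f2 n : (fun q : R * R => q.2 ^+ n) q @[q --> p] --> p.2 ^+ n.
  by apply: (cvg_comp snd (fun x => x ^+ n)); [exact: cvg_snd|exact: exprn_continuous].
apply: (cvgM (cvgM (cvgM (cvg_cst c) (f1 i)) (f2 j))).
apply: (cvg_comp (fun q : R * R => q.1 ^+ 2 + q.2 ^+ 2) b (cvgD (f1 2) (f2 2))).
exact: smooth1_continuous.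
Qed.

Definition refl (R : realType) (a : R * R) (f : R * R -> R) : R * R -> R :=
  fun w => f (a - w).

Lemma partial_refl (R : realType) (k : bool) (a : R * R) (f : R * R -> R) p :
  derivable f (a - p) (axis R k) ->
  derivable (refl a f) p (axis R k) /\
  partial k (refl a f) p = - partial k f (a - p).
Proof.
move=> /derivable_line/derivableP d.
have e : crd k (a - p) = (-1) * crd k p + crd k a.
  by rewrite mulN1r addrC; case: (k).
rewrite e in d.
apply: partial_is_derive.
rewrite (_ : line k (refl a f) p = (fun t => line k f (a - p) (-1 * t + crd k a))); last first.
  apply/funext => t; rewrite /line /refl /crd; case: (k); congr (f _);
  by rewrite mulN1r [- t + _]addrC.
apply: (is_derive_eq (is_derive_affine d)); rewrite partial_line e.
exact: mulN1r.
Qed.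

Lemma smooth_refl (R : realType) (a : R * R) (f : R * R -> R) : kernel f ->
  smooth (refl a f).
Proof.
move=> kf s.
(* Every iterated derivative of a reflected kernel is, up to sign, a reflected kernel; this stronger
   claim is what passes through the induction on the list of directions. *)
suff [n [g kg ->]] : exists n, exists2 g, kernel g &
    foldr (@partial R) (refl a f) s = fun w => (-1) ^+ n * refl a g w.
  have dg k p : derivable (refl a g) p (axis R k).
    by have [] := partial_refl (kernel_derivable k (a - p) kg).
  split; last by move=> k p; apply: derivableM => //; exact: derivable_cst.
  move=> p; apply: cvgM; first exact: cvg_cst.
  have h1 : (a - w) @[w --> p] --> a - p.
    by apply: cvgB; [exact: cvg_cst|exact: cvg_id].
  have h2 : g w @[w --> a - p] --> g (a - p) := @kernel_continuous R g kg (a - p).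
  exact: (cvg_comp _ _ h1 h2).
elim: s => [|k s [n [g kg e]]] /=.
  by exists 0%N, f => //; apply/funext => w; rewrite expr0 mul1r.
exists n.+1, (partial k g); first exact: kernel_partial.
rewrite e; apply/funext => w.
have [d1 d2] := partial_refl (kernel_derivable k (a - w) kg).
rewrite /partial in d2 *.
by rewrite deriveZ //= d2 /refl /GRing.scale /= exprS; ring.
Qed.

(** This turns the definition of a weak derivative into identities between convolutions: tested
    against [w |-> f (a - w)], an integral over [Om] becomes a convolution evaluated at [a]. *)
Lemma test_function_refl (R : realType) (Om : set (Cplx R)) (a : R * R) (r : R)
    (f : R * R -> R) :
  kernel f -> supp 0 r f -> box a r `<=` coords Om -> test_function Om (refl a f).
Proof.
move=> kf sf rO.
have cl : closure [set p | refl a f p != 0] `<=` box a r.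
  have cb : closed (box a r).
    by apply: compact_closed; [exact: norm_hausdorff|exact: compact_box].
  rewrite [X in _ `<=` X]((closure_id _).1 cb); apply: closureS => p /= /eqP fp.
  apply: contrapT => pb; apply: fp; apply: sf => /boxE[/= h1 h2]; apply: pb.
  by apply/boxE; split; rewrite distrC; [move: h1|move: h2]; rewrite subr0.
split; [exact: smooth_refl| |exact: subset_trans rO].
exact: (subclosed_compact (@closed_closure _ _) (compact_box (c := a) (r := r)) cl).
Qed.

(** * Mollifiers and Cauchy kernels *)

(** The mass of the unnormalised bump is kept as an integral; polar coordinates never enter. *)
Definition c0 (R : realType) : R := \int[@area R]_z omega (z.1 ^+ 2 + z.2 ^+ 2).

(** The mollifier of mass one, supported in the annulus [r^2 / 2 <= |z|^2 <= r^2]. The summand [0]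
    and the zero exponents give it the shapes of [smooth1_aff] and [mon]. *)
Definition eta (R : realType) (r : R) : R * R -> R :=
  mon (c0 R * r ^+ 2)^-1 0 0 (fun t => omega (r ^- 2 * t + 0)).

(* [gdiff e r t = (beta (t / e ^+ 2) - beta (t / r ^+ 2)) / t], so it vanishes for
   [r ^+ 2 <= t]. *)
Definition gdiff (R : realType) (e r : R) (t : R) : R :=
  e ^- 2 * gam (e ^- 2 * t + 0) + (- r ^- 2) * gam (r ^- 2 * t + 0).

(* [phi e r = xker e r - i yker e r] satisfies [dzbar phi = c0 (eta e - eta r)]. *)
Definition xker (R : realType) (e r : R) := mon (1 : R) 1 0 (gdiff e r).
Definition yker (R : realType) (e r : R) := mon (1 : R) 0 1 (gdiff e r).

Lemma smooth1_gdiff (R : realType) (e r : R) : smooth1 (gdiff e r).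
Proof.
apply: smooth1_add; apply: (smooth1_mul (smooth1_cst _));
  apply: smooth1_aff; exact: smooth1_gam.
Qed.

Lemma kernel_eta (R : realType) (r : R) : kernel (eta r).
Proof. apply: kernel_mon; apply: smooth1_aff; exact: smooth1_omega. Qed.

Lemma kernel_xker (R : realType) (e r : R) : kernel (xker e r).
Proof. by apply: kernel_mon; exact: smooth1_gdiff. Qed.

Lemma kernel_yker (R : realType) (e r : R) : kernel (yker e r).
Proof. by apply: kernel_mon; exact: smooth1_gdiff. Qed.

Lemma box0_norm2 (R : realType) (r : R) (z : R * R) : 0 <= r -> ~ box 0 r z ->
  r ^+ 2 <= z.1 ^+ 2 + z.2 ^+ 2.
Proof.
move=> r0 zb; rewrite leNgt; apply/negP => h; apply: zb; apply/boxE.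
have h1 := sqr_ge0 z.1; have h2 := sqr_ge0 z.2.
rewrite !subr0; split; rewrite -(ler_pXn2r (n := 2)) ?nnegrE // -normrX ger0_norm ?sqr_ge0 //; lra.
Qed.

Lemma etaE (R : realType) (r : R) z :
  eta r z = (c0 R * r ^+ 2)^-1 * omega (r ^- 2 * (z.1 ^+ 2 + z.2 ^+ 2)).
Proof. by rewrite /eta /mon !expr0 !mulr1 addr0. Qed.

Lemma eta0 (R : realType) (r : R) z : 0 < r -> r ^+ 2 <= z.1 ^+ 2 + z.2 ^+ 2 ->
  eta r z = 0.
Proof.
move=> r0 h; rewrite etaE omega_gt ?mulr0 //.
by rewrite mulrC ler_pdivlMr ?exprn_gt0// mul1r.
Qed.

Lemma supp_eta (R : realType) (r : R) : 0 < r -> supp 0 r (eta r).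
Proof. by move=> r0 z zb; apply: eta0 => //; apply: box0_norm2 => //; exact: ltW. Qed.

(** Beyond both radii the two terms are the same Cauchy kernel [beta 1 / t] and cancel; this is what
    gives [xker] and [yker] compact support. *)
Lemma gdiff0 (R : realType) (e r t : R) : 0 < e -> e <= r -> r ^+ 2 <= t ->
  gdiff e r t = 0.
Proof.
move=> e0 er h; have r0 : 0 < r := lt_le_trans e0 er.
have e2 : 0 < e ^+ 2 by rewrite exprn_gt0.
have r2 : 0 < r ^+ 2 by rewrite exprn_gt0.
have t0 : 0 < t := lt_le_trans r2 h.
have er2 : e ^+ 2 <= r ^+ 2 by apply: lerXn2r => //; rewrite nnegrE ltW.
rewrite /gdiff !addr0 !gam_ge1 ?[_ * t]mulrC ?ler_pdivlMr ?mul1r //; last exact: le_trans h.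
have t0' := lt0r_neq0 t0; have e0' := lt0r_neq0 e0; have r0' := lt0r_neq0 r0.
by field; rewrite t0' e0' r0'.
Qed.

Lemma supp_xker (R : realType) (e r : R) : 0 < e -> e <= r -> supp 0 r (xker e r).
Proof.
move=> e0 er z /box0_norm2 h; rewrite /xker /mon gdiff0 ?mulr0 //; apply: h.
by rewrite ltW // (lt_le_trans e0).
Qed.

Lemma supp_yker (R : realType) (e r : R) : 0 < e -> e <= r -> supp 0 r (yker e r).
Proof.
move=> e0 er z /box0_norm2 h; rewrite /yker /mon gdiff0 ?mulr0 //; apply: h.
by rewrite ltW // (lt_le_trans e0).
Qed.

(** A radial field is curl free. This is the vanishing of the imaginary part of [dzbar phi];
    [div_xyker] is its real part. *)
Lemma partial_xker_yker (R : realType) (e r : R) :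
  partial true (xker e r) = partial false (yker e r).
Proof.
rewrite !partial_mon; try exact: smooth1_gdiff.
by apply/funext => z; rewrite /mon /=; ring.
Qed.

Lemma gdiff_derive (R : realType) (e r t : R) :
  (gdiff e r)^`()%classic t = e ^- 2 * (e ^- 2 * (@gam R)^`()%classic (e ^- 2 * t)) -
     r ^- 2 * (r ^- 2 * (@gam R)^`()%classic (r ^- 2 * t)).
Proof.
have d (a : R) : is_derive t (1 : R) (fun t => gam (a * t + 0)) (a * (@gam R)^`()%classic (a * t)).
  have := @is_derive_affine R (@gam R) t _ a 0 (smooth1_is_derive _ (smooth1_gam R)).
  by rewrite addr0.
have D := is_derive_add (is_derive_mul (is_derive_cst (e ^- 2) t 1) (d (e ^- 2)))
  (is_derive_mul (is_derive_cst (- r ^- 2) t 1) (d (r ^- 2))).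
by rewrite derive1E; have [_ ->] := D; rewrite /cst; ring.
Qed.

Lemma div_xyker (R : realType) (e r : R) z : 0 < c0 R -> 0 < e -> 0 < r ->
  partial false (xker e r) z + partial true (yker e r) z =
  2 * c0 R * (eta e z - eta r z).
Proof.
move=> c00 e0 r0; rewrite !partial_mon; try exact: smooth1_gdiff.
rewrite /mon /= gdiff_derive !etaE /gdiff.
set t := z.1 ^+ 2 + z.2 ^+ 2.
(* [gamE] at [t / e^2] and at [t / r^2] expands the two bumps on the right, after which the identity
   is algebraic. *)
rewrite !addr0 -!gamE !expr0 !mulr1 !mul1r.
have -> : z.1 ^+ 2 = t - z.2 ^+ 2 by rewrite /t addrK.
move: (gam _) (gam _) (_^`()%classic _) (_^`()%classic _) => A B A' B'.
have c0' := lt0r_neq0 c00; have e0' := lt0r_neq0 e0; have r0' := lt0r_neq0 r0.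
by field; rewrite c0' e0' r0'.
Qed.

Lemma continuous_omega2 (R : realType) :
  continuous (fun z : R * R => omega (z.1 ^+ 2 + z.2 ^+ 2)).
Proof.
have -> : (fun z : R * R => omega (z.1 ^+ 2 + z.2 ^+ 2)) = mon 1 0 0 (@omega R).
  by apply/funext => z; rewrite /mon !expr0 !mul1r.
by apply: kernel_continuous; apply: kernel_mon; exact: smooth1_omega.
Qed.

Lemma integrable_omega2 (R : realType) :
  int2 (fun z : R * R => omega (z.1 ^+ 2 + z.2 ^+ 2)).
Proof.
apply: (@integrable_continuous_box _ _ 0 1 (@continuous_omega2 R)) => z zb.
by rewrite omega_gt // -[leLHS](expr1n _ 2); exact: box0_norm2.
Qed.

Lemma integrable_cst_box (R : realType) (c : R * R) (r k : R) :
  (@area R).-integrable (box c r) (EFin \o cst k).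
Proof.
apply: measurable_bounded_integrable; [exact: measurable_box|exact: area_box_lty| |].
  exact: measurable_cst.
by exists `|k|; split; rewrite ?num_real // => x kx z _ /=; exact: ltW.
Qed.

Lemma c0_gt0 (R : realType) : 0 < c0 R.
Proof.
(* [(7/8)^2 = 49/64] lies strictly between [1/2] and [1], where [omega] is positive. *)
pose p : R * R := (7 / 8, 0).
have h0 : 0 < omega (p.1 ^+ 2 + p.2 ^+ 2).
  by apply: omega_gt0; rewrite /p /= expr0n /=; apply/andP; lra.
set m := omega _ in h0.
have : \forall z \near p, m / 2 < omega (z.1 ^+ 2 + z.2 ^+ 2).
  apply: (cvgr_gt _ (@continuous_omega2 R p)); rewrite -/m; lra.
move=> /nbhs_box[e e0 eA].
have := @area_box R p e (ltW e0) => ab.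
rewrite /c0; apply: (@lt_le_trans _ _ (\int[@area R]_(z in box p e) (m / 2))).
  rewrite Rintegral_cst; last exact: measurable_box.
  rewrite [X in _ * fine X]ab /=.
  by apply: mulr_gt0; rewrite ?divr_gt0 // mulr_gt0 // exprn_gt0.
rewrite Rintegral_mkcond; apply: le_Rintegral => //.
- rewrite (_ : EFin \o _ = (EFin \o cst (m / 2)) \_ (box p e)); last first.
    by apply/funext => z; rewrite /= !patchE; case: ifP.
  rewrite -integrable_mkcond; last exact: measurable_box.
  exact: integrable_cst_box.
- exact: integrable_omega2.
- move=> z _; rewrite patchE; case: ifPn => [/set_mem zb|_]; last exact: omega_ge0.
  by apply: ltW; exact: eA.
Qed.

Lemma eta_ge0 (R : realType) (r : R) z : 0 <= eta r z.
Proof.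
by rewrite etaE mulr_ge0 ?omega_ge0 // invr_ge0 mulr_ge0 ?sqr_ge0 // ltW // c0_gt0.
Qed.

Lemma integrable_eta (R : realType) (r : R) : 0 < r -> int2 (eta r).
Proof.
by move=> r0; apply: (integrable_continuous_box (kernel_continuous (kernel_eta r)) (supp_eta r0)).
Qed.

(** The difference of two mollifiers is the divergence of a compactly supported field, so the mass
    does not depend on the radius; at radius [1] it is [1] by the choice of [c0]. This replaces a
    change of variables. *)
Lemma integral_eta (R : realType) (r : R) : 0 < r -> \int[@area R]_z eta r z = 1.
Proof.
have eq_er e s : 0 < e -> e <= s -> \int[@area R]_z eta e z = \int[@area R]_z eta s z.
  move=> e0 es; have s0 : 0 < s := lt_le_trans e0 es.
  have c2 : 2 * c0 R != 0 by rewrite mulf_neq0 // gt_eqF // c0_gt0.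
  apply/eqP; rewrite -subr_eq0 -RintegralB //; try exact: integrable_eta.
  have -> : (fun z : R * R => eta e z - eta s z) = (fun z => (2 * c0 R)^-1 *
      (partial false (xker e s) z + partial true (yker e s) z)).
    by apply/funext => z; rewrite div_xyker ?c0_gt0 // mulKf.
  have sx := supp_partial false (supp_xker e0 es).
  have sy := supp_partial true (supp_yker e0 es).
  have kx := kernel_continuous (kernel_partial false (kernel_xker e s)).
  have ky := kernel_continuous (kernel_partial true (kernel_yker e s)).
  have ix := integrable_continuous_box kx sx.
  have iy := integrable_continuous_box ky sy.
  rewrite RintegralZl //; last first.
    by have := integrableD measurableT ix iy; apply: eq_integrable.
  rewrite RintegralD //.
  rewrite (integral_partial (supp_xker e0 es)) //; last first.
    by move=> p; apply: kernel_derivable; exact: kernel_xker.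
  rewrite (integral_partial (supp_yker e0 es)) //; last first.
    by move=> p; apply: kernel_derivable; exact: kernel_yker.
  by rewrite addr0 mulr0.
move=> r0; transitivity (\int[@area R]_z eta 1 z).
  by have [r1|/ltW r1] := leP r 1; [|symmetry]; apply: eq_er.
have -> : eta (1 : R) = fun z => (c0 R)^-1 * omega (z.1 ^+ 2 + z.2 ^+ 2).
  by apply/funext => z; rewrite etaE expr1n mulr1 invr1 mul1r.
rewrite RintegralZl //; last exact: integrable_omega2.
by rewrite -/(c0 R) mulVf // gt_eqF // c0_gt0.
Qed.

(** * Convolutions *)

Definition conv (R : realType) (ka f : R * R -> R) (z : R * R) : R :=
  \int[@area R]_w (ka (z - w) * f w).

Definition locint (R : realType) (f : R * R -> R) : Prop :=
  mes2 f /\ forall c r, (@area R).-integrable (box c r) (EFin \o f).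

Lemma continuous_refl (R : realType) (a : R * R) (f : R * R -> R) :
  continuous f -> continuous (refl a f).
Proof.
move=> cf p.
have h1 : (a - w) @[w --> p] --> a - p.
  by apply: cvgB; [exact: cvg_cst|exact: cvg_id].
have h2 : f w @[w --> a - p] --> f (a - p) := cf (a - p).
exact: (cvg_comp _ _ h1 h2).
Qed.

Lemma supp_refl (R : realType) (a : R * R) (r : R) (f : R * R -> R) :
  supp 0 r f -> supp a r (refl a f).
Proof.
move=> sf p pb; apply: sf => /boxE[/= h1 h2]; apply: pb.
by apply/boxE; split; rewrite distrC; [move: h1|move: h2]; rewrite subr0.
Qed.

Lemma integrable_mul_box (R : realType) (g f : R * R -> R) (c : R * R) (r M : R) :
  mes2 g -> (forall z, `|g z| <= M) -> supp c r g ->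
  mes2 f -> (@area R).-integrable (box c r) (EFin \o f) ->
  int2 (fun w => g w * f w).
Proof.
move=> mg gM sg mf fi.
have -> : EFin \o (fun w => g w * f w) = (EFin \o (fun w => g w * f w)) \_ (box c r).
  apply/funext => z /=; rewrite patchE; case: ifPn => // /negP zb.
  by rewrite sg ?mul0r// => bz; apply: zb; apply/mem_set.
rewrite -integrable_mkcond; last exact: measurable_box.
have M0 : 0 <= M := le_trans (normr_ge0 (g 0)) (gM 0).
apply: (le_integrable (measurable_box c r) _ _ (integrableZl (measurable_box c r) M fi)).
  by apply/measurable_EFinP; apply: measurable_funTS; exact: measurable_funM.
move=> z _ /=; rewrite lee_fin !normrM; apply: ler_pM => //.
by rewrite (ger0_norm M0).
Qed.

Lemma integrable_conv (R : realType) (ka f : R * R -> R) (r : R) z :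
  continuous ka -> supp 0 r ka -> locint f ->
  int2 (fun w => ka (z - w) * f w).
Proof.
move=> ck sk [mf fi].
have [M _ kM] := continuous_box_bounded ck sk.
have sz := supp_refl (a := z) sk.
have cz := continuous_refl (a := z) ck.
apply: (@integrable_mul_box _ (refl z ka) f z r M) => //.
- exact: continuous_measurable2.
- by move=> w; exact: kM.
Qed.

Lemma convB (R : realType) (ka kb f : R * R -> R) (r : R) z :
  continuous ka -> supp 0 r ka -> continuous kb -> supp 0 r kb -> locint f ->
  conv (fun w => ka w - kb w) f z = conv ka f z - conv kb f z.
Proof.
move=> ca sa cb sb lf; rewrite /conv -RintegralB //; first last.
- exact: (integrable_conv _ cb sb).
- exact: (integrable_conv _ ca sa).
by apply: eq_Rintegral => w _; rewrite mulrBl.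
Qed.

Lemma convD (R : realType) (ka kb f : R * R -> R) (r : R) z :
  continuous ka -> supp 0 r ka -> continuous kb -> supp 0 r kb -> locint f ->
  conv (fun w => ka w + kb w) f z = conv ka f z + conv kb f z.
Proof.
move=> ca sa cb sb lf; rewrite /conv -RintegralD //; first last.
- exact: (integrable_conv _ cb sb).
- exact: (integrable_conv _ ca sa).
by apply: eq_Rintegral => w _; rewrite mulrDl.
Qed.

Lemma convZ (R : realType) (a : R) (ka f : R * R -> R) (r : R) z :
  continuous ka -> supp 0 r ka -> locint f ->
  conv (fun w => a * ka w) f z = a * conv ka f z.
Proof.
move=> ca sa lf; rewrite /conv -RintegralZl //; last exact: (integrable_conv _ ca sa).
by apply: eq_Rintegral => w _; rewrite mulrA.
Qed.

Lemma locint_norm (R : realType) (f : R * R -> R) : locint f -> locint (fun z => `|f z|).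
Proof.
move=> [mf fi]; split; first exact: measurableT_comp.
by move=> c r; apply: (integrable_norm (fi c r)).
Qed.

Lemma Rintegral_box_bound (R : realType) (g f : R * R -> R) (c : R * R) (r C : R) :
  mes2 g -> (forall w, `|g w| <= C) -> supp c r g -> locint f ->
  `|\int[@area R]_w (g w * f w)| <= C * \int[@area R]_(w in box c r) `|f w|.
Proof.
move=> mg gC sg [mf fi].
have C0 : 0 <= C := le_trans (normr_ge0 (g 0)) (gC 0).
have ig := integrable_mul_box mg gC sg mf (fi c r).
apply: le_trans (le_normr_Rintegral measurableT ig) _.
rewrite -RintegralZl; [|exact: measurable_box|exact: (integrable_norm (fi c r))].
rewrite [leRHS]Rintegral_mkcond; apply: le_Rintegral => //.
- exact: (integrable_norm ig).
- rewrite (_ : EFin \o _ = (EFin \o (fun w => C * `|f w|)) \_ (box c r)); last first.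
    by apply/funext => z; rewrite /= !patchE; case: ifP.
  rewrite -integrable_mkcond; last exact: measurable_box.
  have := integrableZl (measurable_box c r) C (integrable_norm (fi c r)).
  by apply: eq_integrable => //; exact: measurable_box.
- move=> w _; rewrite patchE; case: ifPn => [_|/negP wb].
    by rewrite normrM ler_wpM2r.
  by rewrite sg ?mul0r ?normr0 // => bw; apply: wb; apply/mem_set.
Qed.

Lemma derive_bound_segment (R : realType) (g g' : R -> R) (x y K : R) :
  (forall t, is_derive t (1 : R) g (g' t)) ->
  (forall t, `|t - x| <= `|y - x| -> `|g' t| <= K) ->
  `|g y - g x| <= K * `|y - x|.
Proof.
move=> dg gK.
have cg a b : {within `[a, b], continuous g}.
  apply: continuous_subspaceT => t; apply: differentiable_continuous.
  by apply/derivable1_diffP; have [] := dg t.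
have [xy|yx|->] := ltgtP x y; last by rewrite !subrr normr0 mulr0.
- have [t] := MVT xy (fun t _ => dg t) (cg x y).
  rewrite in_itv /= => /andP[t1 t2] ->.
  rewrite normrM ler_wpM2r //; apply: gK; rewrite !ger0_norm; lra.
- have [t] := MVT yx (fun t _ => dg t) (cg y x).
  rewrite in_itv /= => /andP[t1 t2] e.
  rewrite distrC e normrM [`|x - y|]distrC ler_wpM2r //; apply: gK.
  rewrite !ler0_norm; lra.
Qed.

Lemma taylor2_bound (R : realType) (g g' g'' : R -> R) (t h C : R) :
  (forall t, is_derive t (1 : R) g (g' t)) ->
  (forall t, is_derive t (1 : R) g' (g'' t)) ->
  (forall t, `|g'' t| <= C) ->
  `|g (h + t) - g t - h * g' t| <= C * h ^+ 2.
Proof.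
move=> dg dg' gC.
have C0 : 0 <= C := le_trans (normr_ge0 _) (gC 0).
pose G s := g s + - g' t * s.
have dG s : is_derive s (1 : R) G (g' s - g' t).
  apply: (is_derive_eq (is_derive_add (dg s)
    (is_derive_mul (is_derive_cst (- g' t) s 1) (is_derive_id s 1)))).
  by rewrite /cst; ring.
have := @derive_bound_segment R G _ t (h + t) (C * `|h|) dG.
rewrite addrK => H.
have -> : g (h + t) - g t - h * g' t = G (h + t) - G t by rewrite /G; ring.
apply: le_trans (H _) _.
  move=> s st; apply: le_trans (@derive_bound_segment R g' g'' t s C dg' _) _ => //.
  by rewrite ler_wpM2l.
by rewrite -mulrA -expr2 -normrX ger0_norm ?sqr_ge0.
Qed.

Lemma kernel_line_derive (R : realType) (k : bool) (ka : R * R -> R) p t : kernel ka ->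
  is_derive t (1 : R) (line k ka p) (line k (partial k ka) p t).
Proof. by move=> kk; apply: is_derive_line => q; exact: kernel_derivable. Qed.

Lemma kernel_taylor (R : realType) (k : bool) (ka : R * R -> R) (r : R) : kernel ka ->
  supp 0 r ka -> exists2 C : R, 0 <= C & forall p (h : R),
    `|ka (h *: axis R k + p) - ka p - h * partial k ka p| <= C * h ^+ 2.
Proof.
move=> kk sk.
have k2 := kernel_partial k (kernel_partial k kk).
have [C C0 HC] := continuous_box_bounded (kernel_continuous k2)
  (supp_partial k (supp_partial k sk)).
exists C => // p h.
have := @taylor2_bound R (line k ka p) _ _ (crd k p) h C
  (fun t => kernel_line_derive k p t kk)
  (fun t => kernel_line_derive k p t (kernel_partial k kk)).
rewrite axisE => H; move: H; rewrite /line /crd.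
by case: k k2 HC {kk sk} => k2 HC /=; rewrite -surjective_pairing; apply => t; exact: HC.
Qed.

Lemma kernel_lipschitz (R : realType) (ka : R * R -> R) (r : R) : kernel ka ->
  supp 0 r ka -> exists2 L : R, 0 <= L & forall p q,
    `|ka p - ka q| <= L * (`|p.1 - q.1| + `|p.2 - q.2|).
Proof.
move=> kk sk.
have H k := continuous_box_bounded (kernel_continuous (kernel_partial k kk)) (supp_partial k sk).
have [L1 L10 HL1] := H false; have [L2 L20 HL2] := H true.
exists (L1 + L2) => [|p q]; first by rewrite addr_ge0.
have h1 := @derive_bound_segment R (line false ka p) _ q.1 p.1 L1
  (fun t => kernel_line_derive false p t kk) (fun t _ => HL1 _).
have h2 := @derive_bound_segment R (line true ka q) _ q.2 p.2 L2
  (fun t => kernel_line_derive true q t kk) (fun t _ => HL2 _).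
rewrite /line /= -!surjective_pairing in h1 h2.
have -> : ka p - ka q = (ka p - ka (q.1, p.2)) + (ka (q.1, p.2) - ka q) by ring.
apply: le_trans (ler_normD _ _) _; apply: le_trans (lerD h1 h2) _.
have n1 := normr_ge0 (p.1 - q.1); have n2 := normr_ge0 (p.2 - q.2).
nra.
Qed.

(** Only the kernel is differentiated: its second order Taylor remainder, uniform thanks to the
    compact support, is integrated against [|f|]. *)
Lemma conv_is_derive (R : realType) (k : bool) (ka f : R * R -> R) (r : R) z :
  kernel ka -> supp 0 r ka -> locint f ->
  is_derive (crd k z) (1 : R) (line k (conv ka f) z) (conv (partial k ka) f z).
Proof.
move=> kk sk lf.
have [C C0 HC] := kernel_taylor k kk sk.
have ck := kernel_continuous kk.
have cdk := kernel_continuous (kernel_partial k kk).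
have sdk := supp_partial k sk.
(* The radius grows by [1] because increments up to [1] move the support of the kernel by that
   much. *)
apply: (@is_derive_quadratic _ _ _ _ (C * \int[@area R]_(w in box z (r + 1)) `|f w|)) => h h1.
pose zh := h *: axis R k + z.
have -> : line k (conv ka f) z (h + crd k z) = conv ka f zh.
  by rewrite /zh axisE /line /crd; case: (k).
have -> : line k (conv ka f) z (crd k z) = conv ka f z.
  by rewrite /line /crd; case: (k); rewrite -surjective_pairing.
pose g w := ka (zh - w) - ka (z - w) - h * partial k ka (z - w).
have -> : conv ka f zh - conv ka f z - h * conv (partial k ka) f z =
    \int[@area R]_w (g w * f w).
  have i1 := integrable_conv zh ck sk lf; have i2 := integrable_conv z ck sk lf.
  have i3 := integrable_conv z cdk sdk lf.
  rewrite /conv -RintegralZl // -RintegralB // -RintegralB //.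
  - by apply: eq_Rintegral => w _; rewrite /g; ring.
  - by have := integrableB measurableT i1 i2; apply: eq_integrable.
  - by have := integrableZl measurableT h i3; apply: eq_integrable.
rewrite mulrAC; apply: Rintegral_box_bound => //.
- apply: continuous_measurable2 => w.
  apply: cvgB; last first.
    by apply: cvgM; [exact: cvg_cst|exact: (continuous_refl cdk)].
  apply: cvgB; first exact: (@continuous_refl R zh ka ck w).
  exact: (@continuous_refl R z ka ck w).
- by move=> w; rewrite /g /zh -(addrA (h *: axis R k)); exact: HC.
- move=> w wb.
  have out q : `|q.1 - (z - w).1| <= 1 -> `|q.2 - (z - w).2| <= 1 -> ~ box 0 r q.
    move=> q1 q2 /boxE[]; rewrite !subr0 => a1 a2; apply: wb; apply/boxE; split.
      rewrite distrC; have -> : z.1 - w.1 = q.1 - (q.1 - (z - w).1) by rewrite /=; ring.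
      apply: le_trans (ler_normB _ _) _; lra.
    rewrite distrC; have -> : z.2 - w.2 = q.2 - (q.2 - (z - w).2) by rewrite /=; ring.
    apply: le_trans (ler_normB _ _) _; lra.
  rewrite /g sk ?sk ?sdk; first by rewrite mulr0 !subr0.
  - by apply: out; rewrite subrr normr0.
  - by apply: out; rewrite subrr normr0.
  - have e (a b : R) : h + a - b - (a - b) = h by ring.
    by apply: out; rewrite /zh axisE; case: (k) => /=; rewrite ?subrr ?normr0 ?e.
Qed.

Lemma conv_derivable (R : realType) (k : bool) (ka f : R * R -> R) (r : R) z :
  kernel ka -> supp 0 r ka -> locint f ->
  derivable (conv ka f) z (axis R k) /\
  partial k (conv ka f) z = conv (partial k ka) f z.
Proof. by move=> kk sk lf; exact: partial_is_derive (conv_is_derive _ _ kk sk lf). Qed.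

Lemma conv_continuous (R : realType) (ka f : R * R -> R) (r : R) :
  kernel ka -> supp 0 r ka -> locint f -> continuous (conv ka f).
Proof.
move=> kk sk lf z.
have [L L0 HL] := kernel_lipschitz kk sk.
have ck := kernel_continuous kk.
pose I := \int[@area R]_(w in box z (r + 1)) `|f w|.
have I0 : 0 <= I by apply: Rintegral_ge0.
apply/cvgrPdist_le => /= e e0.
(* The [1] keeps the moved support inside [box z (r + 1)]; adding [1] to [L * I] keeps the
   denominator positive when [L * I = 0]. *)
pose d := Num.min 1 (e / (2 * (L * I + 1))).
have LI : 0 <= L * I by rewrite mulr_ge0.
have d0 : 0 < d by rewrite lt_min ltr01 divr_gt0 // mulr_gt0 //; lra.
apply/nbhs_box; exists d => // q /boxE[q1 q2].
have d1 : d <= 1 by rewrite ge_min lexx.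
have de : d * (2 * (L * I + 1)) <= e.
  by rewrite -ler_pdivlMr ?mulr_gt0 //; [rewrite ge_min lexx orbT|lra].
have -> : conv ka f z - conv ka f q = \int[@area R]_w ((ka (z - w) - ka (q - w)) * f w).
  rewrite /conv -RintegralB //.
  - by apply: eq_Rintegral => w _; ring.
  - exact: (integrable_conv z ck sk lf).
  - exact: (integrable_conv q ck sk lf).
apply: (@le_trans _ _ (L * (d + d) * I)); last nra.
apply: Rintegral_box_bound => //.
- apply: continuous_measurable2 => w.
  apply: cvgB; first exact: (@continuous_refl R z ka ck w).
  exact: (@continuous_refl R q ka ck w).
- move=> w; apply: le_trans (HL _ _) _; rewrite ler_wpM2l //.
  rewrite (_ : (z - w).1 - (q - w).1 = - (q.1 - z.1)) ?normrN; last by rewrite /=; ring.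
  rewrite (_ : (z - w).2 - (q - w).2 = - (q.2 - z.2)) ?normrN; last by rewrite /=; ring.
  exact: lerD.
- move=> w wb; rewrite (sk (z - w)) ?(sk (q - w)) ?subr0 //.
    move=> /boxE[/=]; rewrite !subr0 => a1 a2; apply: wb; apply/boxE; split.
      rewrite (_ : w.1 - z.1 = (q.1 - z.1) - (q.1 - w.1)); last ring.
      apply: le_trans (ler_normB _ _) _; lra.
    rewrite (_ : w.2 - z.2 = (q.2 - z.2) - (q.2 - w.2)); last ring.
    apply: le_trans (ler_normB _ _) _; lra.
  move=> /boxE[/=]; rewrite !subr0 => a1 a2; apply: wb; apply/boxE.
  by rewrite distrC [`|w.2 - _|]distrC; split; lra.
Qed.

Lemma conv_supp (R : realType) (ka f : R * R -> R) (r s : R) (c : R * R) :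
  supp 0 r ka -> supp c s f -> supp c (r + s) (conv ka f).
Proof.
move=> sk sf z zb; rewrite /conv /Rintegral integral0_eq // => w _; congr EFin.
have [wb|wb] := pselect (box c s w); last by rewrite sf // mulr0.
rewrite sk ?mul0r // => /boxE[/=]; rewrite !subr0 => a1 a2; apply: zb.
move: wb => /boxE[b1 b2]; apply/boxE; split.
  rewrite (_ : z.1 - c.1 = (z.1 - w.1) + (w.1 - c.1)); last ring.
  apply: le_trans (ler_normD _ _) _; lra.
rewrite (_ : z.2 - c.2 = (z.2 - w.2) + (w.2 - c.2)); last ring.
apply: le_trans (ler_normD _ _) _; lra.
Qed.

(** For such functions every convolution with a kernel is continuous with compact support, so all
    integrals of the [L2] computation exist; truncating the bounded [h_zbar] produces them. *)
Definition bddsupp (R : realType) (c : R * R) (s M : R) (f : R * R -> R) : Prop :=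
  [/\ mes2 f, forall z, `|f z| <= M & supp c s f].

Lemma bddsupp_locint (R : realType) (c : R * R) (s M : R) (f : R * R -> R) :
  bddsupp c s M f -> locint f.
Proof.
move=> [mf fM sf]; split => // d r; apply: (integrableS measurableT).
- exact: measurable_box.
- by [].
- exact: (integrable_bounded_box mf fM sf).
Qed.

Lemma integrable_conv2 (R : realType) (c : R * R) (s M r : R) (g a b : R * R -> R) :
  bddsupp c s M g ->
  kernel a -> supp 0 r a -> kernel b -> supp 0 r b ->
  int2 (fun z => conv a g z * conv b g z).
Proof.
move=> bg ka sa kb sb; have lg := bddsupp_locint bg; have [_ _ sg] := bg.
apply: (@integrable_continuous_box _ _ c (r + s)).
  by move=> z; apply: cvgM; [exact: (conv_continuous ka sa lg)|exact: (conv_continuous kb sb lg)].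
by move=> z zb; rewrite (conv_supp sa sg zb) mul0r.
Qed.

Lemma conv_ibp (R : realType) (k : bool) (c : R * R) (s M r : R) (g a b : R * R -> R) :
  bddsupp c s M g ->
  kernel a -> supp 0 r a -> kernel b -> supp 0 r b ->
  \int[@area R]_z (conv (partial k a) g z * conv b g z) =
  - \int[@area R]_z (conv a g z * conv (partial k b) g z).
Proof.
move=> bg ka sa kb sb; have lg := bddsupp_locint bg; have [_ _ sg] := bg.
have ka' := kernel_partial k ka; have kb' := kernel_partial k kb.
have sa' := supp_partial k sa; have sb' := supp_partial k sb.
pose f z := conv a g z * conv b g z.
have D p : derivable f p (axis R k) /\ partial k f p =
    conv (partial k a) g p * conv b g p + conv a g p * conv (partial k b) g p.
  apply: partial_is_derive.
  have := is_derive_mul (conv_is_derive k p ka sa lg) (conv_is_derive k p kb sb lg).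
  rewrite (_ : line k _ _ _ = conv b g p); last first.
    by rewrite /line /crd; case: (k); rewrite -surjective_pairing.
  rewrite (_ : line k (conv a g) p _ = conv a g p); last first.
    by rewrite /line /crd; case: (k); rewrite -surjective_pairing.
  by rewrite (_ : (fun t => _) = line k f p) //; apply/funext => t; rewrite /line /f; case: (k).
have pf : partial k f = fun p => conv (partial k a) g p * conv b g p + conv a g p * conv (partial k b) g p.
  by apply/funext => p; have [] := D p.
have := @integral_partial R k f c (r + s).
rewrite pf => /(_ _ _ _)/wrap[].
- by move=> z zb; rewrite /f (conv_supp sa sg zb) mul0r.
- by move=> p; have [] := D p.
- move=> z; apply: cvgD; apply: cvgM.
  + exact: (conv_continuous ka' sa' lg).
  + exact: (conv_continuous kb sb lg).
  + exact: (conv_continuous ka sa lg).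
  + exact: (conv_continuous kb' sb' lg).
rewrite RintegralD //; [|exact: (integrable_conv2 bg ka' sa' kb sb)|exact: (integrable_conv2 bg ka sa kb' sb')].
by move/eqP; rewrite addr_eq0 => /eqP.
Qed.

(** * The L2 bound for the truncated Beurling transform *)

(** The Jacobian of a compactly supported map integrates to zero. With [X], [Y] the convolutions of
    [g] with the two kernels, both integrals are minus the integral of [X Y_xy]: the first by moving
    one [x] derivative, the second by writing [X_y^2 = X_y Y_x] and moving one [y] derivative. *)
Lemma conv_jacobian (R : realType) (c : R * R) (s M e r : R) (g : R * R -> R) :
  bddsupp c s M g -> 0 < e -> e <= r ->
  \int[@area R]_z (conv (partial false (xker e r)) g z * conv (partial true (yker e r)) g z) =
  \int[@area R]_z (conv (partial true (xker e r)) g z * conv (partial true (xker e r)) g z).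
Proof.
move=> bg e0 er.
have kx := kernel_xker e r; have ky := kernel_yker e r.
have sx := supp_xker e0 er; have sy := supp_yker e0 er.
have e1 := conv_ibp false bg kx sx (kernel_partial true ky) (supp_partial true sy).
have e2 := conv_ibp true bg kx sx (kernel_partial false ky) (supp_partial false sy).
rewrite (kernel_partialC ky) in e2.
apply: etrans e1 _; apply: etrans (esym e2) _.
by rewrite partial_xker_yker.
Qed.

Lemma integral_sqr_complete (R : realType) (A B D : R * R -> R) :
  int2 (fun z => A z * B z) -> int2 (fun z => A z * A z) ->
  int2 (fun z => B z * B z) -> int2 (fun z => D z * D z) ->
  \int[@area R]_z (A z * B z) = \int[@area R]_z (D z * D z) ->
  \int[@area R]_z ((A z - B z) ^+ 2 + 4 * D z ^+ 2) = \int[@area R]_z (A z + B z) ^+ 2.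
Proof.
move=> iAB iAA iBB iDD J.
have i1 : int2 (fun z => A z * A z + B z * B z).
  by have := integrableD measurableT iAA iBB; apply: eq_integrable.
have i2 : int2 (fun z => 4 * (D z * D z) - 2 * (A z * B z)).
  have := integrableB measurableT (integrableZl measurableT 4 iDD) (integrableZl measurableT 2 iAB).
  exact: eq_integrable.
have i3 : int2 (fun z => 2 * (A z * B z)).
  by have := integrableZl measurableT 2 iAB; exact: eq_integrable.
have i4 : int2 (fun z => 4 * (D z * D z)).
  by have := integrableZl measurableT 4 iDD; exact: eq_integrable.
transitivity (\int[@area R]_z ((A z * A z + B z * B z) + (4 * (D z * D z) - 2 * (A z * B z)))).
  by apply: eq_Rintegral => z _; ring.
transitivity (\int[@area R]_z ((A z * A z + B z * B z) + 2 * (A z * B z))); last first.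
  by apply: eq_Rintegral => z _; ring.
rewrite (RintegralD measurableT i1 i2) (RintegralD measurableT i1 i3); congr (_ + _).
by rewrite RintegralB // !RintegralZl // J; ring.
Qed.

(** The left side is four times the squared [L2] norm of [(d_z phi) * g], the right side the same
    for [dzbar phi]. The integrands differ by [4 (X_y^2 - X_x Y_y)], whose integral vanishes by
    [conv_jacobian]. *)
Lemma integral_sqr_beurling (R : realType) (c : R * R) (s M e r : R) (g : R * R -> R) :
  bddsupp c s M g -> 0 < e -> e <= r ->
  \int[@area R]_z ((conv (partial false (xker e r)) g z - conv (partial true (yker e r)) g z) ^+ 2
     + 4 * conv (partial true (xker e r)) g z ^+ 2) =
  \int[@area R]_z (2 * c0 R * (conv (eta e) g z - conv (eta r) g z)) ^+ 2.
Proof.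
move=> bg e0 er; have r0 : 0 < r := lt_le_trans e0 er.
have lg := bddsupp_locint bg.
have kx := kernel_xker e r; have ky := kernel_yker e r.
have sx := supp_xker e0 er; have sy := supp_yker e0 er.
have kxx := kernel_partial false kx; have sxx := supp_partial false sx.
have kyy := kernel_partial true ky; have syy := supp_partial true sy.
have kxy := kernel_partial true kx; have sxy := supp_partial true sx.
have J := conv_jacobian bg e0 er.
have iAB := integrable_conv2 bg kxx sxx kyy syy.
have iAA := integrable_conv2 bg kxx sxx kxx sxx.
have iBB := integrable_conv2 bg kyy syy kyy syy.
have iDD := integrable_conv2 bg kxy sxy kxy sxy.
have sum z : 2 * c0 R * (conv (eta e) g z - conv (eta r) g z) =
   conv (partial false (xker e r)) g z + conv (partial true (yker e r)) g z.
  have ke := kernel_continuous (kernel_eta e); have kr := kernel_continuous (kernel_eta r).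
  have se := supp_le er (supp_eta e0); have sr := supp_eta r0.
  have cB : continuous (fun w => eta e w - eta r w).
    by move=> w; apply: cvgB; [exact: ke|exact: kr].
  have sB : supp 0 r (fun w => eta e w - eta r w).
    by move=> w wb; rewrite se ?sr ?subrr.
  rewrite -(convB z ke se kr sr lg) -(convZ (2 * c0 R) z cB sB lg).
  rewrite -(convD z (kernel_continuous kxx) sxx (kernel_continuous kyy) syy lg).
  by apply: eq_Rintegral => w _; rewrite -div_xyker ?c0_gt0.
have -> : \int[@area R]_z (2 * c0 R * (conv (eta e) g z - conv (eta r) g z)) ^+ 2 =
  \int[@area R]_z (conv (partial false (xker e r)) g z + conv (partial true (yker e r)) g z) ^+ 2.
  by apply: eq_Rintegral => z _; rewrite sum.
exact: integral_sqr_complete.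
Qed.

(** * Mollification contracts [L2] *)

Lemma eta_even (R : realType) (r : R) z w : eta r (z - w) = eta r (w - z).
Proof.
rewrite !etaE; congr (_ * omega (_ * _)).
by rewrite -[(z - w).1 ^+ 2]sqrrN -[(z - w).2 ^+ 2]sqrrN /= !opprB.
Qed.

Lemma integral_eta_reflect (R : realType) (r : R) z : 0 < r ->
  \int[@area R]_w eta r (z - w) = 1.
Proof. by move=> r0; rewrite Rintegral_reflect ?integral_eta //; exact: integrable_eta. Qed.

(** Jensen's inequality for the probability density [eta r (z - w)]: the nonnegative integral of
    [(f - m)^2] against it, with [m] the mean, is expanded. *)
Lemma conv_eta_sqr (R : realType) (r : R) (f : R * R -> R) z : 0 < r ->
  locint f -> locint (fun z => f z ^+ 2) ->
  conv (eta r) f z ^+ 2 <= conv (eta r) (fun z => f z ^+ 2) z.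
Proof.
move=> r0 lf lf2; set m := conv (eta r) f z.
have ke := kernel_continuous (kernel_eta r); have se := supp_eta r0.
have i1 := integrable_conv z ke se lf; have i2 := integrable_conv z ke se lf2.
have i0 := integrable_reflect z (integrable_eta r0).
have i1' : int2 (fun w => 2 * m * (eta r (z - w) * f w)).
  by have := integrableZl measurableT (2 * m) i1; exact: eq_integrable.
have i0' : int2 (fun w => m ^+ 2 * eta r (z - w)).
  by have := integrableZl measurableT (m ^+ 2) i0; exact: eq_integrable.
have : 0 <= \int[@area R]_w (eta r (z - w) * (f w - m) ^+ 2).
  by apply: Rintegral_ge0 => w _; rewrite mulr_ge0 ?eta_ge0 ?sqr_ge0.
have -> : \int[@area R]_w (eta r (z - w) * (f w - m) ^+ 2) = \int[@area R]_w
    ((eta r (z - w) * f w ^+ 2 - 2 * m * (eta r (z - w) * f w)) + m ^+ 2 * eta r (z - w)).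
  by apply: eq_Rintegral => w _; ring.
rewrite RintegralD //; last first.
  by have := integrableB measurableT i2 i1'; exact: eq_integrable.
rewrite RintegralB // !RintegralZl // integral_eta_reflect //.
move=> H; have {}H : 0 <= conv (eta r) (fun w => f w ^+ 2) z - 2 * m * m + m ^+ 2 * 1 := H.
lra.
Qed.

Lemma area_sigma_finite (R : realType) : sigma_finite setT (@area R).
Proof.
exists (fun n => box (0 : R * R) n%:R).
  apply/seteqP; split => // z _.
  have [n nz] : exists n, Num.max `|z.1| `|z.2| <= n%:R.
    by exists (Num.truncn (Num.max `|z.1| `|z.2|)).+1; apply: ltW; exact: truncnS_gt.
  by exists n => //; apply/boxE; rewrite !subr0; move: nz; rewrite ge_max => /andP.
by move=> k; split; [exact: measurable_box|exact: area_box_lty].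
Qed.

(* [area] is bundled as a measure; sigma-finiteness has to be attached to a copy of the
   underlying set function. *)
Definition area_fun (R : realType) :
  set (measurableTypeR R * measurableTypeR R) -> \bar R := @area R.

HB.instance Definition _ (R : realType) := Measure.on (@area_fun R).

HB.instance Definition _ (R : realType) :=
  @Measure_isSigmaFinite.Build _ _ _ (@area_fun R) (@area_sigma_finite R).

Lemma area_tonelli (R : realType)
    (h : (measurableTypeR R * measurableTypeR R) * (measurableTypeR R * measurableTypeR R) -> \bar R) :
  measurable_fun setT h -> (forall x, 0 <= h x)%E ->
  (\int[@area R]_z \int[@area R]_w h (z, w) = \int[@area R]_w \int[@area R]_z h (z, w))%E.
Proof. by move=> mh h0; exact: (@fubini_tonelli _ _ _ _ R (@area_fun R) (@area_fun R)). Qed.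

Lemma measurable_eta_diff (R : realType) (r : R) (f : R * R -> R) : mes2 f ->
  measurable_fun setT
    (fun zw : (measurableTypeR R * measurableTypeR R) * (measurableTypeR R * measurableTypeR R) =>
       (eta r (zw.1 - zw.2) * f zw.2)%:E).
Proof.
move=> mf; apply/measurable_EFinP; apply: measurable_funM; last first.
  exact: (measurableT_comp mf measurable_snd).
apply: (measurableT_comp (continuous_measurable2 (kernel_continuous (kernel_eta r)))).
apply/measurable_fun_pairP; split; apply: measurable_funB.
- exact: (measurableT_comp measurable_fst measurable_fst).
- exact: (measurableT_comp measurable_fst measurable_snd).
- exact: (measurableT_comp measurable_snd measurable_fst).
- exact: (measurableT_comp measurable_snd measurable_snd).
Qed.

Lemma measurable_integral_eta (R : realType) (r : R) (f : R * R -> R) :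
  mes2 f -> (forall z, 0 <= f z) ->
  measurable_fun [set: measurableTypeR R * measurableTypeR R]
    (fun z => (\int[@area R]_w (eta r (z - w) * f w)%:E)%E).
Proof.
move=> mf f0; have mh := measurable_eta_diff r mf.
apply: (@measurable_fun_fubini_tonelli_F _ _ _ _ R (@area_fun R) _ mh).
by move=> zw; rewrite lee_fin mulr_ge0 ?eta_ge0.
Qed.

(** Stated with extended reals for nonnegative [f], so that it also serves before the integrability
    of [f] or of its mollification is known. *)
Lemma conv_eta_tonelli (R : realType) (r : R) (f : R * R -> R) : 0 < r ->
  mes2 f -> (forall z, 0 <= f z) ->
  (\int[@area R]_z \int[@area R]_w (eta r (z - w) * f w)%:E = \int[@area R]_w (f w)%:E)%E.
Proof.
move=> r0 mf f0.
pose h : (measurableTypeR R * measurableTypeR R) * (measurableTypeR R * measurableTypeR R) -> \bar R :=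
  fun zw => (eta r (zw.1 - zw.2) * f zw.2)%:E.
have mh : measurable_fun setT h := measurable_eta_diff r mf.
have h0 zw : (0 <= h zw)%E by rewrite lee_fin mulr_ge0 ?eta_ge0.
have E := area_tonelli mh h0.
apply: etrans E _; apply: eq_integral => w _; rewrite /h /=.
under eq_integral do rewrite EFinM muleC.
rewrite ge0_integralZl //.
- have := integral_eta_reflect w r0 => H.
  have i0 := integrable_reflect w (integrable_eta r0).
  under eq_integral do rewrite eta_even.
  have <- := fineK (integrable_fin_num measurableT i0).
  by move: H; rewrite /Rintegral /= => ->; rewrite mule1.
- apply/measurable_EFinP.
  have e : (fun z => eta r (z - w)) = refl w (eta r).
    by apply/funext => z; rewrite eta_even.
  rewrite e; apply: continuous_measurable2; apply: continuous_refl.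
  exact: kernel_continuous (kernel_eta r).
- by move=> z _; rewrite lee_fin eta_ge0.
- by rewrite lee_fin.
Qed.

Lemma bddsupp_sqr (R : realType) (c : R * R) (s M : R) (f : R * R -> R) :
  bddsupp c s M f -> bddsupp c s (M ^+ 2) (fun z => f z ^+ 2).
Proof.
move=> [mf fM sf]; split.
- exact: measurable_funX.
- by move=> z; rewrite normrX lerXn2r ?nnegrE // (le_trans _ (fM z)).
- by move=> z zb; rewrite sf // expr0n.
Qed.

Lemma Rintegral_conv_eta (R : realType) (c : R * R) (s M r : R) (f : R * R -> R) :
  bddsupp c s M f -> (forall z, 0 <= f z) -> 0 < r ->
  \int[@area R]_z conv (eta r) f z = \int[@area R]_z f z.
Proof.
move=> bf f0 r0; have lf := bddsupp_locint bf; have [mf _ _] := bf.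
rewrite /Rintegral -(conv_eta_tonelli r0 mf f0); congr fine.
apply: eq_integral => z _; rewrite /conv /Rintegral fineK //.
apply: integrable_fin_num => //.
exact: (integrable_conv z (kernel_continuous (kernel_eta r)) (supp_eta r0) lf).
Qed.

Lemma integrable_conv_kernel (R : realType) (ka f : R * R -> R) (c : R * R) (r s M : R) :
  kernel ka -> supp 0 r ka -> bddsupp c s M f -> int2 (conv ka f).
Proof.
move=> kk sk bf; have lf := bddsupp_locint bf; have [_ _ sf] := bf.
exact: (integrable_continuous_box (conv_continuous kk sk lf) (conv_supp sk sf)).
Qed.

Lemma young_eta (R : realType) (c : R * R) (s M r : R) (f : R * R -> R) :
  bddsupp c s M f -> 0 < r ->
  \int[@area R]_z (conv (eta r) f z) ^+ 2 <= \int[@area R]_z (f z) ^+ 2.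
Proof.
move=> bf r0; have bf2 := bddsupp_sqr bf.
have ke := kernel_eta r; have se := supp_eta r0.
rewrite -(Rintegral_conv_eta bf2 _ r0) //; last by move=> z; exact: sqr_ge0.
apply: le_Rintegral => //.
- by have := integrable_conv2 bf ke se ke se; apply: eq_integrable.
- exact: (integrable_conv_kernel ke se bf2).
- by move=> z _; apply: conv_eta_sqr => //; apply: bddsupp_locint; eauto.
Qed.

(** The constant [16 c0^2] comes from [(E - F)^2 <= 2 E^2 + 2 F^2] and the contraction property of
    both mollifiers. Its independence of [e] is what later allows the inner radius to tend to
    zero. *)
Lemma beurling_bound (R : realType) (c : R * R) (s M e r : R) (g : R * R -> R) :
  bddsupp c s M g -> 0 < e -> e <= r ->
  \int[@area R]_z ((conv (partial false (xker e r)) g z - conv (partial true (yker e r)) g z) ^+ 2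
     + 4 * conv (partial true (xker e r)) g z ^+ 2) <=
  16 * c0 R ^+ 2 * \int[@area R]_z g z ^+ 2.
Proof.
move=> bg e0 er; have r0 : 0 < r := lt_le_trans e0 er.
rewrite (integral_sqr_beurling bg e0 er).
have ke := kernel_eta e; have kr := kernel_eta r.
have se := supp_le er (supp_eta e0); have sr := supp_eta r0.
have iee := integrable_conv2 bg ke se ke se.
have irr := integrable_conv2 bg kr sr kr sr.
have ier := integrable_conv2 bg ke se kr sr.
have ye := young_eta bg e0; have yr := young_eta bg r0.
move: (conv (eta e) g) (conv (eta r) g) iee irr ier ye yr => E F iee irr ier ye yr.
have iE : int2 (fun z => E z ^+ 2) by apply: eq_integrable iee.
have iF : int2 (fun z => F z ^+ 2) by apply: eq_integrable irr.
have i1 : int2 (fun z => E z ^+ 2 + F z ^+ 2).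
  by have := integrableD measurableT iE iF; exact: eq_integrable.
have i1' : int2 (fun z => 2 * (E z * F z)).
  by have := integrableZl measurableT 2 ier; exact: eq_integrable.
have i2 : int2 (fun z => (2 * c0 R * (E z - F z)) ^+ 2).
  have := integrableZl measurableT (4 * c0 R ^+ 2) (integrableB measurableT i1 i1').
  by apply: eq_integrable => // z _ /=; rewrite -!EFinB -!EFinM; congr EFin; ring.
have i3 : int2 (fun z => 8 * c0 R ^+ 2 * (E z ^+ 2 + F z ^+ 2)).
  by have := integrableZl measurableT (8 * c0 R ^+ 2) i1; exact: eq_integrable.
apply: (@le_trans _ _ (\int[@area R]_z (8 * c0 R ^+ 2 * (E z ^+ 2 + F z ^+ 2)))).
  apply: le_Rintegral => // z _; rewrite exprMn.
  have h1 := sqr_ge0 (E z + F z); have h2 := sqr_ge0 (c0 R).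
  have -> : (2 * c0 R) ^+ 2 * (E z - F z) ^+ 2 = 8 * c0 R ^+ 2 * (E z ^+ 2 + F z ^+ 2) - 4 * (c0 R ^+ 2 * (E z + F z) ^+ 2).
    by ring.
  by have := mulr_ge0 h2 h1; lra.
rewrite RintegralZl // RintegralD //.
have h2 := sqr_ge0 (c0 R); nra.
Qed.

(** * Approximate identities *)

Definition L1box (R : realType) (c : R * R) (r : R) (f : R * R -> R) : \bar R :=
  (\int[@area R]_(z in box c r) `|f z|%:E)%E.

Lemma mes2_norm_box (R : realType) (c : R * R) (r : R) (f : R * R -> R) :
  mes2 f -> measurable_fun (box c r : set (measurableTypeR R * measurableTypeR R))
    (fun z => `|f z|%:E).
Proof.
by move=> mf; apply/measurable_EFinP; apply: measurable_funTS; exact: measurableT_comp.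
Qed.

Lemma L1box_le (R : realType) (c : R * R) (r : R) (f g : R * R -> R) :
  mes2 f -> mes2 g -> (forall z, box c r z -> `|f z| <= `|g z|) ->
  (L1box c r f <= L1box c r g)%E.
Proof.
move=> mf mg fg; apply: ge0_le_integral => //.
- exact: mes2_norm_box.
- exact: mes2_norm_box.
Qed.

Lemma L1box_add (R : realType) (c : R * R) (r : R) (f g : R * R -> R) :
  mes2 f -> mes2 g ->
  (L1box c r (fun z => (f z + g z)%R) <= L1box c r f + L1box c r g)%E.
Proof.
move=> mf mg; rewrite /L1box -ge0_integralD //; first last.
- exact: mes2_norm_box.
- exact: mes2_norm_box.
apply: ge0_le_integral => //.
- by apply: (@mes2_norm_box R c r (fun z => f z + g z)); exact: measurable_funD.
- by apply: emeasurable_funD; exact: mes2_norm_box.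
- by move=> z _; rewrite -EFinD lee_fin ler_normD.
Qed.

Lemma L1box_scale (R : realType) (c : R * R) (r a : R) (f : R * R -> R) : mes2 f ->
  (L1box c r (fun z => (a * f z)%R) = `|a|%:E * L1box c r f)%E.
Proof.
move=> mf; rewrite /L1box -ge0_integralZl //; last exact: mes2_norm_box.
by apply: eq_integral => z _; rewrite normrM EFinM.
Qed.

(** Density of continuous functions in [L1] of every square. The convergence of mollifications is
    derived from it rather than from Lebesgue points. *)
Definition approxC (R : realType) (f : R * R -> R) : Prop :=
  forall c r (e : R), 0 < e -> exists2 phi : R * R -> R, continuous phi &
    (L1box c r (fun z => (f z - phi z)%R) < e%:E)%E.

Lemma approxC_continuous (R : realType) (f : R * R -> R) : continuous f -> approxC f.
Proof.
move=> cf c r e e0; exists f => //; rewrite /L1box integral0_eq ?lte_fin // => z _.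
by rewrite subrr normr0.
Qed.

Lemma approxC_add (R : realType) (f g : R * R -> R) : mes2 f -> mes2 g ->
  approxC f -> approxC g -> approxC (fun z => f z + g z).
Proof.
move=> mf mg af ag c r e e0; have e2 : 0 < e / 2 by rewrite divr_gt0.
have [p cp fp] := af c r _ e2; have [q cq gq] := ag c r _ e2.
exists (fun z => p z + q z) => [z|]; first by apply: cvgD; [exact: cp|exact: cq].
have mp := continuous_measurable2 cp; have mq := continuous_measurable2 cq.
rewrite (splitr e) EFinD; apply: le_lt_trans (lteD fp gq).
apply: le_trans (L1box_add _ _ _ _); [|exact: measurable_funB|exact: measurable_funB].
apply: L1box_le => [||z _].
- by apply: measurable_funB; exact: measurable_funD.
- by apply: measurable_funD; exact: measurable_funB.
- by rewrite le_eqVlt; apply/orP; left; apply/eqP; congr `|_|; ring.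
Qed.

Lemma approxC_scale (R : realType) (a : R) (f : R * R -> R) : mes2 f ->
  approxC f -> approxC (fun z => a * f z).
Proof.
move=> mf af c r e e0; have a1 : 0 < `|a| + 1 by rewrite ltr_wpDl.
have [p cp fp] := af c r _ (divr_gt0 e0 a1).
have mp := continuous_measurable2 cp.
exists (fun z => a * p z) => [z|]; first by apply: cvgM; [exact: cvg_cst|exact: cp].
have -> : (fun z => a * f z - a * p z) = (fun z => a * (f z - p z)).
  by apply/funext => z; rewrite mulrBr.
rewrite L1box_scale; last exact: measurable_funB.
apply: (@le_lt_trans _ _ ((`|a| + 1)%:E * L1box c r (fun z => (f z - p z)%R))%E).
  rewrite lee_wpmul2r //; first by apply: integral_ge0.
  by rewrite lee_fin lerDl.
by rewrite muleC -lte_pdivlMr.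
Qed.

Lemma integral_box_prod (R : realType) (c : R * R) (r : R) (F G : R -> R) :
  measurable_fun setT F -> measurable_fun setT G ->
  L1box c r (fun z => F z.1 * G z.2) =
  ((\int[@lebesgue_measure R]_(x in [set` `[c.1 - r, c.1 + r]%R]) `|F x|%:E) *
   (\int[@lebesgue_measure R]_(x in [set` `[c.2 - r, c.2 + r]%R]) `|G x|%:E))%E.
Proof.
move=> mF mG.
pose I1 : set (measurableTypeR R) := [set` `[c.1 - r, c.1 + r]].
pose I2 : set (measurableTypeR R) := [set` `[c.2 - r, c.2 + r]].
have mI1 : measurable I1 by exact: measurable_itv.
have mI2 : measurable I2 by exact: measurable_itv.
pose f1 : measurableTypeR R -> \bar R := (fun x => `|F x|%:E) \_ I1.
pose f2 : measurableTypeR R -> \bar R := (fun x => `|G x|%:E) \_ I2.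
have mf1 : measurable_fun setT f1.
  apply/(measurable_restrictT _ _).1; first exact: mI1.
  by apply/measurable_EFinP; apply: measurable_funTS; exact: measurableT_comp.
have mf2 : measurable_fun setT f2.
  apply/(measurable_restrictT _ _).1; first exact: mI2.
  by apply/measurable_EFinP; apply: measurable_funTS; exact: measurableT_comp.
have f10 x : (0 <= f1 x)%E by rewrite /f1 patchE; case: ifP.
have f20 x : (0 <= f2 x)%E by rewrite /f2 patchE; case: ifP.
pose h (z : measurableTypeR R * measurableTypeR R) : \bar R := (f1 z.1 * f2 z.2)%E.
have mh : measurable_fun setT h.
  apply: emeasurable_funM.
    exact: (measurableT_comp mf1 measurable_fst).
  exact: (measurableT_comp mf2 measurable_snd).
have h0 z : (0 <= h z)%E by rewrite mule_ge0.
transitivity (\int[@area R]_z h z)%E.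
  rewrite /L1box integral_mkcond; apply: eq_integral => z _.
  rewrite patchE /h /f1 /f2 !patchE.
  have -> : (z \in box c r) = (z.1 \in I1) && (z.2 \in I2).
    by apply/idP/andP => [/set_mem[a b]|[/set_mem a /set_mem b]]; [split|]; apply/mem_set.
  case: (z.1 \in I1) => /=; case: (z.2 \in I2); rewrite ?mule0 ?mul0e //.
  by rewrite normrM EFinM.
rewrite [LHS](fubini_tonelli1 h mh h0) /fubini_F /h /=.
under eq_integral => x _ do rewrite ge0_integralZl //.
rewrite ge0_integralZr //; last by apply: integral_ge0.
by rewrite /f1 /f2 -!integral_mkcond.
Qed.

Lemma clip_dist (R : realType) (b : bool) (y : R) :
  `|b%:R - Num.min 1 (Num.max 0 y)| <= `|b%:R - y|.
Proof.
have b0 : 0 <= (b%:R : R) <= 1 by case: b; rewrite !lexx ler01.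
move: (b%:R : R) b0 => t /andP[t0 t1].
have [y0|y0] := leP y 0; first by rewrite ?max_l // min_r ?ler01 // !ger0_norm; lra.
by have [y1|y1] := leP 1 y; rewrite ?lexx // !ler0_norm; lra.
Qed.

(** The approximant is clipped to [[0, 1]], which does not increase its distance to a function with
    values [0] and [1]; the bounds on [u] are what the product estimate in the plane uses. *)
Lemma approx_indic1 (R : realType) (A : set (measurableTypeR R)) (a b e : R) :
  measurable A -> 0 < e ->
  exists u : R -> R, [/\ continuous u, forall x, 0 <= u x <= 1 &
    (\int[@lebesgue_measure R]_(x in `[a, b]) `|\1_A x - u x|%:E < e%:E)%E].
Proof.
move=> mA e0.
have lE : (@lebesgue_measure R `[a, b]%classic < +oo)%E.
  by rewrite lebesgue_measure_itv /=; case: ifP => // _; rewrite ltry.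
have iA : (@lebesgue_measure R).-integrable `[a, b] (EFin \o (\1_A : R -> R)).
  apply: measurable_bounded_integrable => //.
  exists 1; split; rewrite ?num_real // => x x1 z _ /=.
  by rewrite indicE; case: (_ \in _); rewrite ?normr1 ?normr0 ltW // (lt_trans _ x1).
have [g [cg ig g0]] := approximation_continuous_integrable (measurable_itv _) lE iA.
have [n gn] : exists n, (\int[@lebesgue_measure R]_(x in `[a, b]) `|(\1_A x - g n x)%:E| < e%:E)%E.
  have /fine_cvgP[_ /cvgrPdist_lt/(_ _ e0)] := g0.
  have /fine_cvgP[gf _] := g0.
  move=> h; have [n _ /(_ n (leqnn n))[nf]] : \forall n \near \oo,
     ((\int[@lebesgue_measure R]_(x in `[a, b]) `|(\1_A x - g n x)%:E|)%E \is a fin_num) /\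
     `|0 - fine (\int[@lebesgue_measure R]_(x in `[a, b]) `|(\1_A x - g n x)%:E|)%E| < e.
    by apply: filterS2 gf h.
  rewrite sub0r normrN ger0_norm ?fine_ge0 ?integral_ge0 // => lt.
  by exists n; rewrite -(fineK nf) lte_fin.
exists (fun x => Num.min 1 (Num.max 0 (g n x))); split.
- move=> x.
  have h1 : {for x, continuous (fun x => Num.max 0 (g n x))}.
    exact: (@continuous_max R _ (fun=> 0) (g n) x (cvg_cst _) (cg n x)).
  exact: (@continuous_min R _ (fun=> 1) (fun x => Num.max 0 (g n x)) x (cvg_cst _) h1).
- by move=> x; rewrite le_min ler01 le_max lexx ge_min lexx.
- apply: le_lt_trans gn; apply: ge0_le_integral => //.
  + apply/measurable_EFinP; apply: measurable_funTS; apply: measurableT_comp => //.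
    apply: measurable_funB; first exact: measurable_indic.
    apply: measurable_minr => //; apply: measurable_maxr => //.
    exact: continuous_measurable_fun.
  + apply: measurableT_comp => //; apply/measurable_EFinP; apply: measurable_funTS.
    apply: measurable_funB; first exact: measurable_indic.
    exact: continuous_measurable_fun.
  + by move=> x _; rewrite /= lee_fin indicE clip_dist.
Qed.
Lemma approxC_setX (R : realType) (A B : set (measurableTypeR R)) :
  measurable A -> measurable B -> approxC (\1_(A `*` B) : R * R -> R).
Proof.
move=> mA mB c r e e0.
pose I1 : set (measurableTypeR R) := [set` `[c.1 - r, c.1 + r]].
pose I2 : set (measurableTypeR R) := [set` `[c.2 - r, c.2 + r]].
have [k k0 [k1 k2]] : exists2 k : R, 0 < k & (@lebesgue_measure R I1 <= k%:E)%E /\ (@lebesgue_measure R I2 <= k%:E)%E.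
  exists (2 * `|r| + 1); first by rewrite ltr_wpDl // mulr_ge0.
  have hr := ler_norm r; have hr0 := normr_ge0 r.
  rewrite !lebesgue_measure_itv /=; split; case: ifP => _; rewrite -?EFinB lee_fin; lra.
have d0 : 0 < e / (2 * k) by rewrite divr_gt0 // mulr_gt0.
have [u [cu u01 Au]] := approx_indic1 (c.1 - r) (c.1 + r) mA d0.
have [v [cv v01 Bv]] := approx_indic1 (c.2 - r) (c.2 + r) mB d0.
have cuv : continuous (fun z : R * R => u z.1 * v z.2).
  move=> z; apply: cvgM.
    by apply: (cvg_comp fst u); [exact: cvg_fst|exact: cu].
  by apply: (cvg_comp snd v); [exact: cvg_snd|exact: cv].
exists (fun z => u z.1 * v z.2) => //.
have mu1 := continuous_measurable_fun cu; have mv1 := continuous_measurable_fun cv.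
have mAu : measurable_fun setT (fun x : R => \1_A x - u x).
  by apply: measurable_funB => //; exact: measurable_indic.
have mBv : measurable_fun setT (fun x : R => \1_B x - v x).
  by apply: measurable_funB => //; exact: measurable_indic.
have m1 : measurable_fun setT (fun x : R => (1 : R)) by exact: measurable_cst.
have E1 := integral_box_prod c r mAu m1.
have E2 := integral_box_prod c r m1 mBv.
have lt1 : (L1box c r (fun z => ((\1_A z.1 - u z.1) * 1)%R) < (e / 2)%:E)%E.
  rewrite E1; under [X in (_ * X)%E]eq_integral do rewrite normr1.
  rewrite integral_cst // mul1e.
  apply: (@le_lt_trans _ _ ((\int[@lebesgue_measure R]_(x in I1) `|\1_A x - u x|%:E) * k%:E)%E).
    by rewrite lee_wpmul2l //; apply: integral_ge0.
  rewrite -lte_pdivlMr // -EFinM (_ : (e / 2) * k^-1 = e / (2 * k)) //.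
  by rewrite invfM mulrA.
have lt2 : (L1box c r (fun z => (1 * (\1_B z.2 - v z.2))%R) < (e / 2)%:E)%E.
  rewrite E2; under [X in (X * _)%E]eq_integral do rewrite normr1.
  rewrite integral_cst // mul1e muleC.
  apply: (@le_lt_trans _ _ ((\int[@lebesgue_measure R]_(x in I2) `|\1_B x - v x|%:E) * k%:E)%E).
    by rewrite lee_wpmul2l //; apply: integral_ge0.
  rewrite -lte_pdivlMr // -EFinM (_ : (e / 2) * k^-1 = e / (2 * k)) //.
  by rewrite invfM mulrA.
have mf1 : mes2 (fun z : R * R => `|(\1_A z.1 - u z.1) * 1|).
  apply: measurableT_comp => //; apply: measurable_funM => //.
  exact: (measurableT_comp mAu measurable_fst).
have mf2 : mes2 (fun z : R * R => `|1 * (\1_B z.2 - v z.2)|).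
  apply: measurableT_comp => //; apply: measurable_funM => //.
  exact: (measurableT_comp mBv measurable_snd).
have nn (f : R * R -> R) : L1box c r (fun z => `|f z|) = L1box c r f.
  by apply: eq_integral => z _; rewrite normr_id.
rewrite (splitr e) EFinD; apply: le_lt_trans (lteD lt1 lt2).
rewrite -[X in (_ <= X + _)%E]nn -[X in (_ <= _ + X)%E]nn.
apply: le_trans (L1box_add c r mf1 mf2); apply: L1box_le.
- apply: measurable_funB; last exact: continuous_measurable2.
  by apply: measurable_indic; exact: measurableX.
- exact: measurable_funD.
move=> z _; rewrite mulr1 mul1r [leRHS]ger0_norm ?addr_ge0 //.
rewrite indicE in_setX !indicE.
(* Telescoping of the product; the factor left over in each summand is at most [1]. *)
have -> : ((z.1 \in A) && (z.2 \in B))%:R - u z.1 * v z.2 =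
    ((z.1 \in A)%:R - u z.1) * (z.2 \in B)%:R + u z.1 * ((z.2 \in B)%:R - v z.2).
  by case: (z.1 \in A); case: (z.2 \in B) => /=; ring.
apply: le_trans (ler_normD _ _) _; rewrite !normrM; apply: lerD.
  by rewrite ler_piMr //; case: (z.2 \in B); rewrite ?normr1 ?normr0.
rewrite ler_piMl //; have /andP[u0 u1] := u01 z.1.
by rewrite ger0_norm.
Qed.

(** Dynkin's lemma with the measurable rectangles as generators. Disjoint unions reduce to finite
    ones, because inside a square, which has finite area, the measure of the tail of the union tends
    to zero. *)
Lemma approxC_indic (R : realType) (S : set (measurableTypeR R * measurableTypeR R)) :
  measurable S -> approxC (\1_S : R * R -> R).
Proof.
move=> mS; pose T := (measurableTypeR R * measurableTypeR R)%type.
pose G : set (set T) := [set A `*` B | A in measurable & B in measurable].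
apply: (@dynkin_induction _ T G (fun S => approxC (\1_S : R * R -> R))); last first.
- by rewrite -measurable_prod_measurableType.
- move=> F mF tF aF.
  have mU n : measurable (\big[setU/set0]_(i < n) F i) by apply: bigsetU_measurable.
  have aU n : approxC (\1_(\big[setU/set0]_(i < n) F i) : R * R -> R).
    elim: n => [|n IH].
      rewrite big_ord0 (_ : \1_set0 = fun=> 0); last by apply/funext => z; rewrite indic0.
      by apply: approxC_continuous; exact: cst_continuous.
    rewrite big_ord_recr /=.
    rewrite (_ : \1_(_ `|` _) = (fun z : R * R => \1_(\big[setU/set0]_(i < n) F i) z + \1_(F n) z)).
      by apply: approxC_add => //; apply: measurable_indic.
    apply/funext => z; rewrite !indicE in_setU.
    have [zn|zn] := boolP (z \in F n); last by rewrite orbF addr0.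
    rewrite orbT; rewrite (_ : (z \in \big[setU/set0]_(i < n) F i) = false) ?add0r //.
    apply/negbTE/negP => /set_mem; rewrite -bigcup_mkord => -[i /= lin zi].
    have H := tF i n I I; move/set_mem in zn.
    by move: lin; rewrite ltnNge H ?leqnn //; exists z; split.
  move=> c r e e0; have e2 : 0 < e / 2 by rewrite divr_gt0.
  have mB : measurable (\bigcup_k F k) by exact: bigcup_measurable.
  have mD n : measurable ((\bigcup_k F k `\` \big[setU/set0]_(i < n) F i) `&` box c r).
    by apply: measurableI => //; exact: measurableD.
  have D0 : @area R ((\bigcup_k F k `\` \big[setU/set0]_(i < n) F i) `&` box c r) @[n --> \oo] --> (0 : \bar R)%E.
    pose D n := (\bigcup_k F k `\` \big[setU/set0]_(i < n) F i) `&` box c r.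
    have DI : \bigcap_n D n = set0.
      apply/seteqP; split => // z H; have [[[k _ Fk] _] _] := H 0%N I.
      have [[_ +] _] := H k.+1 I; apply; rewrite -bigcup_mkord; exists k => //=.
    have Dlty : (@area R (D 0%N) < +oo)%E.
      apply: le_lt_trans (area_box_lty c r); apply: le_measure; rewrite ?inE //; [exact: mD|by move=> z []].
    have mDI : measurable (\bigcap_n D n) by rewrite DI.
    have Dni : {homo D : n m / (n <= m)%N >-> (m <= n)%O}.
      move=> n m nm; apply/subsetPset => z [[zF zU] zb]; split => //; split => // zn.
      apply: zU; move: zn; rewrite -!bigcup_mkord => -[i /= lin Fi]; exists i => //=.
      exact: leq_trans nm.
    have := nonincreasing_cvg_mu Dlty mD mDI Dni.
    by rewrite DI measure0.
  have [n Dn] : exists n, (@area R ((\bigcup_k F k `\` \big[setU/set0]_(i < n) F i) `&` box c r) < (e / 2)%:E)%E.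
    have /fine_cvgP[gf /cvgrPdist_lt/(_ _ e2) h] := D0.
    have [n _ /(_ n (leqnn n))[nf]] := filterI gf h.
    rewrite sub0r normrN ger0_norm ?fine_ge0 ?measure_ge0 // => lt.
    by exists n; rewrite -(fineK nf) lte_fin.
  have [p cp Up] := aU n c r _ e2; exists p => //.
  have mp := continuous_measurable2 cp.
  have m1 : mes2 (fun z : R * R => (\1_(\bigcup_k F k) z : R) - \1_(\big[setU/set0]_(i < n) F i) z).
    by apply: measurable_funB; exact: measurable_indic.
  have m2 : mes2 (fun z : R * R => (\1_(\big[setU/set0]_(i < n) F i) z : R) - p z).
    by apply: measurable_funB => //; exact: measurable_indic.
  have e1 : L1box c r (fun z : R * R => (\1_(\bigcup_k F k) z : R) - \1_(\big[setU/set0]_(i < n) F i) z) =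
      @area R ((\bigcup_k F k `\` \big[setU/set0]_(i < n) F i) `&` box c r).
    rewrite -integral_indic //; last exact: measurableD.
    apply: eq_integral => z _; congr EFin; rewrite !indicE in_setD.
    have [zU|zU] := boolP (z \in \big[setU/set0]_(i < n) F i); last first.
      by rewrite subr0 andbT; case: (_ \in _); rewrite ?normr1 ?normr0.
    rewrite andbF (_ : z \in _) ?subrr ?normr0 //; apply/mem_set.
    by move/set_mem : zU; rewrite -bigcup_mkord => -[i _ Fi]; exists i.
  rewrite (splitr e) EFinD; apply: le_lt_trans (lteD Dn Up); rewrite -e1.
  apply: le_trans (L1box_add c r m1 m2); apply: L1box_le.
  - by apply: measurable_funB => //; exact: measurable_indic.
  - exact: measurable_funD.
  - by move=> z _; rewrite le_eqVlt; apply/orP; left; apply/eqP; congr `|_|; ring.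
- move=> S' mS' aS'.
  rewrite (_ : \1_(~` S') = (fun z : R * R => 1 + -1 * \1_S' z)); last first.
    by apply/funext => z; rewrite indicC indicE; case: (z \in S'); rewrite /=; ring.
  apply: approxC_add => //.
  + by apply: measurable_funM => //; exact: measurable_indic.
  + by apply: approxC_continuous; exact: cst_continuous.
  + by apply: approxC_scale => //; exact: measurable_indic.
- by move=> _ [A mA [B mB <-]]; exact: approxC_setX.
- rewrite (_ : \1_setT = fun=> 1); last by apply/funext => z; rewrite indicT.
  by apply: approxC_continuous; exact: cst_continuous.
- move=> _ _ [A mA [B mB <-]] [A' mA' [B' mB' <-]].
  by exists (A `&` A'); [exact: measurableI|exists (B `&` B'); [exact: measurableI|rewrite setXI]].
- exact: measurable_prod_measurableType.
Qed.
Import HBSimple.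

Lemma approxC_sfun (R : realType) (g : {sfun (measurableTypeR R * measurableTypeR R)%type >-> R}) :
  approxC (g : R * R -> R).
Proof.
have mg y : measurable (g @^-1` [set y]) by exact: measurable_sfunP.
have -> : (g : R * R -> R) = (fun z : R * R => \sum_(y <- finmap.enum_fset (fset_set (range g)))
    y * \1_(g @^-1` [set y]) z).
  by apply/funext => z; rewrite fimfunE fsbig_finite.
elim: (finmap.enum_fset _) => [|y s IH].
  rewrite (_ : (fun z => _) = fun=> 0); last by apply/funext => z; rewrite big_nil.
  by apply: approxC_continuous; exact: cst_continuous.
have -> : (fun z : R * R => \sum_(y0 <- (y :: s)) y0 * \1_(g @^-1` [set y0]) z) =
  (fun z => y * \1_(g @^-1` [set y]) z + \sum_(y0 <- s) y0 * \1_(g @^-1` [set y0]) z).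
  by apply/funext => z; rewrite big_cons.
apply: approxC_add.
- by apply: measurable_funM => //; exact: measurable_indic.
- apply: measurable_sum => y'.
  by apply: measurable_funM => //; exact: measurable_indic.
- by apply: approxC_scale; [exact: measurable_indic|exact: approxC_indic].
- exact: IH.
Qed.

Lemma approxC_locint (R : realType) (f : R * R -> R) : locint f -> approxC f.
Proof.
move=> [mf fi] c r e e0; have e2 : 0 < e / 2 by rewrite divr_gt0.
have [g [ig _ g0]] := approximation_sfun_integrable (measurable_box c r) (fi c r).
have [n gn] : exists n, (L1box c r (fun z => (f z - g n z)%R) < (e / 2)%:E)%E.
  have /fine_cvgP[gf /cvgrPdist_lt/(_ _ e2) h] := g0.
  have [n _ /(_ n (leqnn n))[nf]] := filterI gf h.
  rewrite sub0r normrN ger0_norm ?fine_ge0 ?integral_ge0 // => lt.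
  by exists n; rewrite /L1box -(fineK nf) lte_fin.
have [p cp pn] := @approxC_sfun R (g n) c r _ e2; exists p => //.
have mg : mes2 (g n : R * R -> R) by exact: measurable_funP.
have mp := continuous_measurable2 cp.
rewrite (splitr e) EFinD; apply: le_lt_trans (lteD gn pn).
apply: le_trans (L1box_add _ _ _ _); [|exact: measurable_funB|exact: measurable_funB].
apply: L1box_le => [||z _].
- exact: measurable_funB.
- by apply: measurable_funD; exact: measurable_funB.
- by rewrite le_eqVlt; apply/orP; left; apply/eqP; congr `|_|; ring.
Qed.

(** Only [z] is confined to the square: a mollification near the boundary also sees points
    outside. *)
Lemma continuous_box_uniform (R : realType) (f : R * R -> R) (c : R * R) (r e : R) :
  continuous f -> 0 < e -> exists2 d : R, 0 < d &
    forall z w, box c r z -> box z d w -> `|f z - f w| <= e.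
Proof.
move=> cf e0.
have cb := @compact_box R c r.
have := (compact_near_coveringP (box c r)).1 cb R (0^'+)
  (fun d z => forall w, box z d w -> `|f z - f w| <= e) _.
case=> [x _|].
  have e2 : 0 < e / 2 by rewrite divr_gt0.
  have /cvgrPdist_le/(_ _ e2) /nbhs_box[d d0 dP] := cf x.
  have d2 : 0 < d / 2 by rewrite divr_gt0.
  exists (box x (d / 2), [set t | t < d / 2]).
    split; first by apply/nbhs_box; exists (d / 2).
    by near=> t; near: t; exact: nbhs_right_lt.
  move=> [z t] [/= zx td] w wz.
  have zd : box x d z.
    by move: zx => /boxE[a b]; apply/boxE; split; lra.
  have wd : box x d w.
    move: zx wz => /boxE[a b] /boxE[a' b']; apply/boxE; split.
      rewrite (_ : w.1 - x.1 = (w.1 - z.1) + (z.1 - x.1)); last ring.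
      apply: le_trans (ler_normD _ _) _; lra.
    rewrite (_ : w.2 - x.2 = (w.2 - z.2) + (z.2 - x.2)); last ring.
    apply: le_trans (ler_normD _ _) _; lra.
  have h1 := dP _ zd; have h2 := dP _ wd; rewrite /= in h1 h2.
  rewrite (_ : f z - f w = (f x - f w) - (f x - f z)); last ring.
  apply: le_trans (ler_normB _ _) _; lra.
move=> d /= d0 dP; exists (d / 2); first by rewrite divr_gt0.
move=> z w zb wz; apply: (dP (d / 2)) => //=.
  by rewrite sub0r normrN gtr0_norm ?divr_gt0 //; lra.
by rewrite divr_gt0.
Unshelve. all: by end_near. Qed.

Lemma continuous_bounded_box (R : realType) (f : R * R -> R) (c : R * R) (r : R) :
  continuous f -> exists2 M, 0 <= M & forall z, box c r z -> `|f z| <= M.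
Proof.
move=> cf.
have [M [_ MP]] : bounded_set (f @` box c r).
  apply: compact_bounded; apply: continuous_compact; last exact: compact_box.
  exact: continuous_subspaceT.
exists (`|M| + 1) => [|z zb]; first by rewrite addr_ge0.
apply: (MP (`|M| + 1)); last by exists z.
by rewrite (le_lt_trans (ler_norm M))// ltrDl.
Qed.

Lemma continuous_locint (R : realType) (f : R * R -> R) : continuous f -> locint f.
Proof.
move=> cf; have mf := continuous_measurable2 cf; split => // c r.
have [M _ fM] := continuous_bounded_box c r cf.
apply: measurable_bounded_integrable; [exact: measurable_box|exact: area_box_lty| |].
  exact: measurable_funTS.
exists M; split; rewrite ?num_real // => x Mx z zb /=.
by apply: le_trans (ltW Mx); apply: fM.
Qed.

Lemma conv_eta_close (R : realType) (f : R * R -> R) (r e : R) z : 0 < r ->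
  continuous f -> (forall w, box z r w -> `|f z - f w| <= e) ->
  `|conv (eta r) f z - f z| <= e.
Proof.
move=> r0 cf fe.
have ke := kernel_continuous (kernel_eta r); have se := supp_eta r0.
have i1 := integrable_conv z ke se (continuous_locint cf).
have i0 := integrable_reflect z (integrable_eta r0).
have i2 : int2 (fun w => f z * eta r (z - w)).
  by have := integrableZl measurableT (f z) i0; exact: eq_integrable.
have i3 : int2 (fun w => e * eta r (z - w)).
  by have := integrableZl measurableT e i0; exact: eq_integrable.
have i4 : int2 (fun w => eta r (z - w) * f w - f z * eta r (z - w)).
  by have := integrableB measurableT i1 i2; exact: eq_integrable.
have -> : conv (eta r) f z - f z = \int[@area R]_w (eta r (z - w) * f w - f z * eta r (z - w)).
  by rewrite RintegralB // RintegralZl // integral_eta_reflect // mulr1.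
apply: le_trans (le_normr_Rintegral measurableT i4) _.
apply: (@le_trans _ _ (\int[@area R]_w (e * eta r (z - w)))); last first.
  by rewrite RintegralZl // integral_eta_reflect // mulr1.
apply: le_Rintegral => //; first exact: (integrable_norm i4).
move=> w _; rewrite mulrC -mulrBl normrM [`|eta _ _|]ger0_norm ?eta_ge0 //.
have [wz|wz] := pselect (box z r w).
  by rewrite ler_wpM2r ?eta_ge0 // distrC fe.
rewrite (_ : eta r (z - w) = 0) ?mulr0 //; apply: (supp_refl se) => //.
Qed.

(** On a square enlarged by [1], [f] is replaced by a continuous [p]. By Tonelli mollification does
    not increase the error [f - p], and [p] is uniformly continuous, so three errors of at most
    [e / 4] remain. *)
Lemma conv_eta_L1 (R : realType) (f : R * R -> R) (c : R * R) (s e : R) :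
  locint f -> 0 < e -> exists2 d : R, 0 < d & forall r : R, 0 < r -> r < d ->
    (L1box c s (fun z => (conv (eta r) f z - f z)%R) < e%:E)%E.
Proof.
move=> lf e0.
have e4 : 0 < e / 4 by rewrite divr_gt0.
have [p cp fp] := approxC_locint lf c (s + 1) e4.
(* The summand [1] covers [s = 0], and also negative [s], where the square is empty. *)
pose k := 4 * s ^+ 2 + 1.
have k0 : 0 < k by rewrite /k ltr_wpDl // mulr_ge0 ?sqr_ge0.
have ek : 0 < e / (4 * k) by rewrite divr_gt0 // mulr_gt0.
have [d d0 dp] := continuous_box_uniform c s cp ek.
have [mf fi] := lf; have mp := continuous_measurable2 cp.
have mfp : mes2 (fun z => f z - p z) by exact: measurable_funB.
have lp := continuous_locint cp.
(* The error is cut off to the enlarged square because Tonelli is applied on the whole plane; radii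
   below [1] do not see the cut. *)
pose q (z : R * R) : R := `|f z - p z| * \1_(box c (s + 1)) z.
have mq : mes2 q.
  apply: measurable_funM; first exact: measurableT_comp.
  by apply: measurable_indic; exact: measurable_box.
have q0 z : 0 <= q z by rewrite mulr_ge0.
have qL : (\int[@area R]_z (q z)%:E)%E = L1box c (s + 1) (fun z => f z - p z).
  rewrite /L1box [RHS]integral_mkcond; apply: eq_integral => z _.
  by rewrite patchE /q indicE; case: ifP => _; rewrite ?mulr1 ?mulr0.
exists (Num.min 1 d) => [|r r0]; first by rewrite lt_min ltr01.
rewrite lt_min => /andP[r1 rd].
have ke := kernel_continuous (kernel_eta r); have se := supp_eta r0.
have mcf : mes2 (conv (eta r) f).
  by apply: continuous_measurable2; exact: (conv_continuous (kernel_eta r) se lf).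
have mcp : mes2 (conv (eta r) p).
  by apply: continuous_measurable2; exact: (conv_continuous (kernel_eta r) se lp).
have m1 : mes2 (fun z => conv (eta r) f z - conv (eta r) p z) by exact: measurable_funB.
have m2 : mes2 (fun z => conv (eta r) p z - p z) by exact: measurable_funB.
have m3 : mes2 (fun z => p z - f z) by exact: measurable_funB.
have t3 : L1box c s (fun z => p z - f z) = L1box c s (fun z => f z - p z).
  by apply: eq_integral => z _; rewrite distrC.
have b3 : (L1box c s (fun z => (f z - p z)%R) < (e / 4)%:E)%E.
  apply: le_lt_trans fp; apply: ge0_subset_integral => //; try exact: measurable_box.
    apply/measurable_EFinP; apply: measurable_funTS; exact: measurableT_comp mfp.
  by apply: box_sub; rewrite subrr normr0 addrAC subrr add0r ler01.
have b2 : (L1box c s (fun z => (conv (eta r) p z - p z)%R) <= (e / 4)%:E)%E.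
  apply: (@le_trans _ _ (\int[@area R]_(z in box c s) (e / (4 * k))%:E)%E).
    apply: ge0_le_integral => //; try exact: measurable_box.
    - by apply/measurable_EFinP; apply: measurable_funTS; exact: measurableT_comp m2.
    - move=> z zb; rewrite lee_fin; apply: conv_eta_close => // w wz; apply: dp => //.
      by apply: box_sub wz; rewrite subrr normr0 subr_ge0 ltW.
  rewrite integral_cst; last exact: measurable_box.
  apply: (@le_trans _ _ ((e / (4 * k))%:E * k%:E)%E).
    rewrite lee_wpmul2l ?lee_fin ?(ltW ek) //.
    have [s0|s0] := leP 0 s.
      by rewrite [X in (X <= _)%E]area_box // lee_fin /k lerDl.
    rewrite (_ : box c s = set0) ?measure0 ?lee_fin ?(ltW k0) //.
    by apply/seteqP; split => // z /boxE[a _]; have := normr_ge0 (z.1 - c.1); lra.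
  rewrite -EFinM lee_fin le_eqVlt; apply/orP; left; apply/eqP.
  by field; rewrite lt0r_neq0.
have b1 : (L1box c s (fun z => (conv (eta r) f z - conv (eta r) p z)%R) <= (e / 4)%:E)%E.
  apply: le_trans (ltW fp); rewrite -qL -(conv_eta_tonelli r0 mq q0).
  apply: (@le_trans _ _ (\int[@area R]_(z in box c s) \int[@area R]_w (eta r (z - w) * q w)%:E)%E); last first.
    apply: ge0_subset_integral => //; try exact: measurable_box.
      exact: measurable_integral_eta.
    by move=> z _; apply: integral_ge0 => w _; rewrite lee_fin mulr_ge0 ?eta_ge0.
  apply: ge0_le_integral => //; try exact: measurable_box.
  - by apply/measurable_EFinP; apply: measurable_funTS; exact: measurableT_comp m1.
  - exact: measurable_funTS (measurable_integral_eta r mq q0).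
  move=> z zb.
  have if_ := integrable_conv z ke se lf; have ip := integrable_conv z ke se lp.
  have ifp : int2 (fun w => eta r (z - w) * f w - eta r (z - w) * p w).
    by have := integrableB measurableT if_ ip; exact: eq_integrable.
  rewrite /conv -RintegralB //.
  rewrite EFin_normr_Rintegral //; apply: le_trans (le_abse_integral _ _ _) _ => //.
    by case/integrableP : ifp.
  apply: ge0_le_integral => //.
  - by apply: measurableT_comp => //; case/integrableP : ifp.
  - apply/measurable_EFinP; apply: measurable_funM => //.
    exact: (continuous_measurable2 (continuous_refl (a := z) ke)).
  move=> w _; rewrite /= lee_fin -mulrBr normrM ger0_norm ?eta_ge0 //.
  have [wz|wz] := pselect (box z r w).
    rewrite ler_wpM2l ?eta_ge0 // /q indicE mem_set ?mulr1 //.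
    move: wz zb => /boxE[a b] /boxE[a' b']; apply/boxE; split.
      rewrite (_ : w.1 - c.1 = (w.1 - z.1) + (z.1 - c.1)); last ring.
      apply: le_trans (ler_normD _ _) _; lra.
    rewrite (_ : w.2 - c.2 = (w.2 - z.2) + (z.2 - c.2)); last ring.
    apply: le_trans (ler_normD _ _) _; lra.
  by rewrite (_ : eta r (z - w) = 0) ?mul0r //; apply: (supp_refl se).
apply: (@le_lt_trans _ _ ((e / 4)%:E + ((e / 4)%:E + (e / 4)%:E))%E); last first.
  rewrite -!EFinD lte_fin; lra.
apply: le_trans (leeD b1 (leeD b2 (ltW b3))).
rewrite -t3; apply: (@le_trans _ _ (L1box c s (fun z => (conv (eta r) f z - conv (eta r) p z)%R) +
   L1box c s (fun z => ((conv (eta r) p z - p z) + (p z - f z))%R))%E); last first.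
  by rewrite leeD2l //; exact: L1box_add.
have m23 : mes2 (fun z => (conv (eta r) p z - p z) + (p z - f z)) by exact: measurable_funD.
apply: le_trans (L1box_add c s m1 m23); apply: L1box_le.
- exact: measurable_funB.
- exact: measurable_funD.
- by move=> z _; rewrite le_eqVlt; apply/orP; left; apply/eqP; congr `|_|; ring.
Qed.

(** * Almost everywhere statements on open sets *)

Lemma ae_imp (R : realType) (P Q : R * R -> Prop) :
  {ae @area R, forall z, P z} -> (forall z, P z -> Q z) -> {ae @area R, forall z, Q z}.
Proof.
move=> aP PQ; apply: (negligibleS _ aP) => z /= nQ hP; apply: nQ; exact: PQ.
Qed.

(** A Lindelof argument: the countably many rational squares on which the statement holds almost
    everywhere still cover [O], and the other rational squares contribute the empty set. *)
Lemma ae_box_cover (R : realType) (O : set (R * R)) (P : R * R -> Prop) :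
  (forall z, O z -> exists2 s : R, 0 < s & {ae @area R, forall w, box z s w -> P w}) ->
  {ae @area R, forall w, O w -> P w}.
Proof.
move=> OP.
pose I : countType := ((rat * rat) * nat)%type.
pose B (i : I) := box (ratr i.1.1 : R, ratr i.1.2 : R) i.2.+1%:R^-1.
pose good i := {ae @area R, forall w, B i w -> P w}.
pose F n : set (R * R) := if unpickle n is Some i then
  [set w | good i /\ ~ (B i w -> P w)] else set0.
have nF n : (@area R).-negligible (F n).
  rewrite /F; case: (unpickle n) => [i|]; last exact: negligible_set0.
  have [gi|gi] := pselect (good i).
    by apply: negligibleS gi => w [].
  by apply: negligibleS (negligible_set0 _) => w [].
apply: negligibleS (negligible_bigcup nF) => w.
move=> /= /not_implyP[Ow nPw].
have [s s0 sP] := OP w Ow.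
have [n ns] : exists n, 2 * n.+1%:R^-1 < s.
  exists (Num.truncn (2 / s)); rewrite -[ltLHS]invrK invfM invrK.
  rewrite -[ltRHS]invrK ltf_pV2 ?posrE ?invr_gt0 ?mulr_gt0 ?invr_gt0 //.
  by rewrite mulrC ltr_pdivlMr // mulrC; exact: truncnS_gt.
set d : R := n.+1%:R^-1 in ns.
have d0 : 0 < d by rewrite invr_gt0.
have rq (x : R) : exists q : rat, `|x - ratr q| <= d.
  have : x - d < x + d by lra.
  move=> /rat_in_itvoo[q]; rewrite inE /= => /itvP h; exists q.
  have h1 : x - d <= ratr q by rewrite h.
  have h2 : ratr q <= x + d by rewrite h.
  by rewrite ler_norml; apply/andP; split; lra.
have [a ha] := rq w.1; have [b hb] := rq w.2.
pose i : I := ((a, b), n).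
have Biw : B i w by apply/boxE.
have Fi m : unpickle m = Some i -> F m w.
  rewrite /F => ->; split; last by move=> /(_ Biw).
  apply: (ae_imp sP) => v wP Biv; apply: wP.
  move: Biv => /boxE[/= h1 h2]; move: ha hb; rewrite -/d in h1 h2 *.
  rewrite !ler_norml in h1 h2 * => h3 h4; apply/boxE; rewrite !ler_norml; lra.
by have := Fi _ (pickleK i); move: (pickle i) => m Fm; exists m.
Qed.

Lemma L1box_ae0 (R : realType) (c : R * R) (s : R) (f : R * R -> R) : mes2 f ->
  (forall e : R, 0 < e -> (L1box c s f <= e%:E)%E) ->
  {ae @area R, forall w, box c s w -> f w = 0}.
Proof.
move=> mf fe.
have i0 : (\int[@area R]_(z in box c s) `|(EFin \o f) z| = 0)%E.
  apply/eqP; rewrite eq_le integral_ge0 // andbT.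
  by apply/lee_addgt0Pr => e e0; rewrite add0e; exact: fe.
have mE : measurable_fun (box c s : set (measurableTypeR R * measurableTypeR R)) (EFin \o f).
  by apply/measurable_EFinP; exact: measurable_funTS.
have /(_ i0) h := (ae_eq_integral_abs (@area R) (measurable_box c s) mE).1.
by apply: (ae_imp h) => z zP /zP[].
Qed.

Lemma conv_eta_ae0 (R : realType) (O : set (R * R)) (f : R * R -> R) :
  open O -> locint f ->
  (forall z (r : R), 0 < r -> box z r `<=` O -> conv (eta r) f z = 0) ->
  {ae @area R, forall z, O z -> f z = 0}.
Proof.
move=> oO lf f0; have [mf _] := lf; apply: ae_box_cover => c Oc.
have /nbhs_box[s s0 sO] : nbhs c O by exact: open_nbhs_nbhs.
have s2 : 0 < s / 2 by rewrite divr_gt0.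
exists (s / 2) => //; apply: L1box_ae0 => // e e0.
have [d d0 dP] := conv_eta_L1 c (s / 2) lf e0.
pose r := Num.min (d / 2) (s / 2).
have r0 : 0 < r by rewrite lt_min !divr_gt0.
have rs : r <= s / 2 by rewrite ge_min lexx orbT.
have rd : r <= d / 2 by rewrite ge_min lexx.
have rd' : r < d by lra.
apply: le_trans (ltW (dP r r0 rd')).
rewrite le_eqVlt; apply/orP; left; apply/eqP; apply: eq_integral => z /set_mem /boxE[z1 z2].
rewrite f0 ?sub0r ?normrN // => w wz; apply: sO; apply: box_sub wz => /=; lra.
Qed.

Lemma conv_ae_eq (R : realType) (ka f g : R * R -> R) (O : set (R * R)) (r : R) z :
  continuous ka -> supp 0 r ka -> box z r `<=` O -> locint f -> locint g ->
  {ae @area R, forall w, O w -> f w = g w} -> conv ka f z = conv ka g z.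
Proof.
move=> ck sk zO lf lg fg; rewrite /conv /Rintegral; congr fine.
have mE h : locint h -> measurable_fun [set: measurableTypeR R * measurableTypeR R]
    (fun w => (ka (z - w) * h w)%:E).
  by move=> lh; have /integrableP[] := integrable_conv z ck sk lh.
apply: ae_eq_integral => //; [exact: mE|exact: mE|].
apply: (ae_imp fg) => w h _ /=; congr EFin.
have [wz|wz] := pselect (box z r w); first by rewrite h //; apply: zO.
by rewrite (supp_refl sk wz : ka (z - w) = 0) !mul0r.
Qed.

Definition sqint (R : realType) (f : R * R -> R) : Prop :=
  mes2 f /\ int2 (fun z => f z ^+ 2).

Lemma sqint_locint (R : realType) (f : R * R -> R) : sqint f -> locint f.
Proof.
move=> [mf fi]; split => // c r.
have i1 := integrable_cst_box c r (1 : R).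
have i2 : (@area R).-integrable (box c r) (EFin \o (fun z => f z ^+ 2)).
  by apply: integrableS fi.
apply: le_integrable (integrableD _ i1 i2) => //.
  by apply/measurable_EFinP; exact: measurable_funTS.
move=> z _ /=; rewrite lee_fin [leRHS]ger0_norm ?addr_ge0 ?sqr_ge0 //.
have h := sqr_ge0 (`|f z| - 1); have h2 : `|f z| ^+ 2 = f z ^+ 2 by rewrite real_normK ?num_real.
by have := normr_ge0 (f z); nra.
Qed.

(** * Complex derivatives of mollified functions *)

Lemma convDr (R : realType) (ka f g : R * R -> R) (r : R) z :
  continuous ka -> supp 0 r ka -> locint f -> locint g ->
  conv ka (fun w => f w + g w) z = conv ka f z + conv ka g z.
Proof.
move=> ck sk lf lg; rewrite /conv -RintegralD //; first last.
- exact: (integrable_conv _ ck sk).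
- exact: (integrable_conv _ ck sk).
by apply: eq_Rintegral => w _; rewrite mulrDr.
Qed.

Lemma convBr (R : realType) (ka f g : R * R -> R) (r : R) z :
  continuous ka -> supp 0 r ka -> locint f -> locint g ->
  conv ka (fun w => f w - g w) z = conv ka f z - conv ka g z.
Proof.
move=> ck sk lf lg; rewrite /conv -RintegralB //; first last.
- exact: (integrable_conv _ ck sk).
- exact: (integrable_conv _ ck sk).
by apply: eq_Rintegral => w _; rewrite mulrBr.
Qed.

Lemma conv_xyker (R : realType) (e r : R) (f : R * R -> R) z : 0 < e -> e <= r ->
  locint f ->
  conv (partial false (xker e r)) f z + conv (partial true (yker e r)) f z =
  2 * c0 R * (conv (eta e) f z - conv (eta r) f z).
Proof.
move=> e0 er lf; have r0 : 0 < r := lt_le_trans e0 er.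
have cx := kernel_continuous (kernel_partial false (kernel_xker e r)).
have cy := kernel_continuous (kernel_partial true (kernel_yker e r)).
have sx := supp_partial false (supp_xker e0 er).
have sy := supp_partial true (supp_yker e0 er).
have ce := kernel_continuous (kernel_eta e); have cr := kernel_continuous (kernel_eta r).
have se := supp_le er (supp_eta e0); have sr := supp_eta r0.
rewrite -(convD z cx sx cy sy lf) -(convB z ce se cr sr lf).
have cB : continuous (fun w => eta e w - eta r w).
  by move=> w; apply: cvgB; [exact: ce|exact: cr].
have sB : supp 0 r (fun w => eta e w - eta r w).
  by move=> w wb; rewrite se // sr // subrr.
rewrite -(convZ (2 * c0 R) z cB sB lf).
by rewrite /conv; apply: eq_Rintegral => w _; rewrite div_xyker ?c0_gt0.
Qed.

(* The weak derivative [g] of [f] in the direction [k], tested against kernels only. *)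
Definition weak_deriv (R : realType) (O : set (R * R)) (k : bool) (f g : R * R -> R) :=
  forall ka (r : R) z, kernel ka -> supp 0 r ka -> 0 < r -> box z r `<=` O ->
    conv (partial k ka) f z = conv ka g z.

(** Both sides are the convolution of [f] with the same mixed second derivative of the kernel: weak
    gradients are curl free. *)
Lemma weak_deriv_curl (R : realType) (O : set (R * R)) (f fx fy : R * R -> R)
    (ka : R * R -> R) (r : R) z :
  weak_deriv O false f fx -> weak_deriv O true f fy ->
  kernel ka -> supp 0 r ka -> 0 < r -> box z r `<=` O ->
  conv (partial true ka) fx z = conv (partial false ka) fy z.
Proof.
move=> wx wy kk sk r0 zO.
rewrite -(wx _ _ _ (kernel_partial true kk) (supp_partial true sk) r0 zO).
rewrite -(wy _ _ _ (kernel_partial false kk) (supp_partial false sk) r0 zO).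
by rewrite kernel_partialC.
Qed.

(* [p + i q] has the complex derivatives [F1 + i F2] and [G1 + i G2] with respect
   to [z] and [zbar]. *)
Definition wirtinger (R : realType) (O : set (R * R)) (p q F1 F2 G1 G2 : R * R -> R) :=
  [/\ locint p /\ locint q, [/\ locint F1, locint F2, locint G1 & locint G2],
   weak_deriv O false p (fun w => F1 w + G1 w),
   weak_deriv O true p (fun w => G2 w - F2 w) &
   weak_deriv O false q (fun w => F2 w + G2 w) /\
   weak_deriv O true q (fun w => F1 w - G1 w)].

(** Real and imaginary parts of [c0 (eta e - eta r) * F = (d_z phi) * G], doubled. The curl
    identities of [p] and [q], each against [xker] and [yker], are four linear relations among
    convolutions of [F] and [G], from which the two equations follow. *)
Lemma beltrami_conv (R : realType) (O : set (R * R)) (p q F1 F2 G1 G2 : R * R -> R)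
    (e r : R) z :
  wirtinger O p q F1 F2 G1 G2 -> 0 < e -> e <= r -> box z r `<=` O ->
  2 * c0 R * (conv (eta e) F1 z - conv (eta r) F1 z) =
    conv (partial false (xker e r)) G1 z - conv (partial true (yker e r)) G1 z +
    2 * conv (partial true (xker e r)) G2 z /\
  2 * c0 R * (conv (eta e) F2 z - conv (eta r) F2 z) =
    conv (partial false (xker e r)) G2 z - conv (partial true (yker e r)) G2 z -
    2 * conv (partial true (xker e r)) G1 z.
Proof.
move=> [_ [l1 l2 l3 l4] px py [qx qy]] e0 er zO.
have r0 : 0 < r := lt_le_trans e0 er.
have kx := kernel_xker e r; have ky := kernel_yker e r.
have sx := supp_xker e0 er; have sy := supp_yker e0 er.
rewrite -!conv_xyker //.
have := weak_deriv_curl px py kx sx r0 zO; have := weak_deriv_curl px py ky sy r0 zO.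
have := weak_deriv_curl qx qy kx sx r0 zO; have := weak_deriv_curl qx qy ky sy r0 zO.
rewrite -!partial_xker_yker.
have cxx := kernel_continuous (kernel_partial false kx).
have cxy := kernel_continuous (kernel_partial true kx).
have cyy := kernel_continuous (kernel_partial true ky).
have sxx := supp_partial false sx; have sxy := supp_partial true sx.
have syy := supp_partial true sy.
have D ka f g := @convDr R ka f g r z; have B ka f g := @convBr R ka f g r z.
clear px py qx qy; move: (@conv R) D B => cv D B; clear kx ky sx sy.
move: (partial false (xker e r)) (partial true (xker e r)) (partial true (yker e r))
  cxx cxy cyy sxx sxy syy => ax ay bz cxx cxy cyy sxx sxy syy.
rewrite (D _ _ _ cyy syy l2 l4) (B _ _ _ cxy sxy l1 l3).
rewrite (D _ _ _ cxy sxy l2 l4) (B _ _ _ cxx sxx l1 l3).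
rewrite (D _ _ _ cyy syy l1 l3) (B _ _ _ cxy sxy l4 l2).
rewrite (D _ _ _ cxy sxy l1 l3) (B _ _ _ cxx sxx l4 l2).
by move=> *; split; lra.
Qed.

(** Real and imaginary parts of the Cauchy type formula for [h]. It is used with [e = t r]: for
    bounded [G] the right side is then [O(r)], which makes the mollifications of [h] converge
    geometrically. *)
Lemma cauchy_conv (R : realType) (O : set (R * R)) (p q F1 F2 G1 G2 : R * R -> R)
    (e r : R) z :
  wirtinger O p q F1 F2 G1 G2 -> 0 < e -> e <= r -> box z r `<=` O ->
  c0 R * (conv (eta e) p z - conv (eta r) p z) =
    conv (xker e r) G1 z + conv (yker e r) G2 z /\
  c0 R * (conv (eta e) q z - conv (eta r) q z) =
    conv (xker e r) G2 z - conv (yker e r) G1 z.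
Proof.
move=> [[lp lq] [l1 l2 l3 l4] px py [qx qy]] e0 er zO.
have r0 : 0 < r := lt_le_trans e0 er.
have kx := kernel_xker e r; have ky := kernel_yker e r.
have sx := supp_xker e0 er; have sy := supp_yker e0 er.
have hp := conv_xyker z e0 er lp; have hq := conv_xyker z e0 er lq.
have cx := kernel_continuous kx; have cy := kernel_continuous ky.
have D ka f g := @convDr R ka f g r z; have B ka f g := @convBr R ka f g r z.
have := px _ _ _ kx sx r0 zO; have := px _ _ _ ky sy r0 zO.
have := py _ _ _ kx sx r0 zO; have := py _ _ _ ky sy r0 zO.
have := qx _ _ _ kx sx r0 zO; have := qx _ _ _ ky sy r0 zO.
have := qy _ _ _ kx sx r0 zO; have := qy _ _ _ ky sy r0 zO.
rewrite -!partial_xker_yker in hp hq *.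
clear px py qx qy lp lq; move: (@conv R) D B hp hq => cv D B hp hq; clear kx ky.
move: (partial false (xker e r)) (partial true (xker e r)) (partial true (yker e r)) hp hq
  => ax ay bz.
move: (xker e r) (yker e r) (eta e) (eta r) cx cy sx sy => a b ee er' cx cy sx sy hp hq.
rewrite (B _ _ _ cy sy l1 l3) (B _ _ _ cx sx l1 l3).
rewrite (D _ _ _ cy sy l2 l4) (D _ _ _ cx sx l2 l4).
rewrite (B _ _ _ cy sy l4 l2) (B _ _ _ cx sx l4 l2).
rewrite (D _ _ _ cy sy l1 l3) (D _ _ _ cx sx l1 l3).
by move=> *; split; lra.
Qed.

(** * Localisation of the Beurling bound *)

Lemma conv_eq_box (R : realType) (ka f g : R * R -> R) (r : R) z :
  supp 0 r ka -> (forall w, box z r w -> f w = g w) -> conv ka f z = conv ka g z.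
Proof.
move=> sk fg; rewrite /conv; apply: eq_Rintegral => w _.
have [wz|wz] := pselect (box z r w); first by rewrite fg.
by rewrite (supp_refl sk wz : ka (z - w) = 0) !mul0r.
Qed.

(** Derivatives of kernels have mean zero. Constants can therefore be subtracted from [G], so that
    its oscillation and not its size enters the estimates. *)
Lemma conv_partial_cst (R : realType) (k : bool) (ka : R * R -> R) (r c : R) z :
  kernel ka -> supp 0 r ka -> conv (partial k ka) (cst c) z = 0.
Proof.
move=> kk sk; rewrite /conv.
have k' := kernel_continuous (kernel_partial k kk); have s' := supp_partial k sk.
have i0 := integrable_reflect z (integrable_continuous_box k' s').
rewrite RintegralZr // Rintegral_reflect ?(integrable_continuous_box k' s') //.
by rewrite (integral_partial sk) ?mul0r // => q; exact: kernel_derivable.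
Qed.

(* The box truncation that makes [beurling_bound] available for local estimates. *)
Definition cut (R : realType) (c : R * R) (r k : R) (f : R * R -> R) : R * R -> R :=
  (fun w => f w - k) \_ (box c r).

Lemma bddsupp_cut (R : realType) (c : R * R) (r k M : R) (f : R * R -> R) :
  mes2 f -> (forall z, `|f z| <= M) -> bddsupp c r (M + `|k|) (cut c r k f).
Proof.
move=> mf fM; split.
- apply/(measurable_restrictT _ (measurable_box c r)).
  by apply: measurable_funTS; exact: measurable_funB.
- move=> z; rewrite /cut patchE; case: ifP => _; last first.
    by rewrite normr0 addr_ge0 // (le_trans _ (fM z)).
  by apply: le_trans (ler_normB _ _) _; rewrite lerD2r.
- by move=> z zb; rewrite /cut patchE memNset.
Qed.

Lemma Rintegral_cut (R : realType) (c : R * R) (r k : R) (f : R * R -> R) :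
  \int[@area R]_z cut c r k f z ^+ 2 = \int[@area R]_(z in box c r) (f z - k) ^+ 2.
Proof.
rewrite [RHS]Rintegral_mkcond; apply: eq_Rintegral => z _; rewrite /cut !patchE.
by case: ifP => // _; rewrite expr0n.
Qed.

Lemma conv_partial_cut (R : realType) (k : bool) (ka : R * R -> R) (r c s : R)
    (f : R * R -> R) (z0 z : R * R) :
  kernel ka -> supp 0 r ka -> locint f -> box z r `<=` box z0 s ->
  conv (partial k ka) (cut z0 s c f) z = conv (partial k ka) f z.
Proof.
move=> kk sk lf zs; have k' := kernel_continuous (kernel_partial k kk).
have s' := supp_partial k sk.
have -> : conv (partial k ka) (cut z0 s c f) z = conv (partial k ka) (fun w => f w - c) z.
  by apply: (conv_eq_box s') => w wz; rewrite /cut patchE mem_set //; apply: zs.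
have lc : locint (cst c : R * R -> R).
  by apply: continuous_locint; exact: cst_continuous.
have e := convBr z k' s' lf lc; apply: etrans e _.
by rewrite (conv_partial_cst k c z kk sk) subr0.
Qed.

(* [bre - i bim] is twice the convolution with [d_z phi], a truncated Beurling transform. *)
Definition bre (R : realType) (e r : R) (g : R * R -> R) (z : R * R) : R :=
  conv (partial false (xker e r)) g z - conv (partial true (yker e r)) g z.

Definition bim (R : realType) (e r : R) (g : R * R -> R) (z : R * R) : R :=
  2 * conv (partial true (xker e r)) g z.

Lemma bre_continuous (R : realType) (e r : R) (g : R * R -> R) : 0 < e -> e <= r ->
  locint g -> continuous (bre e r g).
Proof.
move=> e0 er lg z; apply: cvgB.
  exact: (conv_continuous (kernel_partial false (kernel_xker e r)) (supp_partial false (supp_xker e0 er)) lg).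
exact: (conv_continuous (kernel_partial true (kernel_yker e r)) (supp_partial true (supp_yker e0 er)) lg).
Qed.

Lemma bim_continuous (R : realType) (e r : R) (g : R * R -> R) : 0 < e -> e <= r ->
  locint g -> continuous (bim e r g).
Proof.
move=> e0 er lg z; apply: cvgM; first exact: cvg_cst.
exact: (conv_continuous (kernel_partial true (kernel_xker e r)) (supp_partial true (supp_xker e0 er)) lg).
Qed.

Lemma bre_supp (R : realType) (e r s : R) c (g : R * R -> R) : 0 < e -> e <= r ->
  supp c s g -> supp c (r + s) (bre e r g).
Proof.
move=> e0 er sg z zb; rewrite /bre.
rewrite (conv_supp (supp_partial false (supp_xker e0 er)) sg zb).
by rewrite (conv_supp (supp_partial true (supp_yker e0 er)) sg zb) subr0.
Qed.

Lemma bim_supp (R : realType) (e r s : R) c (g : R * R -> R) : 0 < e -> e <= r ->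
  supp c s g -> supp c (r + s) (bim e r g).
Proof.
move=> e0 er sg z zb; rewrite /bim.
by rewrite (conv_supp (supp_partial true (supp_xker e0 er)) sg zb) mulr0.
Qed.

Lemma integrable_sqr_supp (R : realType) (c : R * R) (s : R) (f : R * R -> R) :
  continuous f -> supp c s f -> int2 (fun z => f z ^+ 2).
Proof.
move=> cf sf; apply: (@integrable_continuous_box _ _ c s).
  by move=> z; apply: (@continuous_comp _ _ _ f (fun x : R => x ^+ 2)); [exact: cf|exact: exprn_continuous].
by move=> z zb; rewrite sf // expr0n.
Qed.

(** The bound for real functions applied to both components of [g1 + i g2]; the mixing of the
    components costs a factor [2], whence [32]. *)
Lemma beurling_bound2 (R : realType) (c : R * R) (s M1 M2 e r : R) (g1 g2 : R * R -> R) :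
  bddsupp c s M1 g1 -> bddsupp c s M2 g2 -> 0 < e -> e <= r ->
  int2 (fun z => (bre e r g1 z + bim e r g2 z) ^+ 2 + (bre e r g2 z - bim e r g1 z) ^+ 2) /\
  \int[@area R]_z ((bre e r g1 z + bim e r g2 z) ^+ 2 + (bre e r g2 z - bim e r g1 z) ^+ 2) <=
  32 * c0 R ^+ 2 * (\int[@area R]_z g1 z ^+ 2 + \int[@area R]_z g2 z ^+ 2).
Proof.
move=> b1 b2 e0 er.
have l1 := bddsupp_locint b1; have l2 := bddsupp_locint b2.
have h1 := beurling_bound b1 e0 er; have h2 := beurling_bound b2 e0 er.
have [_ _ s1] := b1; have [_ _ s2] := b2.
have cu1 := bre_continuous e0 er l1; have cu2 := bre_continuous e0 er l2.
have cw1 := bim_continuous e0 er l1; have cw2 := bim_continuous e0 er l2.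
have su1 := bre_supp e0 er s1; have su2 := bre_supp e0 er s2.
have sw1 := bim_supp e0 er s1; have sw2 := bim_supp e0 er s2.
have E g : \int[@area R]_z ((conv (partial false (xker e r)) g z - conv (partial true (yker e r)) g z) ^+ 2
     + 4 * conv (partial true (xker e r)) g z ^+ 2) = \int[@area R]_z (bre e r g z ^+ 2 + bim e r g z ^+ 2).
  by apply: eq_Rintegral => z _; rewrite /bre /bim [in RHS]exprMn -natrX.
rewrite !E in h1 h2; clear E.
move: (bre e r g1) (bre e r g2) (bim e r g1) (bim e r g2) cu1 cu2 cw1 cw2 su1 su2 sw1 sw2 h1 h2.
move=> u1 u2 w1 w2 cu1 cu2 cw1 cw2 su1 su2 sw1 sw2 h1 h2.
have cA : continuous (fun z => u1 z + w2 z).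
  by move=> z; apply: cvgD; [exact: cu1|exact: cw2].
have cB : continuous (fun z => u2 z - w1 z).
  by move=> z; apply: cvgB; [exact: cu2|exact: cw1].
have sA : supp c (r + s) (fun z => u1 z + w2 z) by move=> z zb; rewrite su1 // sw2 // addr0.
have sB : supp c (r + s) (fun z => u2 z - w1 z) by move=> z zb; rewrite su2 // sw1 // subr0.
have iAB : int2 (fun z => (u1 z + w2 z) ^+ 2 + (u2 z - w1 z) ^+ 2).
  have := integrableD measurableT (integrable_sqr_supp cA sA) (integrable_sqr_supp cB sB).
  exact: eq_integrable.
split => //.
have i1 : int2 (fun z => u1 z ^+ 2 + w1 z ^+ 2).
  have := integrableD measurableT (integrable_sqr_supp cu1 su1) (integrable_sqr_supp cw1 sw1).
  exact: eq_integrable.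
have i2 : int2 (fun z => u2 z ^+ 2 + w2 z ^+ 2).
  have := integrableD measurableT (integrable_sqr_supp cu2 su2) (integrable_sqr_supp cw2 sw2).
  exact: eq_integrable.
have i3 : int2 (fun z => (u1 z ^+ 2 + w1 z ^+ 2) + (u2 z ^+ 2 + w2 z ^+ 2)).
  by have := integrableD measurableT i1 i2; exact: eq_integrable.
have i4 : int2 (fun z => 2 * ((u1 z ^+ 2 + w1 z ^+ 2) + (u2 z ^+ 2 + w2 z ^+ 2))).
  by have := integrableZl measurableT 2 i3; exact: eq_integrable.
apply: (@le_trans _ _ (\int[@area R]_z (2 * ((u1 z ^+ 2 + w1 z ^+ 2) + (u2 z ^+ 2 + w2 z ^+ 2))))).
  apply: le_Rintegral => // z _.
  have := sqr_ge0 (u1 z - w2 z); have := sqr_ge0 (u2 z + w1 z); rewrite !sqrrD !sqrrN.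
  by rewrite !mulrN; lra.
rewrite RintegralZl // RintegralD //; move: h1 h2.
by set X := Rintegral _ _ _; set Y := Rintegral _ _ _; set X1 := Rintegral _ _ _; set Y1 := Rintegral _ _ _; lra.
Qed.

Lemma Rintegral_box_le (R : realType) (c : R * R) (r : R) (f : R * R -> R) :
  int2 f -> (forall z, 0 <= f z) -> \int[@area R]_(z in box c r) f z <= \int[@area R]_z f z.
Proof.
move=> fi f0; rewrite /Rintegral; apply: fine_le.
- by apply: integrable_fin_num => //; exact: (integrableS measurableT).
- exact: integrable_fin_num.
- apply: ge0_subset_integral => //.
  by case/integrableP : fi.
by move=> z _; rewrite lee_fin.
Qed.

Lemma bre_cut (R : realType) (e r c s : R) (f : R * R -> R) (z0 z : R * R) :
  0 < e -> e <= r -> locint f -> box z r `<=` box z0 s ->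
  bre e r (cut z0 s c f) z = bre e r f z.
Proof.
move=> e0 er lf zs; rewrite /bre.
have h1 := conv_partial_cut false c (kernel_xker e r) (supp_xker e0 er) lf zs.
have h2 := conv_partial_cut true c (kernel_yker e r) (supp_yker e0 er) lf zs.
exact: (f_equal2 (fun x y : R => x - y) h1 h2).
Qed.

Lemma bim_cut (R : realType) (e r c s : R) (f : R * R -> R) (z0 z : R * R) :
  0 < e -> e <= r -> locint f -> box z r `<=` box z0 s ->
  bim e r (cut z0 s c f) z = bim e r f z.
Proof.
move=> e0 er lf zs; rewrite /bim.
have h1 := conv_partial_cut true c (kernel_xker e r) (supp_xker e0 er) lf zs.
exact: (f_equal (fun x : R => 2 * x) h1).
Qed.

(** For [z] in [box z0 rho] the kernels see only [box z0 (2 * r)], where truncating and subtracting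
    [c1], [c2] leave the convolutions with their derivatives unchanged. The constant is
    [32 c0^2 / (4 c0^2)]. *)
Lemma beurling_local (R : realType) (O : set (R * R)) (p q F1 F2 G1 G2 : R * R -> R)
    (z0 : R * R) (e rho r M c1 c2 : R) :
  wirtinger O p q F1 F2 G1 G2 -> (forall z, `|G1 z| <= M) -> (forall z, `|G2 z| <= M) ->
  box z0 (2 * r) `<=` O -> 0 < e -> e <= r -> rho <= r ->
  \int[@area R]_(z in box z0 rho) ((conv (eta e) F1 z - conv (eta r) F1 z) ^+ 2 +
     (conv (eta e) F2 z - conv (eta r) F2 z) ^+ 2) <=
  8 * (\int[@area R]_(z in box z0 (2 * r)) (G1 z - c1) ^+ 2 +
       \int[@area R]_(z in box z0 (2 * r)) (G2 z - c2) ^+ 2).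
Proof.
move=> wH G1M G2M zO e0 er rr; have [_ [_ _ [m1 _] [m2 _]] _ _ _] := wH.
have [_ [_ _ l3 l4] _ _ _] := wH; have c0p := c0_gt0 R.
pose g1 := cut z0 (2 * r) c1 G1; pose g2 := cut z0 (2 * r) c2 G2.
have b1 : bddsupp z0 (2 * r) _ g1 := bddsupp_cut z0 (2 * r) c1 m1 G1M.
have b2 : bddsupp z0 (2 * r) _ g2 := bddsupp_cut z0 (2 * r) c2 m2 G2M.
have [iB leB] := beurling_bound2 b1 b2 e0 er.
rewrite -!Rintegral_cut -/g1 -/g2.
pose k := (4 * c0 R ^+ 2)^-1.
have k0 : 0 < k by rewrite invr_gt0 mulr_gt0 // exprn_gt0.
have -> : \int[@area R]_(z in box z0 rho) ((conv (eta e) F1 z - conv (eta r) F1 z) ^+ 2 +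
     (conv (eta e) F2 z - conv (eta r) F2 z) ^+ 2) =
  \int[@area R]_(z in box z0 rho) (k * ((bre e r g1 z + bim e r g2 z) ^+ 2 + (bre e r g2 z - bim e r g1 z) ^+ 2)).
  apply: eq_Rintegral => z /set_mem zb.
  have zr : box z r `<=` box z0 (2 * r).
    by move: zb => /boxE[z1 z2]; apply: box_sub; rewrite mulrDl mul1r addrK; lra.
  have [E1 E2] := beltrami_conv wH e0 er (subset_trans zr zO).
  have B1 := bre_cut c1 e0 er l3 zr; have B2 := bre_cut c2 e0 er l4 zr.
  have B3 := bim_cut c1 e0 er l3 zr; have B4 := bim_cut c2 e0 er l4 zr.
  have E1' : 2 * c0 R * (conv (eta e) F1 z - conv (eta r) F1 z) = bre e r g1 z + bim e r g2 z.
    by apply: etrans E1 _; rewrite -/(bre e r G1 z) -/(bim e r G2 z); congr (_ + _).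
  have E2' : 2 * c0 R * (conv (eta e) F2 z - conv (eta r) F2 z) = bre e r g2 z - bim e r g1 z.
    by apply: etrans E2 _; rewrite -/(bre e r G2 z) -/(bim e r G1 z); congr (_ - _).
  rewrite -E1' -E2' /k; move: (conv _ _ _ - _) (conv _ _ _ - _) => x y.
  by field; exact: lt0r_neq0.
have iB' : (@area R).-integrable (box z0 rho) (EFin \o (fun z => (bre e r g1 z + bim e r g2 z) ^+ 2 + (bre e r g2 z - bim e r g1 z) ^+ 2)).
  exact: (integrableS measurableT).
rewrite RintegralZl //.
have h : \int[@area R]_(z in box z0 rho) ((bre e r g1 z + bim e r g2 z) ^+ 2 + (bre e r g2 z - bim e r g1 z) ^+ 2) <= 32 * c0 R ^+ 2 * (\int[@area R]_z g1 z ^+ 2 + \int[@area R]_z g2 z ^+ 2).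
  by apply: le_trans leB; apply: Rintegral_box_le => // z; rewrite addr_ge0 ?sqr_ge0.
apply: le_trans (ler_wpM2l (ltW k0) h) _; rewrite le_eqVlt; apply/orP; left; apply/eqP.
by rewrite /k; field; exact: lt0r_neq0.
Qed.

(** * Campanato decay *)

Lemma measurable_trunc (R : realType) (f : R * R -> R) (t : R) : mes2 f ->
  mes2 (fun z => f z * (f z <= t)%R%:R).
Proof.
move=> mf; apply: measurable_funM => //.
rewrite (_ : (fun z => _) = \1_([set z | f z <= t] : set (measurableTypeR R * measurableTypeR R))).
  apply: measurable_indic; rewrite -[X in measurable X]setTI.
  rewrite (_ : [set z | f z <= t] = f @^-1` `]-oo, t]%classic).
    exact: (mf measurableT _ (measurable_itv _)).
  by apply/seteqP; split => z /=; rewrite in_itv.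
by apply/funext => z; rewrite indicE mem_setE.
Qed.

Lemma sqr_le_perturb (R : realDomainType) (a b m : R) : `|a| <= m ->
  a ^+ 2 <= b ^+ 2 + 2 * m * `|b - a|.
Proof.
move=> am; have h1 := sqr_ge0 (b - a).
have h2 : - (a * (b - a)) <= m * `|b - a|.
  apply: le_trans (ler_norm _) _; rewrite normrN normrM.
  by apply: ler_wpM2r.
by move: h1; rewrite sqrrB; lra.
Qed.

(** Monotone convergence reduces an estimate of a squared difference to the set where it is bounded;
    there [L1] convergence controls squares, by [sqr_le_perturb]. *)
Lemma integral_trunc_le (R : realType) (Q : set (measurableTypeR R * measurableTypeR R))
    (f : R * R -> R) (C : \bar R) :
  measurable Q -> mes2 f -> (forall z, 0 <= f z) ->
  (forall N : nat, (\int[@area R]_(z in Q) (f z * (f z <= N%:R)%R%:R)%:E <= C)%E) ->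
  (\int[@area R]_(z in Q) (f z)%:E <= C)%E.
Proof.
move=> mQ mf f0 fC.
pose g (n : nat) (z : R * R) : \bar R := (f z * (f z <= n%:R)%R%:R)%:E.
have mg n : measurable_fun Q (g n : measurableTypeR R * measurableTypeR R -> \bar R).
  by apply/measurable_EFinP; apply: measurable_funTS; exact: measurable_trunc.
have g0 n z : Q z -> (0 <= g n z)%E by move=> _; rewrite lee_fin mulr_ge0.
have ndg z : Q z -> {homo g^~ z : m n / (m <= n)%N >-> (m <= n)%E}.
  move=> _ m n mn; rewrite lee_fin ler_wpM2l ?f0 //.
  have [h|_] := boolP (f z <= m%:R); last by [].
  by rewrite (le_trans h) // ler_nat.
have := @cvg_monotone_convergence _ _ _ (@area R) _ mQ g mg g0 ndg.
have -> : (\int[@area R]_(x in Q) (fun x => limn (g ^~ x)) x = \int[@area R]_(z in Q) (f z)%:E)%E.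
  apply: eq_integral => z _; apply/cvg_lim => //.
  apply: cvg_near_cst; exists (Num.truncn (f z)).+1 => // n /= zn.
  rewrite /g (_ : f z <= n%:R) ?mulr1 //.
  by apply: le_trans (ltW (truncnS_gt _)) _; rewrite ler_nat.
move=> cv; rewrite -(cvg_lim _ cv) //; apply: lime_le; first by apply/cvg_ex; eexists; exact: cv.
by apply: nearW => n; exact: fC.
Qed.

Lemma integrable_sqr_sub_box (R : realType) (F H : R * R -> R) (c : R * R) (r : R) :
  sqint F -> continuous H ->
  (@area R).-integrable (box c r) (EFin \o (fun z => (F z - H z) ^+ 2)).
Proof.
move=> [mF iF] cH; have mH := continuous_measurable2 cH.
have cH2 : continuous (fun z => H z ^+ 2).
  by move=> z; apply: (@continuous_comp _ _ _ H (fun x : R => x ^+ 2)); [exact: cH|exact: exprn_continuous].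
have [_ /(_ c r) iH] := continuous_locint cH2.
have iF' : (@area R).-integrable (box c r) (EFin \o (fun z => F z ^+ 2)).
  exact: (integrableS measurableT).
have i2 : (@area R).-integrable (box c r) (EFin \o (fun z => 2 * (F z ^+ 2 + H z ^+ 2))).
  have := integrableZl (measurable_box c r) 2 (integrableD (measurable_box c r) iF' iH).
  exact: eq_integrable.
apply: le_integrable i2 => //.
  apply/measurable_EFinP; apply: measurable_funTS; apply: measurable_funX.
  exact: measurable_funB.
move=> z _ /=; rewrite lee_fin [leLHS]ger0_norm ?sqr_ge0 //.
rewrite [leRHS]ger0_norm ?mulr_ge0 ?addr_ge0 ?sqr_ge0 //.
by have := sqr_ge0 (F z + H z); rewrite sqrrB sqrrD; lra.
Qed.

(* Lower semicontinuity of the local [L2] norm under mollification. *)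
Lemma mollified_sqr_le (R : realType) (F1 F2 H1 H2 : R * R -> R) (c : R * R) (s r C : R) :
  sqint F1 -> sqint F2 -> continuous H1 -> continuous H2 -> 0 < r ->
  (forall e : R, 0 < e -> e <= r ->
    \int[@area R]_(z in box c s) ((conv (eta e) F1 z - H1 z) ^+ 2 +
      (conv (eta e) F2 z - H2 z) ^+ 2) <= C) ->
  \int[@area R]_(z in box c s) ((F1 z - H1 z) ^+ 2 + (F2 z - H2 z) ^+ 2) <= C.
Proof.
move=> q1 q2 c1 c2 r0 HC.
have l1 := sqint_locint q1; have l2 := sqint_locint q2.
have [m1 _] := q1; have [m2 _] := q2.
have n1 := continuous_measurable2 c1; have n2 := continuous_measurable2 c2.
pose D1 z := F1 z - H1 z; pose D2 z := F2 z - H2 z.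
have i12 : (@area R).-integrable (box c s) (EFin \o (fun z => D1 z ^+ 2 + D2 z ^+ 2)).
  have := integrableD (measurable_box c s) (integrable_sqr_sub_box c s q1 c1) (integrable_sqr_sub_box c s q2 c2).
  exact: eq_integrable.
have mD : mes2 (fun z => D1 z ^+ 2 + D2 z ^+ 2).
  by apply: measurable_funD; apply: measurable_funX; exact: measurable_funB.
rewrite -lee_fin fineK; last exact: (integrable_fin_num _ i12).
apply: integral_trunc_le => //.
  by move=> z; rewrite addr_ge0 ?sqr_ge0.
move=> N; apply/lee_addgt0Pr => e e0.
(* On the truncation set both differences are at most [N + 1], since [N <= (N + 1)^2], and
   [sqr_le_perturb] applies with [m = N + 1]. Thus [L1] convergence of the mollifications suffices,
   without an almost everywhere convergent subsequence. *)
pose k : R := 2 * N.+1%:R; have k0 : 0 < k by rewrite mulr_gt0.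
have ek : 0 < e / (2 * k) by rewrite divr_gt0 // mulr_gt0.
have [d1 d10 P1] := conv_eta_L1 c s l1 ek; have [d2 d20 P2] := conv_eta_L1 c s l2 ek.
pose t := Num.min r (Num.min (d1 / 2) (d2 / 2)).
have t0 : 0 < t by rewrite !lt_min r0 !divr_gt0.
have tr : t <= r by rewrite ge_min lexx.
have td1 : t < d1.
  have : t <= d1 / 2 by rewrite !ge_min lexx /= orbT.
  lra.
have td2 : t < d2.
  have : t <= d2 / 2 by rewrite !ge_min lexx /= !orbT.
  lra.
have {}P1 := P1 t t0 td1; have {}P2 := P2 t t0 td2.
have {HC} Ct := HC t t0 tr.
have ct1 := conv_continuous (kernel_eta t) (supp_eta t0) l1.
have ct2 := conv_continuous (kernel_eta t) (supp_eta t0) l2.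
move: (conv (eta t) F1) (conv (eta t) F2) P1 P2 Ct ct1 ct2 => f1 f2 P1 P2 Ct ct1 ct2.
have o1 := continuous_measurable2 ct1; have o2 := continuous_measurable2 ct2.
have cf : continuous (fun z => (f1 z - H1 z) ^+ 2 + (f2 z - H2 z) ^+ 2).
  move=> z; apply: cvgD.
    apply: (@continuous_comp _ _ _ (fun z => f1 z - H1 z) (fun x : R => x ^+ 2)); last exact: exprn_continuous.
    by apply: cvgB; [exact: ct1|exact: c1].
  apply: (@continuous_comp _ _ _ (fun z => f2 z - H2 z) (fun x : R => x ^+ 2)); last exact: exprn_continuous.
  by apply: cvgB; [exact: ct2|exact: c2].
have [_ /(_ c s) icf] := continuous_locint cf.
have mcf := continuous_measurable2 cf.
have mg1 : mes2 (fun z => k * `|f1 z - F1 z|).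
  by apply: measurable_funM => //; apply: measurableT_comp => //; exact: measurable_funB.
have mg2 : mes2 (fun z => k * `|f2 z - F2 z|).
  by apply: measurable_funM => //; apply: measurableT_comp => //; exact: measurable_funB.
apply: (@le_trans _ _ (\int[@area R]_(z in box c s) (((f1 z - H1 z) ^+ 2 + (f2 z - H2 z) ^+ 2) +
    (k * `|f1 z - F1 z| + k * `|f2 z - F2 z|))%:E)%E).
  apply: ge0_le_integral => //.
  - by move=> z _; rewrite lee_fin mulr_ge0 ?addr_ge0 ?sqr_ge0.
  - by apply/measurable_EFinP; apply: measurable_funTS; exact: measurable_trunc.
  - apply/measurable_EFinP; apply: measurable_funTS; apply: measurable_funD => //.
    exact: measurable_funD.
  move=> z _; rewrite lee_fin.
  have h1 := normr_ge0 (f1 z - F1 z); have h2 := normr_ge0 (f2 z - F2 z).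
  have [D2N|D2N] := boolP (D1 z ^+ 2 + D2 z ^+ 2 <= N%:R); last first.
    by rewrite mulr0 !addr_ge0 ?sqr_ge0 // mulr_ge0 // ltW.
  have NN : (N%:R : R) <= N.+1%:R ^+ 2.
    rewrite -natrX ler_nat; apply: leq_trans (leqnSn N) _.
    by rewrite -{1}[N.+1]expn1 leq_pexp2l.
  have a1 : `|D1 z| <= N.+1%:R.
    rewrite -ler_sqr ?nnegrE // real_normK ?num_real //.
    by have := sqr_ge0 (D2 z); lra.
  have a2 : `|D2 z| <= N.+1%:R.
    rewrite -ler_sqr ?nnegrE // real_normK ?num_real //.
    by have := sqr_ge0 (D1 z); lra.
  have := sqr_le_perturb (f1 z - H1 z) a1; have := sqr_le_perturb (f2 z - H2 z) a2.
  rewrite /D1 /D2 !opprB !addrA !subrK -/k mulr1; lra.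
have P (f F : R * R -> R) : mes2 f -> mes2 F -> (L1box c s (fun z => (f z - F z)%R) < (e / (2 * k))%:E)%E ->
  (\int[@area R]_(z in box c s) (k * `|f z - F z|)%:E <= (e / 2)%:E)%E.
  move=> mf mF fF; under eq_integral do rewrite EFinM.
  rewrite ge0_integralZl //; last 2 first.
    apply/measurable_EFinP; apply: measurable_funTS; apply: measurableT_comp => //.
    exact: measurable_funB.
    by rewrite lee_fin ltW.
  apply: (@le_trans _ _ (k%:E * (e / (2 * k))%:E)%E).
    by rewrite lee_wpmul2l ?lee_fin ?(ltW k0) // ltW.
  by rewrite -EFinM lee_fin le_eqVlt; apply/orP; left; apply/eqP; field; exact: lt0r_neq0.
under eq_integral do rewrite EFinD.
rewrite ge0_integralD //; first last.
- apply/measurable_EFinP; apply: measurable_funTS; exact: measurable_funD.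
- by move=> z _; rewrite lee_fin addr_ge0 // mulr_ge0 // ltW.
- by apply/measurable_EFinP; apply: measurable_funTS.
- by move=> z _; rewrite lee_fin addr_ge0 ?sqr_ge0.
under [X in (_ + X)%E]eq_integral do rewrite EFinD.
rewrite ge0_integralD //; first last.
- by apply/measurable_EFinP; apply: measurable_funTS.
- by move=> z _; rewrite lee_fin mulr_ge0 // ltW.
- by apply/measurable_EFinP; apply: measurable_funTS.
- by move=> z _; rewrite lee_fin mulr_ge0 // ltW.
apply: leeD; first by rewrite -lee_fin fineK in Ct; [|exact: (integrable_fin_num _ icf)].
by rewrite [e in leRHS]splitr EFinD; apply: leeD; apply: P.
Qed.

(** * Scaling of the kernels and deviation from constants *)

Lemma eta_scale (R : realType) (r : R) z : eta r z = r ^- 2 * eta 1 (r^-1 * z.1, r^-1 * z.2).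
Proof.
have e : r ^- 2 * (z.1 ^+ 2 + z.2 ^+ 2) = 1 ^- 2 * ((r^-1 * z.1) ^+ 2 + (r^-1 * z.2) ^+ 2).
  by rewrite expr1n invr1 mul1r !exprMn -mulrDr exprVn.
rewrite !etaE /= e; move: (omega _) => y.
by rewrite expr1n mulr1 invfM mulrA; congr (_ * _); rewrite mulrC.
Qed.

Lemma eta_le (R : realType) : exists2 C : R, 0 <= C & forall r z, `|eta r z| <= C * r ^- 2.
Proof.
have [C C0 HC] := continuous_box_bounded (kernel_continuous (kernel_eta (1 : R))) (supp_eta ltr01).
exists C => // r z; rewrite eta_scale normrM mulrC [`|r ^- 2|]ger0_norm ?invr_ge0 ?sqr_ge0 //.
by rewrite ler_wpM2r ?invr_ge0 ?sqr_ge0.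
Qed.

Lemma eta_lipschitz (R : realType) : exists2 L : R, 0 <= L & forall r p q, 0 < r ->
  `|eta r p - eta r q| <= L * r ^- 3 * (`|p.1 - q.1| + `|p.2 - q.2|).
Proof.
have [L L0 HL] := kernel_lipschitz (kernel_eta (1 : R)) (supp_eta ltr01).
exists L => // r p q r0; rewrite [eta r p]eta_scale [eta r q]eta_scale -mulrBr normrM.
rewrite ger0_norm ?invr_ge0 ?sqr_ge0 //.
apply: le_trans (ler_wpM2l _ (HL _ _)) _; first by rewrite invr_ge0 sqr_ge0.
rewrite /= -!mulrBr !normrM -mulrDr [`|r^-1|]gtr0_norm ?invr_gt0 //.
by rewrite le_eqVlt; apply/orP; left; apply/eqP; field; exact: lt0r_neq0.
Qed.

Lemma gdiff_scale (R : realType) (t r x : R) : gdiff (t * r) r x = r ^- 2 * gdiff t 1 (r ^- 2 * x).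
Proof.
rewrite /gdiff !expr1n invr1 !addr0 !mul1r exprMn invfM mulrDr -!mulrA.
by congr (_ + _); [rewrite mulrCA|rewrite !mulN1r mulrN mulNr].
Qed.

(** With the ratio [t] of the two radii fixed, the kernels of outer radius [r] are rescalings of
    those of radius [1], with a factor [1 / r]. *)
Lemma xker_le (R : realType) (t : R) : 0 < t -> t <= 1 ->
  exists2 C : R, 0 <= C & forall r z, 0 < r ->
    `|xker (t * r) r z| <= C * r^-1 /\ `|yker (t * r) r z| <= C * r^-1.
Proof.
move=> t0 t1.
have [C C0 HC] := continuous_box_bounded (kernel_continuous (kernel_xker t 1)) (supp_xker t0 t1).
have [C' C'0 HC'] := continuous_box_bounded (kernel_continuous (kernel_yker t 1)) (supp_yker t0 t1).
exists (C + C') => [|r z r0]; first exact: addr_ge0.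
have E : r ^- 2 * (z.1 ^+ 2 + z.2 ^+ 2) = (r^-1 * z.1) ^+ 2 + (r^-1 * z.2) ^+ 2.
  by rewrite !exprMn -mulrDr exprVn.
have rn : `|r^-1| = r^-1 by rewrite gtr0_norm ?invr_gt0.
have r1 : 0 <= r^-1 by rewrite invr_ge0 ltW.
split.
  have -> : xker (t * r) r z = r^-1 * xker t 1 (r^-1 * z.1, r^-1 * z.2).
    rewrite /xker /mon /= gdiff_scale E; field; exact: lt0r_neq0.
  rewrite normrM rn mulrC ler_wpM2r //; apply: le_trans (HC _) _; lra.
have -> : yker (t * r) r z = r^-1 * yker t 1 (r^-1 * z.1, r^-1 * z.2).
  rewrite /yker /mon /= gdiff_scale E; field; exact: lt0r_neq0.
rewrite normrM rn mulrC ler_wpM2r //; apply: le_trans (HC' _) _; lra.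
Qed.

Lemma Rintegral_cst_box (R : realType) (c : R * R) (s k : R) : 0 <= s ->
  \int[@area R]_(z in box c s) k = 4 * s ^+ 2 * k.
Proof.
move=> s0; rewrite Rintegral_cst; last exact: measurable_box.
by have -> := @area_box R c s s0; rewrite /= mulrC.
Qed.

(** The nonnegative integral of [(|f| - m)^2] is expanded, with [m] the average of [|f|]. *)
Lemma cauchy_schwarz_box (R : realType) (f : R * R -> R) (c : R * R) (s : R) : 0 < s ->
  locint f -> (@area R).-integrable (box c s) (EFin \o (fun z => f z ^+ 2)) ->
  (\int[@area R]_(z in box c s) `|f z|) ^+ 2 <= 4 * s ^+ 2 * \int[@area R]_(z in box c s) f z ^+ 2.
Proof.
move=> s0 lf i2; have [_ /(_ c s) i1] := locint_norm lf.
set I := \int[@area R]_(z in box c s) `|f z|.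
pose m := I / (4 * s ^+ 2).
have s2 : 0 < 4 * s ^+ 2 by rewrite mulr_gt0 // exprn_gt0.
have i3 : (@area R).-integrable (box c s) (EFin \o (fun z => 2 * m * `|f z|)).
  by have := integrableZl (measurable_box c s) (2 * m) i1; exact: eq_integrable.
have i4 := integrable_cst_box c s (m ^+ 2).
have i5 : (@area R).-integrable (box c s) (EFin \o (fun z => f z ^+ 2 - 2 * m * `|f z|)).
  by have := integrableB (measurable_box c s) i2 i3; exact: eq_integrable.
have h : 0 <= \int[@area R]_(z in box c s) ((f z ^+ 2 - 2 * m * `|f z|) + cst (m ^+ 2) z).
  apply: Rintegral_ge0 => z _ /=.
  have := sqr_ge0 (`|f z| - m); rewrite sqrrB real_normK ?num_real //; lra.
move: h; rewrite RintegralD // RintegralB // RintegralZl // (Rintegral_cst_box _ _ (ltW s0)).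
rewrite -/I; set J := \int[@area R]_(z in box c s) f z ^+ 2 => h.
have mE : m * (4 * s ^+ 2) = I by rewrite /m mulfVK // lt0r_neq0.
have : I ^+ 2 / (4 * s ^+ 2) <= J.
  have -> : I ^+ 2 / (4 * s ^+ 2) = m * I by rewrite /m; ring.
  have e : 4 * s ^+ 2 * m ^+ 2 = m * I by rewrite -mE; ring.
  by move: h; rewrite e; lra.
by rewrite ler_pdivrMr // mulrC.
Qed.

Lemma sqint_sub_box (R : realType) (F : R * R -> R) (c : R * R) (s k : R) : sqint F ->
  (@area R).-integrable (box c s) (EFin \o (fun z => (F z - k) ^+ 2)).
Proof. by move=> qF; apply: (@integrable_sqr_sub_box R F (cst k)) => //; exact: cst_continuous. Qed.

Lemma locint_sub (R : realType) (F : R * R -> R) (k : R) : locint F ->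
  locint (fun z => F z - k).
Proof.
move=> [mF iF]; split; first exact: measurable_funB.
move=> c r; have := integrableB (measurable_box c r) (iF c r) (integrable_cst_box c r k).
exact: eq_integrable.
Qed.

Lemma conv_eta_sub (R : realType) (F : R * R -> R) (k r : R) z : 0 < r -> locint F ->
  conv (eta r) (fun w => F w - k) z = conv (eta r) F z - k.
Proof.
move=> r0 lF; have ke := kernel_continuous (kernel_eta r); have se := supp_eta r0.
have lk : locint (cst k : R * R -> R) by apply: continuous_locint; exact: cst_continuous.
have e := convBr z ke se lF lk; apply: etrans e _; congr (_ - _).
have i0 := integrable_reflect z (integrable_eta r0).
by rewrite /conv RintegralZr // integral_eta_reflect // mul1r.
Qed.

(** Jensen's inequality, then the sup bound [C r^-2] of the mollifier. It compares the means of [F]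
    at two successive scales. *)
Lemma conv_eta_excess (R : realType) : exists2 C : R, 0 <= C &
  forall (F : R * R -> R) (k r : R) z, 0 < r -> sqint F ->
    (conv (eta r) F z - k) ^+ 2 <= C * r ^- 2 * \int[@area R]_(w in box z r) (F w - k) ^+ 2.
Proof.
have [C C0 HC] := eta_le R; exists C => // F k r z r0 qF.
have lF := sqint_locint qF; have lFk := locint_sub k lF; have [mF _] := lFk.
have l2 : locint (fun w => (F w - k) ^+ 2).
  by split; [exact: measurable_funX|move=> c s; exact: sqint_sub_box].
rewrite -(conv_eta_sub k z r0 lF).
apply: le_trans (conv_eta_sqr z r0 lFk l2) _.
apply: le_trans (ler_norm _) _.
have sz := supp_refl (a := z) (supp_eta r0).
have mz := continuous_measurable2 (continuous_refl (a := z) (kernel_continuous (kernel_eta r))).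
have := Rintegral_box_bound mz (fun w => HC r (z - w)) sz l2.
congr (_ <= _ * _); apply: eq_Rintegral => w _; by rewrite ger0_norm ?sqr_ge0.
Qed.

(** The difference of two translates of [eta r] has mean zero, so [k] may be subtracted from [F];
    its size is at most [2 L rho r^-3], and Cauchy-Schwarz on the square of half-side [2 r]
    concludes. The factor [rho^2] is the source of the decay. *)
Lemma conv_eta_oscillation (R : realType) : exists2 C : R, 0 <= C &
  forall (F : R * R -> R) (k r rho : R) z0 z, 0 < r -> rho <= r -> sqint F -> box z0 rho z ->
    (conv (eta r) F z - conv (eta r) F z0) ^+ 2 <=
    C * rho ^+ 2 * r ^- 4 * \int[@area R]_(w in box z0 (2 * r)) (F w - k) ^+ 2.
Proof.
have [L L0 HL] := eta_lipschitz R; exists (64 * L ^+ 2) => [|F k r rho z0 z r0 rr qF zb].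
  by rewrite mulr_ge0 ?sqr_ge0.
have lF := sqint_locint qF; have lFk := locint_sub k lF.
have ke := kernel_continuous (kernel_eta r); have se := supp_eta r0.
have -> : conv (eta r) F z - conv (eta r) F z0 =
    \int[@area R]_w ((eta r (z - w) - eta r (z0 - w)) * (F w - k)).
  have -> : conv (eta r) F z - conv (eta r) F z0 = (conv (eta r) F z - k) - (conv (eta r) F z0 - k).
    by move: (conv _ _ z) (conv _ _ z0) => x y; ring.
  rewrite -(conv_eta_sub k z r0 lF) -(conv_eta_sub k z0 r0 lF) /conv -RintegralB //.
  - by apply: eq_Rintegral => w _; rewrite mulrBl.
  - exact: (integrable_conv _ ke se lFk).
  - exact: (integrable_conv _ ke se lFk).
have [z1 z2] := (boxE _ _ _).1 zb.
have rho0 : 0 <= rho by apply: le_trans z1.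
have s1 : supp z0 (2 * r) (fun w => eta r (z - w) - eta r (z0 - w)).
  have A1 := supp_refl (a := z) se; have A2 := supp_refl (a := z0) se.
  move=> w wb; rewrite -/(refl z (eta r) w) -/(refl z0 (eta r) w) A1 ?A2 ?subrr //.
    by move=> h; apply: wb; apply: box_sub h; rewrite subrr normr0; lra.
  by move=> h; apply: wb; apply: box_sub h; lra.
have m1 : mes2 (fun w => eta r (z - w) - eta r (z0 - w)).
  by apply: measurable_funB; exact: (continuous_measurable2 (continuous_refl ke)).
have b1 w : `|eta r (z - w) - eta r (z0 - w)| <= L * r ^- 3 * (2 * rho).
  apply: le_trans (HL _ _ _ r0) _; rewrite ler_wpM2l ?mulr_ge0 ?invr_ge0 ?exprn_ge0 ?(ltW r0) //=.
  have -> : z.1 - w.1 - (z0.1 - w.1) = z.1 - z0.1 by ring.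
  have -> : z.2 - w.2 - (z0.2 - w.2) = z.2 - z0.2 by ring.
  lra.
have h := Rintegral_box_bound m1 b1 s1 lFk.
have r2 : 0 < 2 * r by rewrite mulr_gt0.
have cs := cauchy_schwarz_box r2 lFk (sqint_sub_box z0 (2 * r) k qF).
set J := \int[@area R]_(w in box z0 (2 * r)) (F w - k) ^+ 2 in cs *.
have h2 : (\int[@area R]_w ((eta r (z - w) - eta r (z0 - w)) * (F w - k))) ^+ 2 <=
    (L * r ^- 3 * (2 * rho) * \int[@area R]_(w in box z0 (2 * r)) `|F w - k|) ^+ 2.
  by rewrite -[leLHS]real_normK ?num_real // lerXn2r ?nnegrE // (le_trans _ h).
apply: le_trans h2 _; rewrite exprMn.
apply: le_trans (ler_wpM2l (sqr_ge0 _) cs) _.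
rewrite le_eqVlt; apply/orP; left; apply/eqP; field; exact: lt0r_neq0.
Qed.

(** The squared [L2] distance of [F1 + i F2] to the constant [a + i b], not divided by the area; the
    factors [s ^- 2] below normalise it. *)
Definition sqdev (R : realType) (F1 F2 : R * R -> R) (c : R * R) (s a b : R) : R :=
  \int[@area R]_(z in box c s) (F1 z - a) ^+ 2 + \int[@area R]_(z in box c s) (F2 z - b) ^+ 2.

Lemma sqdev_ge0 (R : realType) (F1 F2 : R * R -> R) (c : R * R) (s a b : R) :
  0 <= sqdev F1 F2 c s a b.
Proof. by rewrite addr_ge0 // Rintegral_ge0 // => z _; exact: sqr_ge0. Qed.

Lemma sqdev_le (R : realType) (F1 F2 : R * R -> R) (c d : R * R) (s t a b : R) :
  sqint F1 -> sqint F2 -> box c s `<=` box d t ->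
  sqdev F1 F2 c s a b <= sqdev F1 F2 d t a b.
Proof.
have P F k : sqint F -> box c s `<=` box d t ->
    \int[@area R]_(z in box c s) (F z - k) ^+ 2 <= \int[@area R]_(z in box d t) (F z - k) ^+ 2.
  move=> qF cd; have i1 := sqint_sub_box c s k qF; have i2 := sqint_sub_box d t k qF.
  rewrite /Rintegral; apply: fine_le.
  - exact: (integrable_fin_num _ i1).
  - exact: (integrable_fin_num _ i2).
  - apply: ge0_subset_integral => //.
      by case/integrableP : i2.
    by move=> z _; rewrite lee_fin sqr_ge0.
by move=> q1 q2 cd; apply: lerD; exact: P.
Qed.

Lemma Rintegral_sqr_sub_le (R : realType) (F H : R * R -> R) (c : R * R) (s h k : R) :
  0 < s -> sqint F -> (forall w, box c s w -> (H w - h) ^+ 2 <= k) ->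
  (@area R).-integrable (box c s) (EFin \o (fun w => (F w - H w) ^+ 2)) ->
  \int[@area R]_(w in box c s) (F w - h) ^+ 2 <=
  2 * \int[@area R]_(w in box c s) (F w - H w) ^+ 2 + 8 * s ^+ 2 * k.
Proof.
move=> s0 qF kP iF; have mb := measurable_box c s.
have j1 : (@area R).-integrable (box c s) (EFin \o (fun w => 2 * (F w - H w) ^+ 2)).
  by have := integrableZl mb 2 iF; exact: eq_integrable.
have j2 := integrable_cst_box c s (2 * k).
have -> : 8 * s ^+ 2 * k = 4 * s ^+ 2 * (2 * k) by ring.
rewrite -(Rintegral_cst_box c (2 * k) (ltW s0)) -RintegralZl // -RintegralD //.
apply: le_Rintegral => //.
- exact: sqint_sub_box.
- by have := integrableD mb j1 j2; exact: eq_integrable.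
move=> w wb; have := kP w wb; move: (H w) (F w) => x f.
by have := sqr_ge0 ((f - x) - (x - h)); lra.
Qed.

(** On the small square [F] is compared with the smooth function [eta s * F]. Their distance is
    bounded by the deviation of [G], letting [e] tend to [0] in [beurling_local]; the smooth
    function itself varies little there. *)
Lemma excess_decay (R : realType) : exists2 K : R, 0 < K &
  forall (O : set (R * R)) (p q F1 F2 G1 G2 : R * R -> R) (M c1 c2 t s : R) (z0 : R * R),
  wirtinger O p q F1 F2 G1 G2 -> sqint F1 -> sqint F2 ->
  (forall z, `|G1 z| <= M) -> (forall z, `|G2 z| <= M) ->
  0 < s -> box z0 (2 * s) `<=` O -> 0 < t -> 2 * t <= 1 ->
  forall a b, a = conv (eta s) F1 z0 -> b = conv (eta s) F2 z0 ->
  (t * s) ^- 2 * sqdev F1 F2 z0 (2 * (t * s)) a b <=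
    K * (t ^+ 2 * (s ^- 2 * sqdev F1 F2 z0 (2 * s) a b) +
         (t * s) ^- 2 * sqdev G1 G2 z0 (2 * s) c1 c2).
Proof.
have [C C0 HC] := conv_eta_oscillation R; exists (128 * C + 16) => [|O p q F1 F2 G1 G2 M c1 c2 t s z0].
  by lra.
move=> wH q1 q2 G1M G2M s0 zO t0 t1 a b aE bE.
have l1 := sqint_locint q1; have l2 := sqint_locint q2.
have ts0 : 0 < t * s by rewrite mulr_gt0.
have tss : 2 * (t * s) <= s by rewrite mulrA -[leRHS]mul1r ler_wpM2r // ltW.
have cs1 := conv_continuous (kernel_eta s) (supp_eta s0) l1.
have cs2 := conv_continuous (kernel_eta s) (supp_eta s0) l2.
pose rho := 2 * (t * s).
have rho0 : 0 < rho by rewrite mulr_gt0.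
have B := mollified_sqr_le q1 q2 cs1 cs2 s0 (fun e e0 er => beurling_local c1 c2 wH G1M G2M zO e0 er tss).
have i1 := integrable_sqr_sub_box z0 rho q1 cs1; have i2 := integrable_sqr_sub_box z0 rho q2 cs2.
rewrite -/(sqdev G1 G2 z0 (2 * s) c1 c2) RintegralD // in B.
have J1 := Rintegral_sqr_sub_le rho0 q1 (fun w wb => HC F1 a s rho z0 w s0 tss q1 wb) i1.
have J2 := Rintegral_sqr_sub_le rho0 q2 (fun w wb => HC F2 b s rho z0 w s0 tss q2 wb) i2.
rewrite -aE in J1; rewrite -bE in J2; clear aE bE.
clear HC; rewrite {1}/sqdev -/rho.
set X := \int[@area R]_(w in box z0 rho) (F1 w - a) ^+ 2 in J1 *.
set Y := \int[@area R]_(w in box z0 rho) (F2 w - b) ^+ 2 in J2 *.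
set E1 := \int[@area R]_(w in box z0 rho) _ in J1 B.
set E2 := \int[@area R]_(w in box z0 rho) _ in J2 B.
rewrite [sqdev F1 _ _ _ _ _]/sqdev.
set D1 := \int[@area R]_(w in box z0 (2 * s)) _ in J1 *.
set D2 := \int[@area R]_(w in box z0 (2 * s)) _ in J2 *.
set I := sqdev _ _ _ _ _ _ in B *.
have I0 : 0 <= I := sqdev_ge0 _ _ _ _ _ _.
have H : X + Y <= 16 * I + 8 * rho ^+ 2 * (C * rho ^+ 2 * s ^- 4 * (D1 + D2)) by lra.
have k0 : 0 < (t * s) ^- 2 by rewrite invr_gt0 exprn_gt0.
apply: le_trans (ler_wpM2l (ltW k0) H) _.
(* Here [16 = 2 * 8]. With [rho = 2 t s] the second factor is [8 C rho^4 s^-4 / (t s)^2 = 128 C t^2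
   s^-2]: the gain [t^2] survives the normalisation. *)
have -> : (t * s) ^- 2 * (16 * I + 8 * rho ^+ 2 * (C * rho ^+ 2 / s ^+ 4 * (D1 + D2))) =
  16 * ((t * s) ^- 2 * I) + 128 * C * (t ^+ 2 * (s ^- 2 * (D1 + D2))).
  by rewrite /rho; field; rewrite ?lt0r_neq0.
have D0 : 0 <= D1 + D2 := sqdev_ge0 F1 F2 z0 (2 * s) a b.
have y0 : 0 <= t ^+ 2 * (s ^- 2 * (D1 + D2)).
  by rewrite mulr_ge0 ?sqr_ge0 // mulr_ge0 // invr_ge0 sqr_ge0.
have x0 : 0 <= (t * s) ^- 2 * I by rewrite mulr_ge0 // ltW.
by have := mulr_ge0 C0 x0; lra.
Qed.

(** * Boundedness of the means *)

(** [a] stands for the size of the mean, [e] for the square root of the excess, and [w] for the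
    Hoelder error at each scale. *)
Lemma iteration_bound (R : realFieldType) (a e w : nat -> R) (K1 C1 S : R) :
  (forall k, 0 <= a k) -> (forall k, 0 <= e k) -> (forall k, 0 <= w k) -> 0 <= K1 -> 0 <= C1 ->
  (forall k, a k.+1 <= a k + e k / 4 + C1 /\ e k.+1 <= e k / 4 + C1) ->
  (forall k, K1 <= a k -> a k.+1 <= a k + e k / 4 + w k /\ e k.+1 <= e k / 4 + w k) ->
  (forall n, \sum_(k < n) w k <= S) ->
  forall k, a k <= a 0%N + 3 * e 0%N + K1 + 5 * C1 + 3 * S.
Proof.
move=> a0 e0 w0 K0 C0 H1 H2 HS.
have eB k : e k <= e 0%N + 2 * C1.
  by elim: k => [|k IH]; [lra|have [_ h] := H1 k; have := e0 0%N; lra].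
(* The potential [a + 2 e] absorbs the growth [e / 4] of [a]: it increases by at most [3 w] when
   [a >= K1], and otherwise is at most [K1 + e 0 + 5 C1] after the step. *)
have P k : a k + 2 * e k <= a 0%N + 2 * e 0%N + (K1 + e 0%N + 5 * C1) + 3 * \sum_(j < k) w j.
  elim: k => [|k IH]; first by rewrite big_ord0; have := e0 0%N; lra.
  rewrite big_ord_recr /= mulrDr.
  have sw : 0 <= \sum_(j < k) w j by apply: sumr_ge0.
  have hk := w0 k; have ek := eB k; have ek0 := e0 k; have e00 := e0 0%N; have a00 := a0 0%N.
  have [h|h] := leP K1 (a k).
    by have [h1 h2] := H2 k h; lra.
  by have [h1 h2] := H1 k; lra.
by move=> k; have := P k; have := HS k; have := e0 k; lra.
Qed.

Lemma sqdev_shift (R : realType) (F1 F2 : R * R -> R) (c : R * R) (s a b a' b' : R) :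
  0 < s -> sqint F1 -> sqint F2 ->
  sqdev F1 F2 c s a' b' <= 2 * sqdev F1 F2 c s a b +
    8 * s ^+ 2 * ((a - a') ^+ 2 + (b - b') ^+ 2).
Proof.
move=> s0 q1 q2; rewrite /sqdev.
have h1 := @Rintegral_sqr_sub_le R F1 (cst a) c s a' ((a - a') ^+ 2) s0 q1 (fun w _ => lexx _) (sqint_sub_box c s a q1).
have h2 := @Rintegral_sqr_sub_le R F2 (cst b) c s b' ((b - b') ^+ 2) s0 q2 (fun w _ => lexx _) (sqint_sub_box c s b q2).
rewrite /= in h1 h2; move: h1 h2.
set X := Rintegral _ _ _; set Y := Rintegral _ _ _; set X' := Rintegral _ _ _; set Y' := Rintegral _ _ _.
lra.
Qed.

(* One scale of the Campanato iteration. *)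
Lemma excess_step (R : realType) : exists2 K : R, 0 < K &
  forall (O : set (R * R)) (p q F1 F2 G1 G2 : R * R -> R) (M c1 c2 t s : R) (z0 : R * R),
  wirtinger O p q F1 F2 G1 G2 -> sqint F1 -> sqint F2 ->
  (forall z, `|G1 z| <= M) -> (forall z, `|G2 z| <= M) ->
  0 < s -> box z0 (2 * s) `<=` O -> 0 < t -> 2 * t <= 1 ->
  forall a b a' b', a = conv (eta s) F1 z0 -> b = conv (eta s) F2 z0 ->
    a' = conv (eta (t * s)) F1 z0 -> b' = conv (eta (t * s)) F2 z0 ->
  let X := K * (t ^+ 2 * (s ^- 2 * sqdev F1 F2 z0 (2 * s) a b) +
         t ^- 2 * (s ^- 2 * sqdev G1 G2 z0 (2 * s) c1 c2)) in
  [/\ (a' - a) ^+ 2 <= X, (b' - b) ^+ 2 <= X &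
      (t * s) ^- 2 * sqdev F1 F2 z0 (2 * (t * s)) a' b' <= X].
Proof.
have AUX (C x y u v : R) : 0 <= C * u -> 0 <= x -> 0 <= y -> 0 <= u -> x + y <= C * u ->
    (2 + 65 * C) * u <= v -> [/\ x <= v, y <= v & 2 * u + 32 * (x + y) <= v].
  by move=> *; split; lra.
have [K K0 HK] := excess_decay R; have [C C0 HC] := conv_eta_excess R.
have C2 : 0 < 2 + 65 * C by lra.
exists ((2 + 65 * C) * K) => [|O p q F1 F2 G1 G2 M c1 c2 t s z0]; first exact: mulr_gt0.
move=> wH q1 q2 G1M G2M s0 zO t0 t1 a b a' b' aE bE a'E b'E X.
have ts0 : 0 < t * s by rewrite mulr_gt0.
have ts2 : 0 < 2 * (t * s) by rewrite mulr_gt0.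
have bs : box z0 (t * s) `<=` box z0 (2 * (t * s)).
  by apply: box_sub; rewrite subrr normr0 mulrDl mul1r addrK ltW.
have D := HK _ _ _ _ _ _ _ _ c1 c2 _ _ _ wH q1 q2 G1M G2M s0 zO t0 t1 a b aE bE.
have A1 := HC F1 a _ z0 ts0 q1; have B1 := HC F2 b _ z0 ts0 q2.
rewrite -a'E in A1; rewrite -b'E in B1.
pose Y := (t * s) ^- 2 * sqdev F1 F2 z0 (2 * (t * s)) a b.
have tsi : 0 < (t * s) ^- 2 by rewrite invr_gt0 exprn_gt0.
have AB : C * (t * s) ^- 2 * sqdev F1 F2 z0 (t * s) a b <= C * Y.
  rewrite /Y -mulrA; apply: ler_wpM2l => //; apply: ler_wpM2l; first exact: ltW.
  exact: sqdev_le.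
have J1 : 0 <= \int[@area R]_(z in box z0 (t * s)) (F1 z - a) ^+ 2.
  by apply: Rintegral_ge0 => z _; exact: sqr_ge0.
have J2 : 0 <= \int[@area R]_(z in box z0 (t * s)) (F2 z - b) ^+ 2.
  by apply: Rintegral_ge0 => z _; exact: sqr_ge0.
have Ct : 0 <= C * (t * s) ^- 2 by rewrite mulr_ge0 // ltW.
have sum : (a' - a) ^+ 2 + (b' - b) ^+ 2 <= C * Y.
  by apply: le_trans AB; rewrite mulrDr; exact: lerD.
have Y0 : 0 <= Y by rewrite mulr_ge0 ?sqdev_ge0 // ltW.
have YX : (2 + 65 * C) * Y <= X.
  rewrite /X -mulrA; apply: ler_wpM2l; first exact: ltW.
  apply: le_trans D _; rewrite -(_ : (t * s) ^- 2 * sqdev G1 G2 z0 (2 * s) c1 c2 = t ^- 2 * (s ^- 2 * sqdev G1 G2 z0 (2 * s) c1 c2)) //.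
  by rewrite exprMn invfM mulrA.
have CY : 0 <= C * Y by exact: mulr_ge0.
have := sqr_ge0 (a' - a); have := sqr_ge0 (b' - b) => sb sa.
have [X1 X2 X3] := AUX _ _ _ _ _ CY sa sb Y0 sum YX; split=> //.
have h := sqdev_shift z0 a b a' b' ts2 q1 q2.
apply: le_trans (ler_wpM2l (ltW tsi) h) _.
rewrite mulrDr [X in X + _ <= _]mulrCA -/Y.
have -> : (t * s) ^- 2 * (8 * (2 * (t * s)) ^+ 2 * ((a - a') ^+ 2 + (b - b') ^+ 2)) =
  32 * ((a' - a) ^+ 2 + (b' - b) ^+ 2) by field; rewrite !lt0r_neq0.
exact: X3.
Qed.

Lemma sqdev_pointwise (R : realType) (F1 F2 G1 G2 : R * R -> R) (c : R * R)
    (s a b c1 c2 m k : R) :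
  0 < s -> sqint F1 -> sqint F2 -> sqint G1 -> sqint G2 ->
  (forall w, box c s w -> (G1 w - c1) ^+ 2 + (G2 w - c2) ^+ 2 <=
     m + k * ((F1 w - a) ^+ 2 + (F2 w - b) ^+ 2)) ->
  sqdev G1 G2 c s c1 c2 <= 4 * s ^+ 2 * m + k * sqdev F1 F2 c s a b.
Proof.
move=> s0 qF1 qF2 qG1 qG2 H; have mb := measurable_box c s; rewrite /sqdev.
have f1 := sqint_sub_box c s a qF1; have f2 := sqint_sub_box c s b qF2.
have g1 := sqint_sub_box c s c1 qG1; have g2 := sqint_sub_box c s c2 qG2.
have f12 : (@area R).-integrable (box c s) (EFin \o (fun w => (F1 w - a) ^+ 2 + (F2 w - b) ^+ 2)).
  by have := integrableD mb f1 f2; exact: eq_integrable.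
have kf : (@area R).-integrable (box c s) (EFin \o (fun w => k * ((F1 w - a) ^+ 2 + (F2 w - b) ^+ 2))).
  by have := integrableZl mb k f12; exact: eq_integrable.
have im := integrable_cst_box c s m.
rewrite -(Rintegral_cst_box c m (ltW s0)) -!RintegralD // -RintegralZl // -RintegralD //.
apply: le_Rintegral => //.
- by have := integrableD mb g1 g2; exact: eq_integrable.
- by have := integrableD mb im kf; exact: eq_integrable.
Qed.

(** All that the iteration knows of the equation. [c1 + i c2] stands for the nonlinearity frozen at
    [z0] and [a + i b], and [v s] for the modulus of continuity [s^alpha]; the factor of the
    oscillation of [F] decays like the inverse square of the mean. *)
Definition nonlinear_control (R : realType) (O : set (R * R)) (F1 F2 G1 G2 : R * R -> R)
    (K0 N : R) (v : R -> R) : Prop :=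
  forall z0 s a b, 0 < s -> box z0 (2 * s) `<=` O -> K0 <= `|a| + `|b| ->
  exists c1 c2, forall w, box z0 (2 * s) w ->
    (G1 w - c1) ^+ 2 + (G2 w - c2) ^+ 2 <=
      N * v s ^+ 2 + K0 ^+ 2 / (a ^+ 2 + b ^+ 2) * ((F1 w - a) ^+ 2 + (F2 w - b) ^+ 2).

Lemma le_of_sqr (R : realFieldType) (x y : R) : 0 <= y -> x ^+ 2 <= y ^+ 2 -> `|x| <= y.
Proof.
by move=> y0 xy; rewrite -ler_sqr ?nnegrE // real_normK ?num_real.
Qed.

Lemma sqrt_le_of_sqr (R : realType) (x y : R) : 0 <= y -> x <= y ^+ 2 -> Num.sqrt x <= y.
Proof. by move=> y0 xy; rewrite -[leRHS]ger0_norm // -sqrtr_sqr ler_wsqrtr. Qed.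

Lemma step_norms (R : realType) (a b a' b' e' X y : R) : 0 <= y ->
  (a' - a) ^+ 2 <= X -> (b' - b) ^+ 2 <= X -> e' <= X -> X <= y ^+ 2 ->
  `|a'| + `|b'| <= `|a| + `|b| + 2 * y /\ Num.sqrt e' <= y.
Proof.
move=> y0 ha hb he hX.
have h1 := le_of_sqr y0 (le_trans ha hX); have h2 := le_of_sqr y0 (le_trans hb hX).
split; last by apply: sqrt_le_of_sqr => //; exact: le_trans hX.
have h3 : `|a'| <= `|a| + `|a' - a| by rewrite -{1}[a'](subrKC a); exact: ler_normD.
have h4 : `|b'| <= `|b| + `|b' - b| by rewrite -{1}[b'](subrKC b); exact: ler_normD.
by lra.
Qed.

Lemma le_one_add_sqr (R : realFieldType) (x y : R) : x ^+ 2 <= y -> x <= 1 + y.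
Proof. by have := sqr_ge0 (x - 1); rewrite sqrrB; have := sqr_ge0 x; lra. Qed.

(** The target [(e / 8)^2] leaves room for [e^2 / 64], while the terms in [e^2] contribute at most
    [1/256] each: one by the smallness of [t], the other by the size of the mean. *)
Lemma iteration_constants (R : realFieldType) (L t M K0 N : R) : 0 < L -> 0 < t ->
  0 < K0 -> 0 <= N -> L * t ^+ 2 <= 256^-1 ->
  exists C1 K1 Q, [/\ 0 <= C1, K0 <= K1, 0 <= Q,
   (forall e, 0 <= e -> L * (t ^+ 2 * e ^+ 2 + t ^- 2 * (32 * M ^+ 2)) <= (e / 8 + C1) ^+ 2) &
   (forall a b e v, 0 <= e -> 0 <= v -> K1 <= `|a| + `|b| ->
      L * (t ^+ 2 * e ^+ 2 + t ^- 2 * (16 * (N * v ^+ 2) + K0 ^+ 2 / (a ^+ 2 + b ^+ 2) * e ^+ 2)) <=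
      (e / 8 + Q * v) ^+ 2)].
Proof.
move=> L0 t0 K00 N0 Lt.
pose u := L * t ^- 2.
have u0 : 0 < u by rewrite mulr_gt0 // invr_gt0 exprn_gt0.
have uM : 0 <= u * M ^+ 2 by rewrite mulr_ge0 ?sqr_ge0 // ltW.
have uN : 0 <= u * N by rewrite mulr_ge0 // ltW.
(* The summands [1] in the first and third witness bound [x] by [(1 + x)^2] without square roots;
   the second makes [u * k <= 1/256] for every mean above it. *)
exists (1 + 32 * (u * M ^+ 2)), (K0 * (1 + 512 * u)), (1 + 16 * (u * N)); split; [lra| |lra| |].
- by rewrite -[leLHS]mulr1 ler_wpM2l ?(ltW K00) //; lra.
- move=> e e0.
  have -> : L * (t ^+ 2 * e ^+ 2 + t ^- 2 * (32 * M ^+ 2)) = L * t ^+ 2 * e ^+ 2 + 32 * (u * M ^+ 2).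
    by rewrite /u; ring.
  have h1 : L * t ^+ 2 * e ^+ 2 <= 256^-1 * e ^+ 2 by rewrite ler_wpM2r ?sqr_ge0.
  have h2 := mulr_ge0 e0 uM; have h3 := mulr_ge0 uM uM; have h4 := sqr_ge0 e.
  have -> : (e / 8 + (1 + 32 * (u * M ^+ 2))) ^+ 2 = e ^+ 2 / 64 + e / 4 + 8 * (e * (u * M ^+ 2)) + 1 + 64 * (u * M ^+ 2) + 1024 * ((u * M ^+ 2) * (u * M ^+ 2)).
    by field.
  by lra.
move=> a b e v e0 v0 ab.
set k := K0 ^+ 2 / (a ^+ 2 + b ^+ 2).
have k1 : 256 * (u * k) <= 1.
  have u1 : 0 < 1 + 512 * u by lra.
  have ab0 : 0 < K0 * (1 + 512 * u) := mulr_gt0 K00 u1.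
  have h1 : (K0 * (1 + 512 * u)) ^+ 2 <= (`|a| + `|b|) ^+ 2.
    by rewrite ler_sqr; [exact: ab|rewrite nnegrE; exact: ltW|rewrite nnegrE; exact: addr_ge0].
  have h2 : (`|a| + `|b|) ^+ 2 <= 2 * (a ^+ 2 + b ^+ 2).
    have := sqr_ge0 (`|a| - `|b|); rewrite sqrrB sqrrD !real_normK ?num_real //; lra.
  have K02 : 0 < K0 ^+ 2 by rewrite exprn_gt0.
  have h3 : 512 * (u * K0 ^+ 2) <= (K0 * (1 + 512 * u)) ^+ 2.
    have -> : (K0 * (1 + 512 * u)) ^+ 2 = K0 ^+ 2 + 1024 * (u * K0 ^+ 2) + (512 * u * K0) ^+ 2 by ring.
    by have := mulr_gt0 u0 K02; have := sqr_ge0 (512 * u * K0); lra.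
  have d0 : 0 < a ^+ 2 + b ^+ 2.
    have : 0 < (K0 * (1 + 512 * u)) ^+ 2 by rewrite exprn_gt0.
    lra.
  have -> : 256 * (u * k) = 256 * (u * K0 ^+ 2) / (a ^+ 2 + b ^+ 2) by rewrite /k; ring.
  by rewrite ler_pdivrMr // mul1r; lra.
have -> : L * (t ^+ 2 * e ^+ 2 + t ^- 2 * (16 * (N * v ^+ 2) + k * e ^+ 2)) =
   L * t ^+ 2 * e ^+ 2 + (u * k) * e ^+ 2 + 16 * (u * N * v ^+ 2) by rewrite /u; ring.
have h1 : L * t ^+ 2 * e ^+ 2 <= 256^-1 * e ^+ 2 by rewrite ler_wpM2r ?sqr_ge0.
have h2 : u * k * e ^+ 2 <= 256^-1 * e ^+ 2 by rewrite ler_wpM2r ?sqr_ge0 //; lra.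
have v2 := sqr_ge0 v; have uv := mulr_ge0 uN v2; have ev := mulr_ge0 e0 v0.
have euv := mulr_ge0 uN ev; have e2 := sqr_ge0 e; have uuv := mulr_ge0 (mulr_ge0 uN uN) v2.
have -> : (e / 8 + (1 + 16 * (u * N)) * v) ^+ 2 = e ^+ 2 / 64 + (e * v) / 4 + 4 * (u * N * (e * v)) +
   v ^+ 2 + 32 * (u * N * v ^+ 2) + 256 * (u * N * (u * N) * v ^+ 2) by field.
by lra.
Qed.

(** The ratio [t] depends on the kernels only, so the same scales serve all points and data. [T] is
    uniform in [z0], because mean and excess at the initial scale [s0] are controlled by the global
    [L2] norms. *)
Lemma means_bounded (R : realType) : exists t : R, [/\ 0 < t, 2 * t <= 1 &
  forall (O : set (R * R)) (p q F1 F2 G1 G2 : R * R -> R) (M K0 N s0 S : R) (v : R -> R),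
  wirtinger O p q F1 F2 G1 G2 -> sqint F1 -> sqint F2 -> sqint G1 -> sqint G2 ->
  (forall z, `|G1 z| <= M) -> (forall z, `|G2 z| <= M) ->
  0 < K0 -> 0 <= N -> 0 < s0 -> (forall s, 0 <= v s) ->
  nonlinear_control O F1 F2 G1 G2 K0 N v ->
  (forall n, \sum_(k < n) v (t ^+ k * s0) <= S) ->
  exists T, forall z0 k, box z0 (2 * s0) `<=` O ->
    `|conv (eta (t ^+ k * s0)) F1 z0| <= T /\ `|conv (eta (t ^+ k * s0)) F2 z0| <= T].
Proof.
have [L L0 HL] := excess_step R; have [C C0 HC] := conv_eta_excess R.
(* Then [L t^2 = L / (256 (L + 1)^2) <= 1/256], the smallness asked for by [iteration_constants]. *)
pose t : R := (16 * (L + 1))^-1.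
have L1 : 0 < 16 * (L + 1) by lra.
have t0 : 0 < t by rewrite invr_gt0.
have t2 : 2 * t <= 1 by rewrite ler_pdivrMr //; lra.
have Lt : L * t ^+ 2 <= 256^-1.
  rewrite /t exprVn ler_pdivrMr ?exprn_gt0 // mulrC ler_pdivlMr //.
  have -> : (16 * (L + 1)) ^+ 2 = 256 * (L ^+ 2 + 2 * L + 1) by ring.
  by have := sqr_ge0 L; lra.
exists t; split=> // O p q F1 F2 G1 G2 M K0 N s0 S v wH qF1 qF2 qG1 qG2 G1M G2M K00 N0 s00 v0 nl vS.
have [C1 [K1 [Q [C10 K01 Q0 step1 step2]]]] := iteration_constants M L0 t0 K00 N0 Lt.
pose Phi := \int[@area R]_z (F1 z) ^+ 2 + \int[@area R]_z (F2 z) ^+ 2.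
(* The bound of [iteration_bound], with the initial mean and excess estimated through [Phi], and
   with [C1] and [Q] doubled because [step_norms] adds [2 * y] to the mean. *)
exists ((2 + 2 * (C * s0 ^- 2 * Phi)) + 3 * (1 + (2 * (s0 ^- 2 * Phi) + 64 * (C * s0 ^- 2 * Phi))) + K1 + 5 * (2 * C1) + 3 * (2 * Q * S)).
move=> z0 k zO.
pose s j := t ^+ j * s0; pose A j := conv (eta (s j)) F1 z0; pose B j := conv (eta (s j)) F2 z0.
have s_gt0 j : 0 < s j by rewrite mulr_gt0 // exprn_gt0.
have sS j : s j.+1 = t * s j by rewrite /s exprS mulrA.
have sO j : box z0 (2 * s j) `<=` O.
  apply: subset_trans zO; apply: box_sub; rewrite subrr normr0 subr_ge0 ler_pM2l // /s.
    by rewrite ger_pMl // exprn_ile1 ?ltW //; lra.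
  by rewrite ger_pMl // exprn_ile1 ?ltW //; lra.
pose E j := s j ^- 2 * sqdev F1 F2 z0 (2 * s j) (A j) (B j).
have E0 j : 0 <= E j by rewrite mulr_ge0 ?sqdev_ge0 // invr_ge0 sqr_ge0.
pose e j := Num.sqrt (E j); pose a j := `|A j| + `|B j|.
have eE j : e j ^+ 2 = E j by rewrite sqr_sqrtr.
have e0 j : 0 <= e j by exact: sqrtr_ge0.
have a0 j : 0 <= a j by exact: addr_ge0.
have step j c1 c2 := HL _ _ _ _ _ _ _ _ c1 c2 _ _ _ wH qF1 qF2 G1M G2M (s_gt0 j) (sO j) t0 t2
  (A j) (B j) (A j.+1) (B j.+1) erefl erefl (f_equal (fun r => conv (eta r) F1 z0) (sS j))
  (f_equal (fun r => conv (eta r) F2 z0) (sS j)).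
have s2 j : 0 < 2 * s j by rewrite mulr_gt0.
have si j : 0 <= s j ^- 2 by rewrite invr_ge0 sqr_ge0.
have J2 j c1 c2 y : 0 <= y -> L * (t ^+ 2 * E j + t ^- 2 * (s j ^- 2 * sqdev G1 G2 z0 (2 * s j) c1 c2)) <= y ^+ 2 ->
  a j.+1 <= a j + 2 * y /\ e j.+1 <= y.
  move=> y0 Xy; have /= [h1 h2 h3] := step j c1 c2.
  rewrite -sS in h3; exact: (step_norms y0 h1 h2 h3 Xy).
have mono j x y : x <= y -> L * (t ^+ 2 * E j + t ^- 2 * x) <= L * (t ^+ 2 * E j + t ^- 2 * y).
  move=> xy; rewrite ler_wpM2l ?(ltW L0) // lerD2l ler_wpM2l //.
  by rewrite invr_ge0 sqr_ge0.
(* At every scale: only the bound on [G] enters, with [0] for [c1] and [c2]. *)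
have H1 j : a j.+1 <= a j + e j / 4 + 2 * C1 /\ e j.+1 <= e j / 4 + 2 * C1.
  have y0 : 0 <= e j / 8 + C1 by rewrite addr_ge0 // divr_ge0.
  have hG : s j ^- 2 * sqdev G1 G2 z0 (2 * s j) 0 0 <= 32 * M ^+ 2.
    rewrite mulrC ler_pdivrMr ?exprn_gt0 //.
    have G2M2 x : `|x| <= M -> (x - 0) ^+ 2 <= M ^+ 2.
      by rewrite subr0 => xM; rewrite -[leLHS]real_normK ?num_real // lerXn2r // nnegrE // (le_trans _ xM).
    have pw w : box z0 (2 * s j) w -> (G1 w - 0) ^+ 2 + (G2 w - 0) ^+ 2 <=
        2 * M ^+ 2 + 0 * ((F1 w - 0) ^+ 2 + (F2 w - 0) ^+ 2).
      by move=> _; rewrite mul0r addr0 mulr_natl mulr2n; apply: lerD; exact: G2M2.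
    apply: le_trans (sqdev_pointwise (s2 j) qF1 qF2 qG1 qG2 pw) _.
    rewrite mul0r addr0 le_eqVlt; apply/orP; left; apply/eqP; ring.
  have Xy : L * (t ^+ 2 * E j + t ^- 2 * (s j ^- 2 * sqdev G1 G2 z0 (2 * s j) 0 0)) <= (e j / 8 + C1) ^+ 2.
    by apply: le_trans (mono j _ _ hG) _; rewrite -eE; exact: step1.
  have [h1 h2] := J2 j 0 0 _ y0 Xy.
  split; first by apply: le_trans h1 _; clear -C10; lra.
  by apply: le_trans h2 _; have := e0 j; clear -C10; lra.
(* For large means: [nonlinear_control] is applied at the current means [A j], [B j]. *)
have H2 j : K1 <= a j -> a j.+1 <= a j + e j / 4 + 2 * Q * v (s j) /\ e j.+1 <= e j / 4 + 2 * Q * v (s j).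
  move=> Kj; have vj := v0 (s j).
  have y0 : 0 <= e j / 8 + Q * v (s j) by rewrite addr_ge0 // ?divr_ge0 // mulr_ge0.
  have [c1 [c2 pw]] := nl z0 (s j) (A j) (B j) (s_gt0 j) (sO j) (le_trans K01 Kj).
  have hG : s j ^- 2 * sqdev G1 G2 z0 (2 * s j) c1 c2 <=
      16 * (N * v (s j) ^+ 2) + K0 ^+ 2 / (A j ^+ 2 + B j ^+ 2) * E j.
    apply: le_trans (ler_wpM2l (si j) (sqdev_pointwise (s2 j) qF1 qF2 qG1 qG2 pw)) _.
    rewrite mulrDr lerD //; last by rewrite /E mulrCA.
    rewrite le_eqVlt; apply/orP; left; apply/eqP; field; exact: lt0r_neq0.
  have Xy : L * (t ^+ 2 * E j + t ^- 2 * (s j ^- 2 * sqdev G1 G2 z0 (2 * s j) c1 c2)) <=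
      (e j / 8 + Q * v (s j)) ^+ 2.
    by apply: le_trans (mono j _ _ hG) _; rewrite -eE; exact: step2.
  have [h1 h2] := J2 j c1 c2 _ y0 Xy.
  have Qv : 0 <= Q * v (s j) by exact: mulr_ge0.
  split; first by apply: le_trans h1 _; move: (v _) Qv => x; clear; lra.
  by apply: le_trans h2 _; have := e0 j; move: (v _) Qv => x; clear; lra.
have HS n : \sum_(j < n) (2 * Q * v (s j)) <= 2 * Q * S.
  by rewrite -mulr_sumr ler_wpM2l // mulr_ge0.
have K10 : 0 <= K1 by apply: le_trans K01; exact: ltW.
have w0 j : 0 <= 2 * Q * v (s j) by rewrite !mulr_ge0.
have C20 : 0 <= 2 * C1 by rewrite mulr_ge0.
have bnd := iteration_bound a0 e0 w0 K10 C20 H1 H2 HS k.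
have s00E : s 0%N = s0 by rewrite /s expr0 mul1r.
have Pb F r : sqint F -> \int[@area R]_(w in box z0 r) (F w - 0) ^+ 2 <= \int[@area R]_w F w ^+ 2.
  move=> [_ iF]; under eq_Rintegral do rewrite subr0.
  by apply: Rintegral_box_le => // w; exact: sqr_ge0.
have si0 : 0 <= s0 ^- 2 by rewrite invr_ge0 sqr_ge0.
have AB : A 0%N ^+ 2 + B 0%N ^+ 2 <= C * s0 ^- 2 * Phi.
  have := HC F1 0 _ z0 s00 qF1; have := HC F2 0 _ z0 s00 qF2; rewrite !subr0.
  rewrite /A /B s00E /Phi mulrDr => h2 h1; apply: lerD.
    by apply: le_trans h1 _; rewrite ler_wpM2l ?mulr_ge0 // Pb.
  by apply: le_trans h2 _; rewrite ler_wpM2l ?mulr_ge0 // Pb.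
have E00 : E 0%N <= 2 * (s0 ^- 2 * Phi) + 64 * (C * s0 ^- 2 * Phi).
  rewrite /E s00E.
  have ss : 0 < 2 * s0 by rewrite mulr_gt0.
  have h := sqdev_shift z0 0 0 (A 0%N) (B 0%N) ss qF1 qF2; rewrite !sub0r !sqrrN in h.
  apply: le_trans (ler_wpM2l si0 h) _; rewrite mulrDr lerD //.
    rewrite mulrCA ler_wpM2l // ler_wpM2l // /sqdev /Phi; apply: lerD; exact: Pb.
  have -> : s0 ^- 2 * (8 * (2 * s0) ^+ 2 * (A 0%N ^+ 2 + B 0%N ^+ 2)) = 32 * (A 0%N ^+ 2 + B 0%N ^+ 2).
    by field; exact: lt0r_neq0.
  have CP : 0 <= C * s0 ^- 2 * Phi by apply: le_trans AB; rewrite addr_ge0 ?sqr_ge0.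
  by move: AB CP; clear; lra.
have eb : e 0%N <= 1 + (2 * (s0 ^- 2 * Phi) + 64 * (C * s0 ^- 2 * Phi)).
  by apply: le_one_add_sqr; rewrite eE.
have ab : a 0%N <= 2 + 2 * (C * s0 ^- 2 * Phi).
  have hA : `|A 0%N| <= 1 + C * s0 ^- 2 * Phi.
    apply: le_one_add_sqr; rewrite real_normK ?num_real //; apply: le_trans AB.
    by rewrite lerDl sqr_ge0.
  have hB : `|B 0%N| <= 1 + C * s0 ^- 2 * Phi.
    apply: le_one_add_sqr; rewrite real_normK ?num_real //; apply: le_trans AB.
    by rewrite lerDr sqr_ge0.
  by rewrite /a; move: hA hB; clear; lra.
have aT : a k <= (2 + 2 * (C * s0 ^- 2 * Phi)) + 3 * (1 + (2 * (s0 ^- 2 * Phi) + 64 * (C * s0 ^- 2 * Phi))) + K1 + 5 * (2 * C1) + 3 * (2 * Q * S).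
  apply: le_trans bnd _; rewrite !lerD2r; apply: lerD ab _.
  by rewrite ler_wpM2l.
by split; apply: le_trans aT; rewrite /a ?lerDl ?lerDr.
Qed.

(** * The Lipschitz representative *)

(** With [D (1 - t) = C], the sequences [u n - D t^n] and [u n + D t^n] are monotone from rank [m]
    on and enclose the limit, the supremum of the first. *)
Lemma geometric_cvg (R : realType) (u : nat -> R) (C t : R) (m : nat) :
  0 < t -> t < 1 -> (forall n, (m <= n)%N -> `|u n.+1 - u n| <= C * t ^+ n) ->
  u @ \oo --> limn u /\ forall n, (m <= n)%N -> `|u n - limn u| <= C / (1 - t) * t ^+ n.
Proof.
move=> t0 t1 uC; have t1' : 0 < 1 - t by lra.
pose D := C / (1 - t).
have C0 : 0 <= C.
  have := le_trans (normr_ge0 _) (uC m (leqnn m)); by rewrite pmulr_lge0 // exprn_gt0.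
have D0 : 0 <= D by rewrite divr_ge0 // ltW.
have DC : D * (1 - t) = C by rewrite /D divfK // lt0r_neq0.
pose y n := u (n + m)%N - D * t ^+ (n + m); pose w n := u (n + m)%N + D * t ^+ (n + m).
have yS n : y n <= y n.+1.
  have := uC (n + m)%N (leq_addl _ _); rewrite /y addSn exprS -DC => /ler_normlP[h1 h2].
  by move: h1; set x := t ^+ _; lra.
have wS n : w n.+1 <= w n.
  have := uC (n + m)%N (leq_addl _ _); rewrite /w addSn exprS -DC => /ler_normlP[h1 h2].
  by move: h2; set x := t ^+ _; lra.
have yw n : y n <= w n.
  by have := mulr_ge0 D0 (exprn_ge0 (n + m) (ltW t0)); rewrite /y /w; lra.
have yM i j : (i <= j)%N -> y i <= y j.
  move=> /subnK <-; elim: (j - i)%N => // d IH; rewrite addSn; exact: le_trans IH (yS _).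
have wM i j : (i <= j)%N -> w j <= w i.
  move=> /subnK <-; elim: (j - i)%N => // d IH; rewrite addSn; exact: le_trans (wS _) IH.
have ywij i j : y i <= w j.
  have [ij|ji] := leqP i j; first exact: le_trans (yM _ _ ij) (yw j).
  exact: le_trans (yw i) (wM _ _ (ltnW ji)).
pose l := sup (range y).
have ubw j : ubound (range y) (w j) by move=> _ [i _ <-].
have ly n : y n <= l by apply: ub_le_sup; [exists (w 0%N); exact: ubw|exists n].
have lw n : l <= w n by apply: ge_sup; [exists (y 0%N), 0%N|exact: ubw].
have ul n : (m <= n)%N -> `|u n - l| <= D * t ^+ n.
  move=> /subnK nm; have := ly (n - m)%N; have := lw (n - m)%N; rewrite /y /w nm => h1 h2.
  by apply/ler_normlP; split; lra.
have cu : u @ \oo --> l.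
  apply/cvgrPdist_le => e e0.
  have ct : D * t ^+ n @[n --> \oo] --> (0 : R).
    rewrite -(mulr0 D); apply: cvgM; first exact: cvg_cst.
    by apply: cvg_expr; rewrite ger0_norm // ltW.
  have [N _ NP] := (cvgrPdist_le _ _).1 ct e e0.
  exists (maxn m N) => // n /=; rewrite geq_max => /andP[mn Nn].
  have := NP n Nn; rewrite /= sub0r normrN ger0_norm; last by rewrite mulr_ge0 // exprn_ge0 // ltW.
  by move=> h; rewrite distrC; exact: le_trans (ul n mn) h.
by rewrite (cvg_lim _ cu).
Qed.

Lemma conv_le (R : realType) (ka f : R * R -> R) (r C M : R) z : 0 <= r ->
  continuous ka -> supp 0 r ka -> (forall w, `|ka w| <= C) -> locint f ->
  (forall w, `|f w| <= M) -> `|conv ka f z| <= C * (4 * r ^+ 2 * M).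
Proof.
move=> r0 ck sk kC lf fM; have C0 : 0 <= C := le_trans (normr_ge0 _) (kC 0).
have mz := continuous_measurable2 (continuous_refl (a := z) ck).
apply: le_trans (Rintegral_box_bound mz (fun w => kC (z - w)) (supp_refl sk) lf) _.
apply: ler_wpM2l => //; rewrite -(Rintegral_cst_box z M r0).
apply: le_Rintegral => //; last exact: integrable_cst_box.
by have [_ /(_ z r)] := locint_norm lf.
Qed.

Lemma conv_eta_le (R : realType) (f : R * R -> R) (r M : R) z : 0 < r ->
  locint f -> (forall w, `|f w| <= M) -> `|conv (eta r) f z| <= M.
Proof.
move=> r0 lf fM; have ke := kernel_continuous (kernel_eta r); have se := supp_eta r0.
have i1 := integrable_conv z ke se lf; have i0 := integrable_reflect z (integrable_eta r0).
have i3 : int2 (fun w => M * eta r (z - w)).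
  by have := integrableZl measurableT M i0; exact: eq_integrable.
apply: le_trans (le_normr_Rintegral measurableT i1) _.
apply: (@le_trans _ _ (\int[@area R]_w (M * eta r (z - w)))); last first.
  by rewrite RintegralZl // integral_eta_reflect // mulr1.
apply: le_Rintegral => //; first exact: (integrable_norm i1).
by move=> w _; rewrite normrM [`|eta _ _|]ger0_norm ?eta_ge0 // mulrC ler_wpM2r ?eta_ge0.
Qed.

(** The mollifications converge to [g] uniformly on the square and to [f] in [L1], so the two agree
    almost everywhere there. Elsewhere [limn] may be a default value, hence measurability of [g] is
    claimed on the square only. *)
Lemma mollified_rep (R : realType) (f : R * R -> R) (c : R * R) (s C L t : R) (m : nat) :
  0 < t -> t < 1 -> 0 <= s -> locint f ->
  (forall n z, (m <= n)%N -> box c s z ->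
     `|conv (eta (t ^+ n.+1)) f z - conv (eta (t ^+ n)) f z| <= C * t ^+ n) ->
  (forall n z w, (m <= n)%N -> box c s z -> box c s w ->
     `|conv (eta (t ^+ n)) f z - conv (eta (t ^+ n)) f w| <= L * (`|z.1 - w.1| + `|z.2 - w.2|)) ->
  let g z := limn (fun n => conv (eta (t ^+ n)) f z) in
  (forall z w, box c s z -> box c s w -> `|g z - g w| <= L * (`|z.1 - w.1| + `|z.2 - w.2|)) /\
  {ae @area R, forall z, box c s z -> g z = f z}.
Proof.
move=> t0 t1 s0 lf fC fL g.
pose u n z := conv (eta (t ^+ n)) f z.
have tn n : 0 < t ^+ n by rewrite exprn_gt0.
have G z : box c s z -> (u ^~ z) @ \oo --> g z /\
    forall n, (m <= n)%N -> `|u n z - g z| <= C / (1 - t) * t ^+ n.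
  by move=> zb; apply: (geometric_cvg t0 t1) => n mn; exact: fC.
split.
  move=> z w zb wb; have [cz _] := G z zb; have [cw _] := G w wb.
  have cn : `|u n z - u n w| @[n --> \oo] --> `|g z - g w|.
    by apply: cvg_norm; exact: cvgB cz cw.
  rewrite -(cvg_lim _ cn) //; apply: limr_le; first by apply/cvg_ex; eexists; exact: cn.
  by exists m => // n /= mn; exact: fL.
have cu n : continuous (u n) := conv_continuous (kernel_eta (t ^+ n)) (supp_eta (tn n)) lf.
have mg : measurable_fun (box c s : set (measurableTypeR R * measurableTypeR R)) g.
  apply: (@measurable_fun_cvg _ _ _ _ u) => [n|z zb]; last by have [] := G z zb.
  by apply: measurable_funTS; exact: continuous_measurable2.
have [mf _] := lf.
pose k z := g z - f z.
have mk : mes2 (k \_ (box c s)).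
  apply/(measurable_restrictT _ (measurable_box c s)).
  by apply: measurable_funB => //; exact: measurable_funTS.
suff : {ae @area R, forall z, box c s z -> (k \_ (box c s)) z = 0}.
  move=> h; apply: (ae_imp h) => z + zb => /(_ zb); rewrite patchE mem_set // /k.
  by move/eqP; rewrite subr_eq0 => /eqP.
apply: L1box_ae0 => // e e0.
pose D := C / (1 - t).
have ct : D * t ^+ n * (4 * s ^+ 2) @[n --> \oo] --> (0 : R).
  rewrite -(mul0r (4 * s ^+ 2)); apply: cvgM; last exact: cvg_cst.
  rewrite -(mulr0 D); apply: cvgM; first exact: cvg_cst.
  by apply: cvg_expr; rewrite ger0_norm // ltW.
have ct' : t ^+ n @[n --> \oo] --> (0 : R).
  by apply: cvg_expr; rewrite ger0_norm // ltW.
have e2 : 0 < e / 2 by rewrite divr_gt0.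
have [d d0 dP] := conv_eta_L1 c s lf e2.
have [n [mn nD nd]] : exists n, [/\ (m <= n)%N, D * t ^+ n * (4 * s ^+ 2) <= e / 2 & t ^+ n < d].
  have h1 := (cvgrPdist_le _ _).1 ct _ e2; have h2 := (cvgrPdist_lt _ _).1 ct' _ d0.
  have h3 : \forall n \near \oo, (m <= n)%N by exists m.
  have [N _ NP] := filterI h3 (filterI (h1 _) (h2 _)).
  have [/= a1 [a2 a3]] := NP N (leqnn N); exists N; split=> //.
    by apply: le_trans a2; rewrite sub0r normrN ler_norm.
  by rewrite sub0r normrN ger0_norm // ltW in a3.
have mu := continuous_measurable2 (cu n).
have mb := measurable_box c s.
have m1 : mes2 (fun z => u n z - f z) by exact: measurable_funB.
apply: (@le_trans _ _ (\int[@area R]_(z in box c s) ((D * t ^+ n)%:E + `|u n z - f z|%:E))%E).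
  apply: ge0_le_integral => //.
  - exact: mes2_norm_box.
  - apply: emeasurable_funD; first exact: measurable_cst.
    by apply/measurable_EFinP; apply: measurable_funTS; exact: measurableT_comp m1.
  move=> z zb; rewrite -EFinD lee_fin patchE mem_set // /k.
  rewrite (_ : g z - f z = (u n z - f z) - (u n z - g z)); last ring.
  apply: le_trans (ler_normB _ _) _; rewrite addrC lerD2r.
  by have [_ ->] := G z zb.
have D0 : 0 <= D * t ^+ n.
  have cb : box c s c by apply/boxE; rewrite !subrr normr0.
  have [_ /(_ n mn) h] := G c cb; exact: le_trans (normr_ge0 _) h.
rewrite ge0_integralD //; first last.
- by apply/measurable_EFinP; apply: measurable_funTS; exact: measurableT_comp m1.
rewrite [e]splitr EFinD; apply: leeD; last exact: (ltW (dP _ (tn n) nd)).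
rewrite integral_cst //; have -> : @area R (box c s) = (4 * s ^+ 2)%:E by exact: area_box.
by rewrite -EFinM lee_fin.
Qed.

(** The factor [3]: the mean value bound asks for control at all [t] with
    [|t - x| <= |y - x| <= 2 s], that is up to distance [3 s] from the centre. *)
Lemma conv_line_lipschitz (R : realType) (O : set (R * R)) (k : bool) (f g : R * R -> R)
    (r T : R) (c : R * R) (s : R) z x y :
  0 < r -> locint f -> weak_deriv O k f g -> box c (3 * s + r) `<=` O ->
  (forall w, box c (3 * s) w -> `|conv (eta r) g w| <= T) ->
  (forall j, `|crd j z - crd j c| <= s) -> `|x - crd k c| <= s -> `|y - crd k c| <= s ->
  `|line k (conv (eta r) f) z y - line k (conv (eta r) f) z x| <= T * `|y - x|.
Proof.
move=> r0 lf wg cO gT zb xb yb.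
have ke := kernel_eta r; have se := supp_eta r0.
apply: (@derive_bound_segment R _ (fun t => line k (partial k (conv (eta r) f)) z t)) => [t|t tx].
  by apply: is_derive_line => w; have [] := conv_derivable k w ke se lf.
pose w := if k then (z.1, t) else (t, z.2).
have -> : line k (partial k (conv (eta r) f)) z t = partial k (conv (eta r) f) w.
  by rewrite /line /w; case: (k).
have [_ ->] := conv_derivable k w ke se lf.
have wb : box c (3 * s) w.
  apply/boxE; split.
    rewrite /w; case: (k) xb yb tx => /= xb yb tx; first by have := zb false; rewrite /crd; have := normr_ge0 (z.1 - c.1); lra.
    rewrite (_ : t - c.1 = (t - x) + (x - c.1)); last ring.
    apply: le_trans (ler_normD _ _) _.
    have : `|y - x| <= `|y - c.1| + `|x - c.1|.
      by rewrite (_ : y - x = (y - c.1) - (x - c.1)); [exact: ler_normB|ring].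
    by rewrite /crd in xb yb; lra.
  rewrite /w; case: (k) xb yb tx => /= xb yb tx; last by have := zb true; rewrite /crd; have := normr_ge0 (z.2 - c.2); lra.
  rewrite (_ : t - c.2 = (t - x) + (x - c.2)); last ring.
  apply: le_trans (ler_normD _ _) _.
  have : `|y - x| <= `|y - c.2| + `|x - c.2|.
    by rewrite (_ : y - x = (y - c.2) - (x - c.2)); [exact: ler_normB|ring].
  by rewrite /crd in xb yb; lra.
have wO : box w r `<=` O.
  by move: wb => /boxE[h1 h2]; apply: subset_trans cO; apply: box_sub; rewrite addrK.
by rewrite (wg _ _ _ ke se r0 wO); exact: gT.
Qed.

Lemma conv_box_lipschitz (R : realType) (O : set (R * R)) (f gx gy : R * R -> R)
    (r T : R) (c : R * R) (s : R) z w :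
  0 < r -> locint f -> weak_deriv O false f gx -> weak_deriv O true f gy ->
  box c (3 * s + r) `<=` O ->
  (forall w, box c (3 * s) w -> `|conv (eta r) gx w| <= T) ->
  (forall w, box c (3 * s) w -> `|conv (eta r) gy w| <= T) ->
  box c s z -> box c s w ->
  `|conv (eta r) f z - conv (eta r) f w| <= T * (`|z.1 - w.1| + `|z.2 - w.2|).
Proof.
move=> r0 lf wx wy cO xT yT /boxE[z1 z2] /boxE[w1 w2].
have h1 : `|conv (eta r) f z - conv (eta r) f (w.1, z.2)| <= T * `|z.1 - w.1|.
  have := @conv_line_lipschitz R O false f gx r T c s (w.1, z.2) w.1 z.1 r0 lf wx cO xT _ w1 z1.
  by rewrite /line -surjective_pairing; apply; case.
have h2 : `|conv (eta r) f (w.1, z.2) - conv (eta r) f w| <= T * `|z.2 - w.2|.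
  have := @conv_line_lipschitz R O true f gy r T c s w w.2 z.2 r0 lf wy cO yT _ w2 z2.
  by rewrite /line -surjective_pairing; apply; case.
rewrite mulrDr (_ : _ - _ = (conv (eta r) f z - conv (eta r) f (w.1, z.2)) + (conv (eta r) f (w.1, z.2) - conv (eta r) f w)).
  by apply: le_trans (ler_normD _ _) _; exact: lerD.
by rewrite addrA subrK.
Qed.

Lemma geometric_sum_le (R : realFieldType) (b : R) n : 0 <= b -> b < 1 ->
  \sum_(k < n) b ^+ k <= (1 - b)^-1.
Proof.
move=> b0 b1; have d0 : 0 < 1 - b by lra.
rewrite -[leRHS]mul1r ler_pdivlMr // mulrC -opprB mulNr -subrX1 opprB.
by rewrite gerBl exprn_ge0.
Qed.

Lemma powR_geometric_sum (R : realType) (t a s : R) n : 0 < t -> t < 1 -> 0 < a -> 0 <= s ->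
  \sum_(k < n) (t ^+ k * s) `^ a <= (1 - t `^ a)^-1 * s `^ a.
Proof.
move=> t0 t1 a0 s0.
have b1 : t `^ a < 1.
  have <- : 1 `^ a = 1 :> R by rewrite powR1.
  by apply: gt0_ltr_powR => //; rewrite ?nnegrE ?ler01 // ltW.
have -> : \sum_(k < n) (t ^+ k * s) `^ a = (\sum_(k < n) (t `^ a) ^+ k) * s `^ a.
  rewrite mulr_suml; apply: eq_bigr => k _; rewrite powRM ?exprn_ge0 ?(ltW t0) //.
  by congr (_ * _); rewrite -(powR_mulrn k (ltW t0)) -(powR_mulrn k (powR_ge0 t a)) -!powRrM mulrC.
by apply: ler_wpM2r; [exact: powR_ge0|apply: geometric_sum_le => //; exact: powR_ge0].
Qed.

Lemma exists_expr_le (R : realType) (t e : R) : 0 < t -> t < 1 -> 0 < e -> exists m, t ^+ m <= e.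
Proof.
move=> t0 t1 e0.
have ct : t ^+ n @[n --> \oo] --> (0 : R) by apply: cvg_expr; rewrite ger0_norm // ltW.
have [N _ NP] := (cvgrPdist_le _ _).1 ct e e0.
exists N; have := NP N (leqnn N); rewrite /= sub0r normrN ger0_norm //.
by rewrite exprn_ge0 // ltW.
Qed.

(** The ratio [t] is chosen before all data, so the representative is given by the same formula near
    every [c] and the local versions need no gluing. *)
Lemma lipschitz_rep (R : realType) : exists t : R, forall (O : set (R * R))
    (p q F1 F2 G1 G2 : R * R -> R) (M K0 N alpha : R),
  open O -> wirtinger O p q F1 F2 G1 G2 ->
  sqint F1 -> sqint F2 -> sqint G1 -> sqint G2 ->
  (forall z, `|G1 z| <= M) -> (forall z, `|G2 z| <= M) ->
  0 < K0 -> 0 <= N -> 0 < alpha ->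
  nonlinear_control O F1 F2 G1 G2 K0 N (fun s => s `^ alpha) ->
  forall c, O c -> exists s L : R, 0 < s /\ forall f, f = p \/ f = q ->
    let g z := limn (fun n => conv (eta (t ^+ n)) f z) in
    (forall z w, box c s z -> box c s w -> `|g z - g w| <= L * (`|z.1 - w.1| + `|z.2 - w.2|)) /\
    {ae @area R, forall z, box c s z -> g z = f z}.
Proof.
have [t [t0 t2 HT]] := means_bounded R; have t1 : t < 1 by lra.
exists t => O p q F1 F2 G1 G2 M K0 N al oO wH q1 q2 q3 q4 G1M G2M K00 N0 al0 nl c Oc.
have /nbhs_box[e e0 eO] : nbhs c O by exact: open_nbhs_nbhs.
have e4 : 0 < e / 4 by rewrite divr_gt0.
have [m tm] := exists_expr_le t0 t1 e4.
have s00 : 0 < t ^+ m by rewrite exprn_gt0.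
have [T HTT] := HT O p q F1 F2 G1 G2 M K0 N (t ^+ m) _ _ wH q1 q2 q3 q4 G1M G2M K00 N0 s00
  (fun s => powR_ge0 s al) nl (fun n => powR_geometric_sum n t0 t1 al0 (ltW s00)).
(* Then [3 s + 2 t^m <= e], so that all squares used below stay inside [O]. *)
pose s := e / 6; have s0 : 0 < s by rewrite divr_gt0.
have [C C0 HC] := xker_le t0 (ltW t1).
have M0 : 0 <= M := le_trans (normr_ge0 _) (G1M 0).
have c0p := c0_gt0 R.
(* Two convolutions in [cauchy_conv], each at most [(C / r) (4 r^2 M) = 4 C M r]. *)
pose D := (c0 R)^-1 * (8 * C * M).
have [[lp lq] [l1 l2 l3 l4] px py [qx qy]] := wH.
have tn n : 0 < t ^+ n by rewrite exprn_gt0.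
have tnm n : (m <= n)%N -> t ^+ n <= t ^+ m.
  by move=> mn; rewrite ler_wiXn2l // ltW.
have zO z : box c (3 * s) z -> box z (2 * t ^+ m) `<=` O.
  move=> /boxE[z1 z2]; apply: subset_trans eO; apply: box_sub.
    by move: z1 tm; rewrite /s; clear; lra.
  by move: z2 tm; rewrite /s; clear; lra.
have szb z : box c s z -> box c (3 * s) z.
  by apply: box_sub; rewrite subrr normr0; move: s0; clear; lra.
have zO' n z : (m <= n)%N -> box c s z -> box z (t ^+ n) `<=` O.
  move=> mn zb; apply: subset_trans (zO z (szb z zb)); apply: box_sub; rewrite subrr normr0.
    by have := tnm n mn; move: s00; clear; lra.
  by have := tnm n mn; move: s00; clear; lra.
have dist n z : (m <= n)%N -> box c s z ->
   `|conv (eta (t ^+ n.+1)) p z - conv (eta (t ^+ n)) p z| <= D * t ^+ n /\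
   `|conv (eta (t ^+ n.+1)) q z - conv (eta (t ^+ n)) q z| <= D * t ^+ n.
  move=> mn zb; set r := t ^+ n.
  have r0 : 0 < r := tn n; have e0' : 0 < t * r by rewrite mulr_gt0.
  have er : t * r <= r by rewrite ger_pMl // ltW.
  have [E1 E2] := cauchy_conv wH e0' er (zO' n z mn zb).
  have kx := kernel_continuous (kernel_xker (t * r) r); have ky := kernel_continuous (kernel_yker (t * r) r).
  have sx := supp_xker e0' er; have sy := supp_yker e0' er.
  have bx w : `|xker (t * r) r w| <= C * r^-1 by have [] := HC r w r0.
  have bw w : `|yker (t * r) r w| <= C * r^-1 by have [] := HC r w r0.
  have x1 := conv_le z (ltW r0) kx sx bx l3 G1M; have x2 := conv_le z (ltW r0) kx sx bx l4 G2M.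
  have y1 := conv_le z (ltW r0) ky sy bw l3 G1M; have y2 := conv_le z (ltW r0) ky sy bw l4 G2M.
  have Cr : C * r^-1 * (4 * r ^+ 2 * M) = 4 * C * M * r by field; exact: lt0r_neq0.
  rewrite Cr in x1 x2 y1 y2.
  have fin (x u v : R) : c0 R * x = u + v -> `|u| <= 4 * C * M * r -> `|v| <= 4 * C * M * r -> `|x| <= D * r.
    move=> xE hu hv.
    have -> : D * r = 8 * C * M * r / c0 R by rewrite /D; ring.
    rewrite ler_pdivlMr // mulrC -[X in X * _](gtr0_norm c0p) -normrM xE.
    apply: le_trans (ler_normD _ _) _; move: hu hv; clear; lra.
  rewrite exprS -/r; split; first exact: fin E1 x1 y2.
  by apply: fin E2 x2 _; rewrite normrN.
have FT n z : (m <= n)%N -> box c (3 * s) z ->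
   `|conv (eta (t ^+ n)) F1 z| <= T /\ `|conv (eta (t ^+ n)) F2 z| <= T.
  by move=> mn zb; have := HTT z (n - m)%N (zO z zb); rewrite -exprD subnK.
have GT n z : `|conv (eta (t ^+ n)) G1 z| <= M /\ `|conv (eta (t ^+ n)) G2 z| <= M.
  by split; apply: conv_eta_le.
have addB n z (f g : R * R -> R) : locint f -> locint g -> `|conv (eta (t ^+ n)) f z| <= T -> `|conv (eta (t ^+ n)) g z| <= M ->
    `|conv (eta (t ^+ n)) (fun w => f w + g w) z| <= T + M /\
    `|conv (eta (t ^+ n)) (fun w => f w - g w) z| <= T + M /\
    `|conv (eta (t ^+ n)) (fun w => g w - f w) z| <= T + M.
  move=> lf lg hf hg; have ke := kernel_continuous (kernel_eta (t ^+ n)); have se := supp_eta (tn n).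
  rewrite (convDr z ke se lf lg) (convBr z ke se lf lg) (convBr z ke se lg lf).
  split; first by apply: le_trans (ler_normD _ _) _; exact: lerD.
  split; first by apply: le_trans (ler_normB _ _) _; exact: lerD.
  by apply: le_trans (ler_normB _ _) _; rewrite addrC; exact: lerD.
have cO n : (m <= n)%N -> box c (3 * s + t ^+ n) `<=` O.
  move=> mn; apply: subset_trans eO; apply: box_sub; rewrite subrr normr0.
    by have := tnm n mn; move: tm e0; rewrite /s; clear; lra.
  by have := tnm n mn; move: tm e0; rewrite /s; clear; lra.
exists s, (T + M); split=> // f fpq.
have [fD fL] : (forall n z, (m <= n)%N -> box c s z ->
     `|conv (eta (t ^+ n.+1)) f z - conv (eta (t ^+ n)) f z| <= D * t ^+ n) /\
  (forall n z w, (m <= n)%N -> box c s z -> box c s w ->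
     `|conv (eta (t ^+ n)) f z - conv (eta (t ^+ n)) f w| <= (T + M) * (`|z.1 - w.1| + `|z.2 - w.2|)).
  split=> [n z mn zb|n z w mn zb wb].
    by have [h1 h2] := dist n z mn zb; case: fpq => ->.
  case: fpq => ->.
    apply: (conv_box_lipschitz (tn n) lp px py (cO n mn)) => // x xb.
      by have [h1 h2] := FT n x mn xb; have [g1 g2] := GT n x; have [] := addB n x _ _ l1 l3 h1 g1.
    by have [h1 h2] := FT n x mn xb; have [g1 g2] := GT n x; have [_ []] := addB n x _ _ l2 l4 h2 g2.
  apply: (conv_box_lipschitz (tn n) lq qx qy (cO n mn)) => // x xb.
    by have [h1 h2] := FT n x mn xb; have [g1 g2] := GT n x; have [] := addB n x _ _ l2 l4 h2 g2.
  by have [h1 h2] := FT n x mn xb; have [g1 g2] := GT n x; have [_ []] := addB n x _ _ l1 l3 h1 g1.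
have lf : locint f by case: fpq => ->.
exact: (mollified_rep t0 t1 (ltW s0) lf fD fL).
Qed.

(** * From real to complex coordinates *)

Lemma cabsE (R : realType) (z : Cplx R) :
  cabs z = Num.sqrt (complex.Re z ^+ 2 + complex.Im z ^+ 2).
Proof. by rewrite /cabs normc_def. Qed.

Lemma cabs_sqr (R : realType) (z : Cplx R) :
  cabs z ^+ 2 = complex.Re z ^+ 2 + complex.Im z ^+ 2.
Proof. by rewrite cabsE sqr_sqrtr // addr_ge0 ?sqr_ge0. Qed.

Lemma cabs_ge0 (R : realType) (z : Cplx R) : 0 <= cabs z.
Proof. by rewrite cabsE sqrtr_ge0. Qed.

Lemma normC_cabs (R : realType) (z : Cplx R) : `|z| = (cabs z)%:C%C.
Proof. by rewrite cabsE normc_def. Qed.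

Lemma cabsM (R : realType) (z w : Cplx R) : cabs (z * w) = cabs z * cabs w.
Proof. by apply: (@complexI R); rewrite -normC_cabs normrM !normC_cabs -rmorphM. Qed.

Lemma cabsV (R : realType) (z : Cplx R) : cabs z^-1 = (cabs z)^-1.
Proof. by apply: (@complexI R); rewrite -normC_cabs normfV normC_cabs -fmorphV. Qed.

Lemma cabs0_eq (R : realType) (z : Cplx R) : cabs z = 0 -> z = 0.
Proof. by move=> z0; apply/normr0_eq0; rewrite normC_cabs z0. Qed.

Lemma cabsD (R : realType) (z w : Cplx R) : cabs (z + w) <= cabs z + cabs w.
Proof. by rewrite -lecR rmorphD /= -!normC_cabs ler_normD. Qed.

Lemma cabsN (R : realType) (z : Cplx R) : cabs (- z) = cabs z.
Proof. by rewrite /cabs normrN. Qed.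

Lemma cabsB (R : realType) (z w : Cplx R) : cabs (z - w) <= cabs z + cabs w.
Proof. by rewrite -(cabsN w); exact: cabsD. Qed.

Lemma cabs_dist (R : realType) (z w : Cplx R) : cabs (z - w) = cabs (w - z).
Proof. by rewrite -cabsN opprB. Qed.

Lemma cabs_le_sum (R : realType) (z : Cplx R) :
  cabs z <= `|complex.Re z| + `|complex.Im z|.
Proof.
rewrite -ler_sqr ?nnegrE ?cabs_ge0 ?addr_ge0 // cabs_sqr sqrrD !real_normK ?num_real //.
by rewrite -addrA lerD2l lerDr mulrn_wge0 // mulr_ge0.
Qed.

Lemma sum_le_cabs (R : realType) (z : Cplx R) :
  `|complex.Re z| + `|complex.Im z| <= 2 * cabs z.
Proof.
have h := sqr_ge0 (`|complex.Re z| - `|complex.Im z|); have c0 := cabs_ge0 z.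
rewrite -ler_sqr ?nnegrE ?addr_ge0 ?mulr_ge0 // exprMn cabs_sqr.
rewrite -[complex.Re z ^+ 2]real_normK ?num_real // -[complex.Im z ^+ 2]real_normK ?num_real //.
move: h (sqr_ge0 (`|complex.Re z| + `|complex.Im z|)); rewrite sqrrB sqrrD; lra.
Qed.

Lemma Re_le_cabs (R : realType) (z : Cplx R) : `|complex.Re z| <= cabs z.
Proof. by rewrite cabsE -sqrtr_sqr ler_wsqrtr // lerDl sqr_ge0. Qed.

Lemma Im_le_cabs (R : realType) (z : Cplx R) : `|complex.Im z| <= cabs z.
Proof. by rewrite cabsE -sqrtr_sqr ler_wsqrtr // lerDr sqr_ge0. Qed.

Lemma cpxE (R : realType) (z : Cplx R) : cpx (complex.Re z, complex.Im z) = z.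
Proof. by case: z. Qed.

Lemma nbhs_cpx (R : realType) (z : Cplx R) (A : set (Cplx R)) :
  nbhs z A <-> exists2 e : R, 0 < e & forall w, cabs (z - w) < e -> A w.
Proof.
split=> [/nbhs_ballP[e /= e0 eA]|[e e0 eA]].
  (* The radius of a library ball is itself a complex number; positivity forces it to be real. *)
  have re : e = (complex.Re e)%:C%C.
    by rewrite RRe_real // ger0_real // ltW.
  exists (complex.Re e); first by move: e0; rewrite re ltcR.
  by move=> w zw; apply: eA; rewrite /ball /= normC_cabs re ltcR.
apply/nbhs_ballP; exists (e%:C%C) => /=; first by rewrite ltcR.
by move=> w; rewrite /ball /= normC_cabs ltcR; exact: eA.
Qed.

Lemma continuous_cpx (R : realType) : continuous (@cpx R).
Proof.
move=> p A /nbhs_cpx[e e0 eA]; apply/nbhs_box; exists (e / 4); first by rewrite divr_gt0.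
move=> q /boxE[h1 h2]; apply: eA; apply: le_lt_trans (cabs_le_sum _) _ => /=.
by rewrite distrC in h1; rewrite distrC in h2; lra.
Qed.

Lemma open_coords (R : realType) (Om : set (Cplx R)) : open Om -> open (coords Om).
Proof. by move=> oO; apply: open_comp => // z _; exact: continuous_cpx. Qed.

Lemma coords_image (R : realType) (K : set (R * R)) : coords (@cpx R @` K) = K.
Proof.
apply/seteqP; split=> [p [q Kq]|p Kp]; last by exists p.
by rewrite /cpx => -[] h1 h2; rewrite (surjective_pairing p) -h1 -h2 -surjective_pairing.
Qed.

Lemma compact_cpx (R : realType) (K : set (R * R)) : compact K -> compact (@cpx R @` K).
Proof.
move=> cK; apply: continuous_compact cK; apply: continuous_subspaceT; exact: continuous_cpx.
Qed.

(** * Zero extensions and uniqueness of weak derivatives *)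

Lemma L1_loc_box (R : realType) (Om : set (Cplx R)) (f : Cplx R -> Cplx R) (c : R * R) (s : R) :
  L1_loc Om f -> box c s `<=` coords Om ->
  (@area R).-integrable (box c s) (EFin \o re_part f) /\
  (@area R).-integrable (box c s) (EFin \o im_part f).
Proof.
move=> lf cO; have := lf _ (compact_cpx (@compact_box R c s)).
by rewrite coords_image; apply=> _ [p cp <-]; exact: cO.
Qed.

Lemma locint_patch_box (R : realType) (f : R * R -> R) (c : R * R) (s : R) :
  (@area R).-integrable (box c s) (EFin \o f) -> locint (f \_ (box c s)).
Proof.
move=> fi.
have fT : int2 (f \_ (box c s)).
  by rewrite -restrict_EFin; apply/(integrable_mkcond _ (measurable_box c s)).1.
split; first by case/integrableP : fT => /measurable_EFinP.
by move=> d r; exact: (integrableS measurableT).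
Qed.

Lemma sqint_patch (R : realType) (O : set (measurableTypeR R * measurableTypeR R))
    (f g : R * R -> R) :
  measurable O -> measurable_fun O f -> measurable_fun O g ->
  (\int[@area R]_(p in O) (g p)%:E < +oo)%E ->
  (forall p, O p -> f p ^+ 2 <= g p) -> sqint (f \_ O).
Proof.
move=> mO mf mg gfin fg.
have mfO : mes2 (f \_ O) by apply/(measurable_restrictT _ mO).
split => //; apply/integrableP; split.
  by apply/measurable_EFinP; exact: measurable_funX.
apply: le_lt_trans gfin; rewrite [leRHS]integral_mkcond.
apply: ge0_le_integral => //.
- apply/measurable_EFinP; apply: measurableT_comp => //; exact: measurable_funX.
- by apply/(measurable_restrictT _ mO); exact/measurable_EFinP.
move=> p _; rewrite /= !patchE; case: ifPn => [/set_mem Op|_].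
  by rewrite lee_fin ger0_norm ?sqr_ge0 // fg.
by rewrite expr0n normr0.
Qed.

Lemma L2_sqint (R : realType) (Om : set (Cplx R)) (f : Cplx R -> Cplx R)
    (A : set (measurableTypeR R * measurableTypeR R)) :
  open Om -> measurable A -> A `<=` coords Om -> L2 Om f ->
  sqint (re_part f \_ A) /\ sqint (im_part f \_ A).
Proof.
move=> oO mA AO [m1 m2 fi]; have mO := open_measurable2 (open_coords oO).
have E p : cabs (f (cpx p)) ^+ 2 = re_part f p ^+ 2 + im_part f p ^+ 2 by exact: cabs_sqr.
have mg : measurable_fun (coords Om : set (measurableTypeR R * measurableTypeR R))
    (fun p => cabs (f (cpx p)) ^+ 2).
  by under eq_fun do rewrite E; apply: measurable_funD; exact: measurable_funX.
have n1 := measurable_funS mO AO m1; have n2 := measurable_funS mO AO m2.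
have ng := measurable_funS mO AO mg.
have fiA : (\int[@area R]_(p in A) (cabs (f (cpx p)) ^+ 2)%:E < +oo)%E.
  apply: le_lt_trans fi; apply: ge0_subset_integral => //.
    exact/measurable_EFinP.
  by move=> p _; rewrite lee_fin sqr_ge0.
split; apply: (sqint_patch mA _ ng fiA) => // p _; rewrite E.
  by rewrite lerDl sqr_ge0.
by rewrite lerDr sqr_ge0.
Qed.

Lemma ae_patch_eq (R : realType) (O Z : set (R * R)) (f : R * R -> R) :
  (@area R).-negligible Z ->
  {ae @area R, forall w, O w -> (f \_ (O `\` Z)) w = (f \_ O) w}.
Proof.
move=> nZ; apply: negligibleS nZ => w /= /not_implyP[Ow h]; apply: contrapT => nZw; apply: h.
by rewrite !patchE !mem_set.
Qed.

Lemma conv_patch (R : realType) (ka f : R * R -> R) (O : set (R * R)) z :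
  conv ka (f \_ O) z = \int[@area R]_(w in O) (f w * ka (z - w)).
Proof.
rewrite /conv [RHS]Rintegral_mkcond; apply: eq_Rintegral => w _.
by rewrite !patchE; case: ifP; rewrite ?mulr0 // mulrC.
Qed.

Lemma weak_partial_integrals (R : realType) (Om : set (Cplx R)) (k : bool)
    (h g : Cplx R -> Cplx R) (phi : R * R -> R) :
  is_weak_partial Om k h g -> test_function Om phi ->
  \int[@area R]_(w in coords Om) (re_part h w * partial k phi w) =
    (- \int[@area R]_(w in coords Om) (re_part g w * phi w)) /\
  \int[@area R]_(w in coords Om) (im_part h w * partial k phi w) =
    - \int[@area R]_(w in coords Om) (im_part g w * phi w).
Proof.
move=> [_ _ H] tphi; have := H phi tphi.
rewrite /cintegral => /eqP; rewrite eq_complex /= => /andP[/eqP h1 /eqP h2].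
have E (f : Cplx R -> Cplx R) (u : R * R -> R) :
   (re_part (fun z => f z * (u (complex.Re z, complex.Im z))%:C%C) = fun w => re_part f w * u w) /\
   (im_part (fun z => f z * (u (complex.Re z, complex.Im z))%:C%C) = fun w => im_part f w * u w).
  rewrite /re_part /im_part; split; apply/funext => w; rewrite /= -surjective_pairing;
    case: (f (cpx w)) => a b /=; ring.
have [e1 e2] := E h (partial k phi); have [e3 e4] := E g phi.
by rewrite e1 e3 in h1; rewrite e2 e4 in h2.
Qed.

(** Valid without integrability, since [fine] sends infinite values to [0]. *)
Lemma RintegralN (R : realType) (O : set (R * R)) (f : R * R -> R) :
  \int[@area R]_(w in O) - f w = - \int[@area R]_(w in O) f w.
Proof.
rewrite /Rintegral integralE [in RHS]integralE.
have -> : (fun x => (- f x)%:E) = (\- (fun x => (f x)%:E))%E by [].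
rewrite funeposN funenegN.
by move: (integral _ _ _) (integral _ _ _) => [x| |] [y| |] //=; rewrite ?oppr0 // opprB.
Qed.

(** The test function is the kernel reflected at [z]; the sign produced by the reflection cancels
    the one in the definition of a weak derivative. *)
Lemma weak_deriv_patch (R : realType) (Om : set (Cplx R)) (k : bool)
    (h g : Cplx R -> Cplx R) : is_weak_partial Om k h g ->
  weak_deriv (coords Om) k (re_part h \_ (coords Om)) (re_part g \_ (coords Om)) /\
  weak_deriv (coords Om) k (im_part h \_ (coords Om)) (im_part g \_ (coords Om)).
Proof.
move=> H.
have P (f u : R * R -> R) ka r z : kernel ka -> supp 0 r ka ->
    \int[@area R]_(w in coords Om) (f w * partial k (refl z ka) w) =
      (- \int[@area R]_(w in coords Om) (u w * refl z ka w)) ->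
    conv (partial k ka) (f \_ (coords Om)) z = conv ka (u \_ (coords Om)) z.
  move=> kk sk; rewrite !conv_patch.
  have -> : \int[@area R]_(w in coords Om) (f w * partial k (refl z ka) w) =
      - \int[@area R]_(w in coords Om) (f w * partial k ka (z - w)).
    rewrite -RintegralN; apply: eq_Rintegral => w _.
    by have [_ ->] := partial_refl (kernel_derivable k (z - w) kk); rewrite mulrN.
  by move/oppr_inj.
split=> ka r z kk sk r0 zO.
  by apply: (P _ _ _ _ _ kk sk); have [] := weak_partial_integrals H (test_function_refl kk sk zO).
by apply: (P _ _ _ _ _ kk sk); have [] := weak_partial_integrals H (test_function_refl kk sk zO).
Qed.

(** [weak_partial] is an arbitrary choice made by [xget]; this identifies it almost everywhere with
    any known weak derivative. The fundamental lemma asks for functions on the whole plane, hence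
    the truncation to squares. *)
Lemma weak_partial_unique (R : realType) (Om : set (Cplx R)) (k : bool)
    (h g1 g2 : Cplx R -> Cplx R) : open Om ->
  is_weak_partial Om k h g1 -> is_weak_partial Om k h g2 ->
  ae_in Om (fun z => g1 z = g2 z).
Proof.
move=> oO H1 H2; have oC := open_coords oO.
have [_ L1 _] := H1; have [_ L2' _] := H2.
have [wr1 wi1] := weak_deriv_patch H1; have [wr2 wi2] := weak_deriv_patch H2.
suff P (f g u : R * R -> R) : weak_deriv (coords Om) k u (f \_ (coords Om)) ->
    weak_deriv (coords Om) k u (g \_ (coords Om)) ->
    (forall c s, box c s `<=` coords Om -> (@area R).-integrable (box c s) (EFin \o f)) ->
    (forall c s, box c s `<=` coords Om -> (@area R).-integrable (box c s) (EFin \o g)) ->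
    {ae @area R, forall p, coords Om p -> f p = g p}.
  have Pr := P (re_part g1) (re_part g2) _ wr1 wr2
    (fun c s cs => (L1_loc_box L1 cs).1) (fun c s cs => (L1_loc_box L2' cs).1).
  have Pi := P (im_part g1) (im_part g2) _ wi1 wi2
    (fun c s cs => (L1_loc_box L1 cs).2) (fun c s cs => (L1_loc_box L2' cs).2).
  apply: (negligibleS _ (negligibleU Pr Pi)) => p /= /not_implyP[Op ne].
  apply: contrapT => /not_orP[/contrapT er /contrapT ei]; apply: ne.
  apply/eqP; rewrite eq_complex; apply/andP; split; apply/eqP; [exact: er|exact: ei].
move=> w1 w2 i1 i2; apply: ae_box_cover => c Oc.
have /nbhs_box[s s0 sO] : nbhs c (coords Om) by exact: open_nbhs_nbhs.
exists (s / 2); first by rewrite divr_gt0.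
have l1 := locint_patch_box (i1 c s sO); have l2 := locint_patch_box (i2 c s sO).
pose O1 : set (R * R) := interior (box c s).
have lB : locint (fun w => (f \_ (box c s)) w - (g \_ (box c s)) w).
  have [[m1 j1] [m2 j2]] := (l1, l2); split; first exact: measurable_funB.
  by move=> d r; have := integrableB (measurable_box d r) (j1 d r) (j2 d r); exact: eq_integrable.
have Z : {ae @area R, forall z, O1 z -> (f \_ (box c s)) z - (g \_ (box c s)) z = 0}.
  apply: conv_eta_ae0 => //; first exact: open_interior.
  move=> z r r0 zO1; have ke := kernel_eta r; have se := supp_eta r0.
  have zs : box z r `<=` box c s by apply: subset_trans zO1 _; exact: interior_subset.
  have e := convBr z (kernel_continuous ke) se l1 l2; apply: etrans e _.
  have X (v : R * R -> R) : conv (eta r) (v \_ (box c s)) z = conv (eta r) (v \_ (coords Om)) z.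
    apply: (conv_eq_box se) => w wz; rewrite !patchE !mem_set //; last exact: zs.
    by apply: sO; exact: zs.
  rewrite !X -(w1 _ _ _ ke se r0 (subset_trans zs sO)) -(w2 _ _ _ ke se r0 (subset_trans zs sO)).
  by rewrite subrr.
apply: (ae_imp Z) => z zP zc.
have : O1 z.
  apply/nbhs_box; exists (s / 2); first by rewrite divr_gt0.
  move: zc => /boxE[z1 z2]; apply: box_sub; lra.
move=> /zP; rewrite !patchE !mem_set; first by move/eqP; rewrite subr_eq0 => /eqP.
  by apply: box_sub zc; rewrite subrr normr0; lra.
Qed.

(** * Pointwise estimates for the nonlinearity *)

Lemma open_two_points (R : realType) (Om : set (Cplx R)) : open Om -> Om !=set0 ->
  exists z w, [/\ Om z, Om w & z != w].
Proof.
move=> oO [z Oz]; have /nbhs_cpx[e e0 eO] : nbhs z Om by exact: open_nbhs_nbhs.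
pose w : Cplx R := z + (e / 2)%:C%C.
have e2 : 0 < e / 2 by rewrite divr_gt0.
exists z, w; split=> //.
  apply: eO; rewrite /w opprD addrA subrr sub0r cabsN cabsE /= expr0n addr0 sqrtr_sqr gtr0_norm //.
  by lra.
rewrite /w -[X in X != _]addr0 (inj_eq (addrI z)) eq_sym.
by rewrite eq_complex /= negb_and lt0r_neq0.
Qed.

(** Both suprema are nonnegative, so [M] bounds each of them. For the Hoelder quotient this takes
    two distinct points of [Om]: the supremum of an empty set would be [-oo] and the sum would carry
    no information. *)
Lemma hoelder_bounds (R : realType) (Om : set (Cplx R)) (r M alpha : R)
    (H : Cplx R -> sphere R -> Cplx R) xi :
  open Om -> Om !=set0 -> H_hoelder Om r M alpha H -> sphere_gt r xi ->
  (forall z, Om z -> cabs (H z xi) <= M) /\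
  (forall z w, Om z -> Om w -> cabs (H z xi - H w xi) <= M * cabs (z - w) `^ alpha).
Proof.
move=> oO Oe /[apply].
set A := ereal_sup _; set B := ereal_sup _ => AB.
have [z0 [w0 [Oz0 Ow0 zw0]]] := open_two_points oO Oe.
have A0 : (0 <= A)%E.
  apply: le_trans (ereal_sup_ubound _); last by exists z0; [exact: Oz0|].
  by rewrite lee_fin cabs_ge0.
have B0 : (0 <= B)%E.
  apply: le_trans (ereal_sup_ubound _); last by exists (z0, w0); [split|].
  by rewrite lee_fin divr_ge0 ?cabs_ge0 ?powR_ge0.
have AM : (A <= M%:E)%E by apply: le_trans AB; exact: leeDl.
have BM : (B <= M%:E)%E by apply: le_trans AB; exact: leeDr.
split=> [z Oz|z w Oz Ow].
  rewrite -lee_fin; apply: le_trans AM; apply: ereal_sup_ubound; by exists z.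
have [->|zw] := eqVneq z w.
  rewrite !subrr (_ : cabs 0 = 0); last by rewrite cabsE expr0n addr0 sqrtr0.
  by rewrite mulr_ge0 ?powR_ge0 // -lee_fin; exact: le_trans A0 AM.
have zw1 : 0 < cabs (z - w) `^ alpha.
  rewrite powR_gt0 // lt_neqAle cabs_ge0 andbT eq_sym; apply/eqP => /cabs0_eq/eqP.
  by rewrite subr_eq0 (negbTE zw).
rewrite -ler_pdivrMr // -lee_fin; apply: le_trans BM; apply: ereal_sup_ubound.
by exists (z, w).
Qed.

Lemma sphere_gt_Some (R : realType) (r : R) (z : Cplx R) : r < cabs z -> sphere_gt r (Some z).
Proof. by move=> rz; rewrite /sphere_gt /= lte_fin rz leey. Qed.

Lemma sqr_sum_le (R : realDomainType) (x y u v : R) : 0 <= x -> x <= y + u -> y ^+ 2 <= v ->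
  x ^+ 2 <= 2 * u ^+ 2 + 2 * v.
Proof.
move=> x0 xyu yv; have h := sqr_ge0 (y - u).
have : x ^+ 2 <= (y + u) ^+ 2 by rewrite lerXn2r // nnegrE // (le_trans x0).
by move: h; rewrite sqrrB sqrrD; lra.
Qed.

(* The nonlinearity oscillates less than the derivative itself once the mean of the
   derivative is large, because [H] is Lipschitz in [1 / xi]. *)
Lemma nonlinear_pointwise (R : realType) (Om : set (Cplx R)) (r L M M' alpha : R)
    (H : Cplx R -> sphere R -> Cplx R) (K0 : R) :
  open Om -> Om !=set0 -> 0 <= r -> 0 <= L -> 0 <= M -> 0 < alpha < 1 -> M <= M' ->
  H_lipschitz Om r L H -> H_hoelder Om r M alpha H ->
  4 * (r + 1) <= K0 -> 4 * L <= K0 -> 4 * M' <= K0 ->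
  forall (z0 z A F G : Cplx R) (s : R), 0 < s -> Om z0 -> Om z ->
   `|complex.Re (z - z0)| + `|complex.Im (z - z0)| <= 4 * s ->
   K0 / 2 <= cabs A -> cabs G <= M' ->
   (r < cabs F -> G = H z (Some F)) ->
   cabs (G - H z0 (Some A)) ^+ 2 <= 32 * M ^+ 2 * (s `^ alpha) ^+ 2 +
     K0 ^+ 2 / cabs A ^+ 2 * cabs (F - A) ^+ 2.
Proof.
move=> oO Oe r0 L0 M0 /andP[a0 a1] MM' HL HH K1 K2 K3 z0 z A F G s s0 Oz0 Oz zz AK GM' GH.
have Ar : r < cabs A by lra.
have Apos : 0 < cabs A by lra.
have [HM HHA] := hoelder_bounds oO Oe HH (sphere_gt_Some Ar).
have AE : cabs A <= cabs F + cabs (F - A).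
  by rewrite -{1}[A](subKr F); exact: cabsB.
set x := cabs (F - A) in AE *.
have x0 : 0 <= x := cabs_ge0 _.
have nn : 0 <= 32 * M ^+ 2 * (s `^ alpha) ^+ 2.
  by apply: mulr_ge0 (sqr_ge0 _); apply: mulr_ge0 (sqr_ge0 _).
(* If [|F - A| <= |A| / 2], then [|F| >= |A| / 2 >= r + 1], the equation holds at [z], and
   [1/F - 1/A = (A - F) / (F A)] gives the decay in [|A|]. Otherwise the crude bound
   [2 M' <= K0 / 2] is already below [K0 |F - A| / |A|]. *)
have [Fbig|Fsmall] := leP x (cabs A / 2).
  have Fr : r < cabs F by lra.
  rewrite (GH Fr).
  have d1 : cabs (H z (Some F) - H z0 (Some A)) <=
      cabs (H z (Some F) - H z (Some A)) + cabs (H z (Some A) - H z0 (Some A)).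
    rewrite (_ : H z (Some F) - H z0 (Some A) = (H z (Some F) - H z (Some A)) + (H z (Some A) - H z0 (Some A))).
      exact: cabsD.
    by rewrite addrA subrK.
  have Fpos : 0 < cabs F by lra.
  have F0 : F != 0 by apply/eqP => F0; move: Fpos; rewrite F0 cabsE expr0n addr0 sqrtr0 ltxx.
  have A0 : A != 0 by apply/eqP => A0; move: Apos; rewrite A0 cabsE expr0n addr0 sqrtr0 ltxx.
  have d2 : cabs (H z (Some F) - H z (Some A)) <= 2 * L * x / cabs A.
    apply: le_trans (HL z (Some F) (Some A) Oz (sphere_gt_Some Fr) (sphere_gt_Some Ar)) _.
    rewrite /= (_ : F^-1 - A^-1 = (A - F) * (F^-1 * A^-1)); last first.
      by rewrite mulrBl mulrCA mulfV // mulr1 mulrA mulfV // mul1r.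
    rewrite !cabsM !cabsV cabs_dist -/x.
    have -> : 2 * L * x / cabs A = L * (x * (2 / cabs A)) by ring.
    apply: ler_wpM2l => //; apply: ler_wpM2l => //.
    apply: ler_wpM2r; first by rewrite invr_ge0 ltW.
    by apply: (@le_trans _ _ 1); [rewrite invf_le1 //; lra|rewrite ler1n].
  have zs : cabs (z - z0) <= 4 * s by apply: le_trans zz; exact: cabs_le_sum.
  have d3 : cabs (H z (Some A) - H z0 (Some A)) <= 4 * M * s `^ alpha.
    apply: le_trans (HHA z z0 Oz Oz0) _; rewrite [4 * M]mulrC -mulrA; apply: ler_wpM2l => //.
    (* [(4 s)^alpha <= 4 s^alpha] because [alpha < 1]; squared and doubled, [4 M] becomes the
       [32 M^2] of the statement. *)
    apply: (@le_trans _ _ ((4 * s) `^ alpha)).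
      by apply: ge0_ler_powR => //; rewrite ?nnegrE ?cabs_ge0 ?mulr_ge0 // ltW.
    have c4 : (0 : R) <= 4 by [].
    rewrite (powRM _ c4 (ltW s0)); apply: ler_wpM2r; first exact: powR_ge0.
    rewrite -[leRHS](powRr1 c4); apply: ler_powR (ltW a1); lra.
  have d12 := le_trans d1 (lerD d2 d3).
  have := sqr_sum_le (cabs_ge0 _) d12 (lexx _); move/le_trans; apply.
  rewrite lerD //.
    by rewrite le_eqVlt; apply/orP; left; apply/eqP; ring.
  have -> : 2 * (2 * L * x / cabs A) ^+ 2 = (8 * L ^+ 2) / cabs A ^+ 2 * x ^+ 2.
    by field; exact: lt0r_neq0.
  apply: ler_wpM2r; first exact: sqr_ge0.
  apply: ler_wpM2r; first by rewrite invr_ge0 sqr_ge0.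
  have : (4 * L) ^+ 2 <= K0 ^+ 2 by rewrite lerXn2r // nnegrE; lra.
  by rewrite exprMn; have := sqr_ge0 L; lra.
have d1 : cabs (G - H z0 (Some A)) <= 2 * M'.
  by apply: le_trans (cabsB _ _) _; have := HM z0 Oz0; lra.
have : cabs (G - H z0 (Some A)) ^+ 2 <= (2 * M') ^+ 2.
  by rewrite lerXn2r // nnegrE ?cabs_ge0 // (le_trans (cabs_ge0 _) d1).
move/le_trans; apply; apply: (@le_trans _ _ (K0 ^+ 2 / cabs A ^+ 2 * x ^+ 2)); last by rewrite lerDr.
have : (4 * M') ^+ 2 <= K0 ^+ 2.
  by rewrite lerXn2r // nnegrE; have := le_trans M0 MM'; lra.
have h : (cabs A / 2) ^+ 2 <= x ^+ 2.
  by rewrite lerXn2r // ?nnegrE ?divr_ge0 ?cabs_ge0 // ltW.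
move=> hK; rewrite -mulrA mulrCA ler_pdivlMl ?exprn_gt0 //.
have K00 : 0 <= K0 ^+ 2 := sqr_ge0 _.
apply: (@le_trans _ _ (K0 ^+ 2 * (cabs A / 2) ^+ 2)); last exact: ler_wpM2l.
have := ler_wpM2r (sqr_ge0 (cabs A / 2)) hK; apply: le_trans.
by rewrite le_eqVlt; apply/orP; left; apply/eqP; field.
Qed.

(** * Local Lipschitz continuity of the solution *)

Lemma sqint_comb (R : realType) (f g : R * R -> R) (k l : R) : sqint f -> sqint g ->
  sqint (fun w => k * f w + l * g w).
Proof.
move=> [mf jf] [mg jg].
have m : mes2 (fun w => k * f w + l * g w) by apply: measurable_funD; exact: measurable_funM.
split=> //.
have i2 : int2 (fun w => 2 * (k ^+ 2 * f w ^+ 2 + l ^+ 2 * g w ^+ 2)).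
  have := integrableZl measurableT 2 (integrableD measurableT
    (integrableZl measurableT (k ^+ 2) jf) (integrableZl measurableT (l ^+ 2) jg)).
  exact: eq_integrable.
apply: le_integrable i2 => //; first by apply/measurable_EFinP; exact: measurable_funX.
move=> w _ /=; rewrite lee_fin [leLHS]ger0_norm ?sqr_ge0 //; apply: le_trans (ler_norm _).
by have := sqr_ge0 (k * f w - l * g w); rewrite -!exprMn sqrrB sqrrD; lra.
Qed.

Lemma weak_deriv_ae (R : realType) (O : set (R * R)) (k : bool) (f g g' : R * R -> R) :
  weak_deriv O k f g -> locint g -> locint g' -> {ae @area R, forall w, O w -> g' w = g w} ->
  weak_deriv O k f g'.
Proof.
move=> wg lg lg' gg ka r z kk sk r0 zO; rewrite (wg _ _ _ kk sk r0 zO); apply/esym.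
exact: (conv_ae_eq (kernel_continuous kk) sk zO lg' lg gg).
Qed.

Lemma wirtinger_cpx (R : realType) (x y : Cplx R) :
  (x - 'i%C * y) / 2 = cpx ((complex.Re x + complex.Im y) / 2, (complex.Im x - complex.Re y) / 2) /\
  (x + 'i%C * y) / 2 = cpx ((complex.Re x - complex.Im y) / 2, (complex.Im x + complex.Re y) / 2).
Proof.
have -> : (2 : Cplx R)^-1 = (2^-1)%:C%C :> R[i] by rewrite fmorphV rmorph_nat.
case: x y => [a b] [c d]; rewrite /cpx; split; apply/eqP; rewrite eq_complex /=;
  by apply/andP; split; apply/eqP; ring.
Qed.

Lemma cabs0 (R : realType) : cabs (0 : Cplx R) = 0.
Proof. by rewrite cabsE expr0n addr0 sqrtr0. Qed.

Lemma patch_notin (R : realType) (A : set (R * R)) (f : R * R -> R) w :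
  ~ A w -> (f \_ A) w = 0.
Proof. by move=> nA; rewrite patchE memNset. Qed.

Lemma local_lipschitz_part (R : realType) (Om : set (Cplx R)) (Rad L M alpha : R)
      (H : Cplx R -> sphere R -> Cplx R) (h : Cplx R -> Cplx R) :
    is_domain Om -> 0 <= Rad -> 0 <= L -> 0 <= M -> 0 < alpha < 1 ->
    H_lipschitz Om Rad L H -> H_hoelder Om Rad M alpha H ->
      W12 Om h -> solution Om Rad H h ->
      ae_in Om (fun z => 0 <= Jac Om h z) ->
      up_to_null Om (locally_lipschitz Om) h.
Proof.
move=> [Oe oO _] R0 L0 M0 a01 HL HH [L2h Hk] [_ Heq] HJ.
have [gx wgx L2x] := Hk false; have [gy wgy L2y] := Hk true.
have wpx : is_weak_partial Om false h (weak_partial Om false h) by apply: xgetPex; exists gx.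
have wpy : is_weak_partial Om true h (weak_partial Om true h) by apply: xgetPex; exists gy.
have aex := weak_partial_unique oO wpx wgx; have aey := weak_partial_unique oO wpy wgy.
have oC := open_coords oO; have mC := open_measurable2 oC.
(* One measurable null set collects every exception: the choice of weak derivatives, the sign of the
   Jacobian and the equation. *)
have [Z [mZ Z0 ZP]] : exists Z : set (measurableTypeR R * measurableTypeR R),
  [/\ measurable Z, @area R Z = 0 & forall w, coords Om w -> ~ Z w ->
    [/\ weak_partial Om false h (cpx w) = gx (cpx w), weak_partial Om true h (cpx w) = gy (cpx w),
      0 <= Jac Om h (cpx w) & Rad < cabs (dz Om h (cpx w)) ->
        dzbar Om h (cpx w) = H (cpx w) (Some (dz Om h (cpx w)))]].
  have [Z [mZ Z0 ZP]] := negligibleU (negligibleU aex aey) (negligibleU HJ Heq).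
  exists Z; split=> // w Ow nZ.
  have nn : forall P : Prop, (~ P -> Z w) -> P by move=> P hP; apply: contrapT => /hP.
  split.
  - by apply: nn => e; apply: ZP; left; left; move=> /(_ Ow).
  - by apply: nn => e; apply: ZP; left; right; move=> /(_ Ow).
  - by apply: nn => e; apply: ZP; right; left; move=> /(_ Ow).
  - by apply: nn => e; apply: ZP; right; right; move=> /(_ Ow).
have nZ : (@area R).-negligible Z by exists Z; split=> //; exact: subset_refl.
(* [F] and [G] are set to zero on [Z] and outside [Om], so that the bound on [G] holds everywhere
   and the equation everywhere in [Om]: where [F = 0] it demands nothing, as [0 <= Rad]. *)
pose O := coords Om; pose Og := O `\` Z.
have mOg : measurable (Og : set (measurableTypeR R * measurableTypeR R)) by exact: measurableD.
have OgO : Og `<=` O by move=> w [].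
have [qa qb] := L2_sqint oO mOg OgO L2x; have [qc qd] := L2_sqint oO mOg OgO L2y.
have [qa' qb'] := L2_sqint oO mC (@subset_refl _ _) L2x.
have [qc' qd'] := L2_sqint oO mC (@subset_refl _ _) L2y.
have [qp qq] := L2_sqint oO mC (@subset_refl _ _) L2h.
have [dpx dqx] := weak_deriv_patch wgx; have [dpy dqy] := weak_deriv_patch wgy.
pose a := re_part gx \_ Og; pose b := im_part gx \_ Og.
pose c := re_part gy \_ Og; pose d := im_part gy \_ Og.
pose F1 w := 2^-1 * a w + 2^-1 * d w; pose F2 w := 2^-1 * b w + - 2^-1 * c w.
pose G1 w := 2^-1 * a w + - 2^-1 * d w; pose G2 w := 2^-1 * b w + 2^-1 * c w.
have qF1 : sqint F1 := sqint_comb _ _ qa qd; have qF2 : sqint F2 := sqint_comb _ _ qb qc.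
have qG1 : sqint G1 := sqint_comb _ _ qa qd; have qG2 : sqint G2 := sqint_comb _ _ qb qc.
pose p := re_part h \_ O; pose q := im_part h \_ O.
have ae_of (f : R * R -> R) u : u = f \_ Og -> {ae @area R, forall w, O w -> u w = (f \_ O) w}.
  by move=> ->; exact: ae_patch_eq.
have wH : wirtinger O p q F1 F2 G1 G2.
  split; first by split; exact: sqint_locint.
  - by split; exact: sqint_locint.
  - have e : (fun w => F1 w + G1 w) = a by apply/funext => w; rewrite /F1 /G1; field.
    by rewrite e; apply: (weak_deriv_ae dpx) (sqint_locint qa') (sqint_locint qa) (ae_of _ _ erefl).
  - have e : (fun w => G2 w - F2 w) = c by apply/funext => w; rewrite /F2 /G2; field.
    by rewrite e; apply: (weak_deriv_ae dpy) (sqint_locint qc') (sqint_locint qc) (ae_of _ _ erefl).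
  split.
    have e : (fun w => F2 w + G2 w) = b by apply/funext => w; rewrite /F2 /G2; field.
    by rewrite e; apply: (weak_deriv_ae dqx) (sqint_locint qb') (sqint_locint qb) (ae_of _ _ erefl).
  have e : (fun w => F1 w - G1 w) = d by apply/funext => w; rewrite /F1 /G1; field.
  by rewrite e; apply: (weak_deriv_ae dqy) (sqint_locint qd') (sqint_locint qd) (ae_of _ _ erefl).
(* Where [|h_z| > Rad] the equation bounds [h_zbar] by [M]; elsewhere the Jacobian bounds it by
   [|h_z| <= Rad]. *)
pose M' := Num.max M Rad.
have MM' : M <= M' by rewrite le_max lexx.
have RM' : Rad <= M' by rewrite le_max lexx orbT.
have M'0 : 0 <= M' := le_trans M0 MM'.
have inOg w : Og w -> dz Om h (cpx w) = cpx (F1 w, F2 w) /\ dzbar Om h (cpx w) = cpx (G1 w, G2 w).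
  move=> Ogw; have [Ow nZw] := Ogw; have [e1 e2 _ _] := ZP w Ow nZw.
  have [h1 h2] := wirtinger_cpx (gx (cpx w)) (gy (cpx w)).
  rewrite /dz /dzbar e1 e2 h1 h2 /F1 /F2 /G1 /G2 /a /b /c /d !patchE !mem_set //.
  by split; congr (cpx (_, _)); rewrite /re_part /im_part; ring.
have outOg w : ~ Og w -> [/\ F1 w = 0, F2 w = 0, G1 w = 0 & G2 w = 0].
  move=> nOg; rewrite /F1 /F2 /G1 /G2 /a /b /c /d !patch_notin //.
  by rewrite !mulr0 addr0.
have GM w : cabs (cpx (G1 w, G2 w)) <= M'.
  have [Ogw|nOg] := pselect (Og w); last first.
    have [_ _ -> ->] := outOg w nOg.
    by rewrite (_ : cpx (0, 0) = 0) ?cabs0.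
  have [e1 e2] := inOg w Ogw; have [Ow nZw] := Ogw; have [_ _ J E] := ZP w Ow nZw.
  rewrite -e2; have [Rz|zR] := ltP Rad (cabs (dz Om h (cpx w))).
    rewrite (E Rz); have [HM _] := hoelder_bounds oO Oe HH (sphere_gt_Some Rz).
    by apply: le_trans MM'; exact: HM.
  apply: le_trans RM'; apply: le_trans zR.
  by rewrite -ler_sqr ?nnegrE ?cabs_ge0 // -subr_ge0.
have G1M w : `|G1 w| <= M' by apply: le_trans (GM w); exact: (Re_le_cabs (cpx (G1 w, G2 w))).
have G2M w : `|G2 w| <= M' by apply: le_trans (GM w); exact: (Im_le_cabs (cpx (G1 w, G2 w))).
have FG w : O w -> Rad < cabs (cpx (F1 w, F2 w)) -> cpx (G1 w, G2 w) = H (cpx w) (Some (cpx (F1 w, F2 w))).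
  move=> Ow; have [Ogw|nOg] := pselect (Og w); last first.
    have [-> -> _ _] := outOg w nOg.
    by rewrite (_ : cpx (0, 0) = 0) // cabs0 ltNge R0.
  have [e1 e2] := inOg w Ogw; have [_ nZw] := Ogw; have [_ _ _ E] := ZP w Ow nZw.
  by rewrite -e1 -e2.
pose K0 := 4 * (Rad + 1) + 4 * L + 4 * M'.
have K00 : 0 < K0 by rewrite /K0; lra.
have K1 : 4 * (Rad + 1) <= K0 by rewrite /K0; lra.
have K2 : 4 * L <= K0 by rewrite /K0; lra.
have K3 : 4 * M' <= K0 by rewrite /K0; lra.
have N0 : 0 <= 32 * M ^+ 2 by rewrite mulr_ge0 ?sqr_ge0.
have nl : nonlinear_control O F1 F2 G1 G2 K0 (32 * M ^+ 2) (fun s => s `^ alpha).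
  move=> z0 s x y s0 zO Kxy; pose A : Cplx R := cpx (x, y).
  exists (complex.Re (H (cpx z0) (Some A))), (complex.Im (H (cpx z0) (Some A))) => w wb.
  have Ow : O w := zO w wb.
  have Oz0 : O z0 by apply: zO; apply/boxE; rewrite !subrr normr0; lra.
  (* The threshold is stated for [|a| + |b|], which is at most twice the modulus; hence the [K0 / 2]
     in [nonlinear_pointwise]. *)
  have AK : K0 / 2 <= cabs A by have := sum_le_cabs A; rewrite /A /=; lra.
  have wz : `|complex.Re (cpx w - cpx z0)| + `|complex.Im (cpx w - cpx z0)| <= 4 * s.
    by move: wb => /boxE[/= h1 h2]; lra.
  have := nonlinear_pointwise oO Oe R0 L0 M0 a01 MM' HL HH K1 K2 K3 s0 Oz0 Ow wz AK (GM w) (FG w Ow).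
  by rewrite !cabs_sqr !raddfB.
have al0 : 0 < alpha by case/andP: a01.
have [t Ht] := lipschitz_rep R.
have Hrep := Ht O p q F1 F2 G1 G2 M' K0 (32 * M ^+ 2) alpha oC wH qF1 qF2 qG1 qG2 G1M G2M K00 N0 al0 nl.
pose g f z := limn (fun n => conv (eta (t ^+ n)) f z).
pose h' (z : Cplx R) : Cplx R := cpx (g p (complex.Re z, complex.Im z), g q (complex.Re z, complex.Im z)).
exists h'.
  have A : {ae @area R, forall w, O w -> (O w -> h' (cpx w) = h (cpx w))}.
    apply: ae_box_cover => z Oz; have [s [l [s0 Hs]]] := Hrep z Oz.
    exists s => //; have [_ ap] := Hs p (or_introl erefl); have [_ aq] := Hs q (or_intror erefl).
    apply: (negligibleS _ (negligibleU ap aq)) => w /= /not_implyP[wz /not_implyP[Ow ne]].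
    apply: contrapT => /not_orP[/contrapT ep /contrapT eq_]; apply: ne.
    rewrite /h' /= -surjective_pairing /g (ep wz) (eq_ wz) /p /q !patchE !mem_set //.
    by rewrite /re_part /im_part; case: (h (cpx w)).
  by apply: (ae_imp A) => w wP Ow; exact: wP.
move=> z Oz.
have Oc : O (complex.Re z, complex.Im z) by rewrite /O /coords /= cpxE.
have [s [l [s0 Hs]]] := Hrep _ Oc.
have [lp _] := Hs p (or_introl erefl); have [lq _] := Hs q (or_intror erefl).
pose U : set (Cplx R) := [set w | box (complex.Re z, complex.Im z) s (complex.Re w, complex.Im w)].
have Uz : nbhs z U.
  apply/nbhs_cpx; exists s => // w zw; apply/boxE => /=; split.
    by rewrite distrC; have := Re_le_cabs (z - w); rewrite raddfB /=; lra.
  by rewrite distrC; have := Im_le_cabs (z - w); rewrite raddfB /=; lra.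
exists U => //.
have UU : (U `*` U) (z, z) by split; exact: nbhs_singleton.
have PF := globally_properfilter UU.
(* Each component varies by at most [|l| X] with [X <= 2 |x - y|], which gives [4 |l|] for the two;
   the absolute value is there because the sign of [l] is not known. *)
apply: (@klipschitzW _ _ _ (4 * `|l|)%:C%C) => -[x y] [/= Ux Uy].
rewrite !normC_cabs -rmorphM /= lecR.
apply: le_trans (cabs_le_sum _) _; rewrite /h' /=.
have h1 := lp _ _ Ux Uy; have h2 := lq _ _ Ux Uy; rewrite /= in h1 h2.
have h3 := sum_le_cabs (x - y); rewrite !raddfB /= in h3.
set X := `|complex.Re x - complex.Re y| + `|complex.Im x - complex.Im y| in h1 h2 h3.
have X0 : 0 <= X by rewrite addr_ge0.
have hl : l * X <= `|l| * X by apply: ler_wpM2r => //; exact: ler_norm.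
have hX : `|l| * X <= `|l| * (2 * cabs (x - y)) by exact: ler_wpM2l.
by move: h1 h2 hl hX; rewrite /g; lra.
Qed.

(** * A solution that is not continuously differentiable *)

Definition square (R : realType) : set (Cplx R) :=
  [set z | `|complex.Re z| < 1 /\ `|complex.Im z| < 1].

Lemma open_square (R : realType) : open (@square R).
Proof.
move=> z [z1 z2]; apply/nbhs_cpx.
exists (Num.min (1 - `|complex.Re z|) (1 - `|complex.Im z|)); first by rewrite lt_min !subr_gt0 z1.
move=> w; rewrite lt_min => /andP[h1 h2].
have a1 := Re_le_cabs (z - w); have a2 := Im_le_cabs (z - w); rewrite !raddfB /= in a1 a2.
have b1 : `|complex.Re w| <= `|complex.Re z| + `|complex.Re z - complex.Re w|.
  by rewrite -{1}[complex.Re w](subKr (complex.Re z)); exact: ler_normB.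
have b2 : `|complex.Im w| <= `|complex.Im z| + `|complex.Im z - complex.Im w|.
  by rewrite -{1}[complex.Im w](subKr (complex.Im z)); exact: ler_normB.
by split; lra.
Qed.

(** The square is star-shaped: a union of segments issuing from [0]. *)
Lemma connected_square (R : realType) : connected (@square R).
Proof.
pose seg (z : Cplx R) : set (Cplx R) :=
  (fun t : R => cpx (t * complex.Re z, t * complex.Im z)) @` `[0, 1].
have -> : @square R = \bigcup_(z in @square R) seg z.
  apply/seteqP; split => [z sz|w [z [z1 z2] [t]]].
    exists z => //; exists 1; last by rewrite !mul1r cpxE.
    by rewrite /= in_itv /= ler01 lexx.
  rewrite /= in_itv /= => /andP[t0 t1] <-; rewrite /square /= !normrM ger0_norm //.
  have h1 := normr_ge0 (complex.Re z); have h2 := normr_ge0 (complex.Im z).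
  by split; nra.
apply: bigcup_connected.
  exists 0 => z _; exists 0; first by rewrite /= in_itv /= lexx ler01.
  by rewrite !mul0r.
move=> z _; apply: connected_continuous_connected; first exact: segment_connected.
apply: continuous_subspaceT => t.
apply: (@continuous_comp _ _ _ (fun t : R => (t * complex.Re z, t * complex.Im z)) (@cpx R)).
  have h (k : R) : t' * k @[t' --> t] --> t * k by apply: cvgM; [exact: cvg_id|exact: cvg_cst].
  exact: (cvg_pair (h _) (h _)).
exact: continuous_cpx.
Qed.

Lemma coords_square_box (R : realType) : coords (@square R) `<=` box 0 1.
Proof. by move=> p [/= p1 p2]; apply/boxE; rewrite !subr0; split; apply: ltW. Qed.

Lemma test_function_supp (R : realType) (Om : set (Cplx R)) (c : R * R) (s : R) (phi : R * R -> R) :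
  coords Om `<=` box c s -> test_function Om phi ->
  [/\ supp c s phi,
      forall p, ~ coords Om p -> phi p = 0 /\ forall k, partial k phi p = 0,
      forall k p, derivable phi p (axis R k), continuous phi &
      forall k, continuous (partial k phi)].
Proof.
move=> Oc [sm _ sO].
have out p : ~ coords Om p -> phi p = 0.
  move=> nO; apply: contrapT => /eqP p0; apply: nO; apply: sO.
  by apply: subset_closure.
split.
- by move=> p pb; apply: out => Op; apply: pb; exact: Oc.
- move=> p nO; split=> [|k]; first exact: out.
  rewrite /partial (near_eq_derive (g := cst 0)) ?derive_cst //.
  have : nbhs p (~` closure [set p | phi p != 0]).
    apply: open_nbhs_nbhs; split; last by move=> /sO.
    by rewrite openC; exact: closed_closure.
  apply: filterS => w nw; apply: contrapT => /eqP w0; apply: nw; exact: subset_closure.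
- by move=> k p; have [_] := sm [::]; apply.
- by have [] := sm [::].
- by move=> k; have [] := sm [:: k].
Qed.

(** * Weak derivatives of [max (x, 0)] *)

Definition posx (R : realType) (p : R * R) : R := Num.max 0 p.1.
Definition stepx (R : realType) (p : R * R) : R := (0 <= p.1)%R%:R.

Lemma continuous_posx (R : realType) : continuous (@posx R).
Proof.
move=> p; apply: (@continuous_comp _ _ _ (fst : R * R -> R) (fun x : R => Num.max 0 x)).
  exact: cvg_fst.
by apply: continuous_max; [exact: cvg_cst|exact: cvg_id].
Qed.

Lemma measurable_stepx (R : realType) : mes2 (@stepx R).
Proof.
have -> : @stepx R = \1_([set p | 0 <= p.1] : set (measurableTypeR R * measurableTypeR R)).
  by apply/funext => p; rewrite indicE mem_setE.
apply: measurable_indic; rewrite -[X in measurable X]setTI.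
rewrite (_ : [set p : R * R | 0 <= p.1] = fst @^-1` `[(0 : R), +oo[%classic).
  exact: (measurable_fst measurableT _ (measurable_itv _)).
by apply/seteqP; split => p /=; rewrite in_itv /= andbT.
Qed.

(** On every horizontal line the sum of the two integrands is the derivative of [x phi] for [x >= 0]
    and zero for [x < 0]; [x phi] vanishes at [0] and beyond the support. *)
Lemma integral_posx_partial_x (R : realType) (phi : R * R -> R) (s : R) : 0 < s ->
  supp 0 s phi -> (forall p, derivable phi p (axis R false)) -> continuous phi ->
  continuous (partial false phi) ->
  \int[@area R]_w (posx w * partial false phi w) = - \int[@area R]_w (stepx w * phi w).
Proof.
move=> s0 sp dp cp cdp; have sdp := supp_partial false sp.
have mst := @measurable_stepx R.
have step1 p : `|@stepx R p| <= 1 by rewrite /stepx normr_nat lern1 leq_b1.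
have [M M0 HM] := continuous_box_bounded cp sp.
have i2 : int2 (fun w => stepx w * phi w).
  apply: (@integrable_bounded_box _ _ 0 s M) => [|z|z zb].
  - by apply: measurable_funM => //; exact: continuous_measurable2.
  - by rewrite normrM -[leRHS]mul1r ler_pM.
  - by rewrite sp // mulr0.
have i1 : int2 (fun w => posx w * partial false phi w).
  apply: (@integrable_continuous_box _ _ 0 s) => z.
    by apply: cvgM; [exact: continuous_posx|exact: cdp].
  by move=> zb; rewrite sdp // mulr0.
have i12 : int2 (fun w => posx w * partial false phi w + stepx w * phi w).
  by have := integrableD measurableT i1 i2; exact: eq_integrable.
suff L (y : R) : (\int[@lebesgue_measure R]_x
    (posx (x, y) * partial false phi (x, y) + stepx (x, y) * phi (x, y))%R%:E = 0)%E.
  apply/eqP; rewrite -addr_eq0 -RintegralD //; apply/eqP.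
  by rewrite /Rintegral -(integral21_prod_meas1 i12) /fubini_G integral0_eq//= => y _; exact: L.
have dl t := is_derive_line (k := false) (0, y) t dp.
have D t : is_derive t (1 : R) (fun x => x * phi (x, y)) (phi (t, y) + t * partial false phi (t, y)).
  have E := is_derive_mul (is_derive_id t (1 : R)) (dl t); rewrite mul1r in E; exact: E.
have cx : continuous (fun x : R => x * phi (x, y)).
  by move=> t; apply: differentiable_continuous; apply/derivable1_diffP; have [] := D t.
have cpl : continuous (fun x : R => phi (x, y)) := @continuous_line R false phi (0, y) cp.
have cdl : continuous (fun x : R => partial false phi (x, y)) := @continuous_line R false _ (0, y) cdp.
pose o : R := 0; pose b := s + 1; have b0 : o < b by rewrite /o /b; lra.
pose g (x : R) : R := phi (x, y) + x * partial false phi (x, y).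
have -> : (\int[@lebesgue_measure R]_x (posx (x, y) * partial false phi (x, y) + stepx (x, y) * phi (x, y))%R%:E =
    \int[@lebesgue_measure R]_(x in `[o, b]) (g x)%:E)%E.
  rewrite [RHS]integral_mkcond; apply: eq_integral => x _.
  rewrite patchE; case: ifPn => [/set_mem|/negP xb].
    rewrite /= in_itv /= => /andP[x0 _]; by rewrite /posx /stepx /= x0 max_r // mul1r addrC.
  have [x0|x0] := leP 0 x; last by rewrite /posx /stepx /= max_l ?(ltW x0) // leNgt x0 !mul0r addr0.
  have xs : ~ box 0 s (x, y).
    move=> /boxE[/= h _]; apply: xb; apply/mem_set; rewrite /= in_itv /= /o /b x0 /=.
    by move: h; rewrite subr0 ger0_norm //; lra.
  by rewrite sp // sdp // !mulr0 addr0.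
rewrite (@continuous_FTC2 _ _ (fun x => x * phi (x, y))) //.
- have -> : phi (b, y) = 0.
    by apply: sp => /boxE[/= h _]; move: h; rewrite subr0 /b => /ler_normlP[_]; lra.
  by rewrite /o mul0r mulr0 subee.
- apply: continuous_subspaceT => x; apply: cvgD; first exact: cpl.
  by apply: cvgM; [exact: cvg_id|exact: cdl].
- split.
  + by move=> t _; have [] := D t.
  + by apply: cvg_at_right_filter; exact: cx.
  + by apply: cvg_at_left_filter; exact: cx.
- by move=> t _; rewrite derive1E; have [_ ->] := D t.
Qed.

(** [posx] is constant along vertical lines, so the integrand is itself the [y] derivative of a
    compactly supported function. *)
Lemma integral_posx_partial_y (R : realType) (phi : R * R -> R) (s : R) :
  supp 0 s phi -> (forall p, derivable phi p (axis R true)) -> continuous (partial true phi) ->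
  \int[@area R]_w (posx w * partial true phi w) = 0.
Proof.
move=> sp dp cdp.
pose f p := posx p * phi p.
have D p : derivable f p (axis R true) /\ partial true f p = posx p * partial true phi p.
  apply: partial_is_derive.
  have dl := is_derive_line (k := true) p (crd true p) dp.
  have := is_derive_mul (is_derive_cst (posx p) (crd true p) (1 : R)) dl.
  rewrite /line /crd /= -surjective_pairing mul0r add0r.
  by rewrite (_ : (fun t => _) = (fun t : R => f (p.1, t))).
have pf : partial true f = fun p => posx p * partial true phi p.
  by apply/funext => p; have [] := D p.
have := @integral_partial R true f 0 s; rewrite pf; apply.
- by move=> p pb; rewrite /f sp // mulr0.
- by move=> p; have [] := D p.
- by move=> p; apply: cvgM; [exact: continuous_posx|exact: cdp].
Qed.
Definition posC (R : realType) (z : Cplx R) : Cplx R := (Num.max 0 (complex.Re z))%:C%C.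
Definition stepC (R : realType) (z : Cplx R) : Cplx R := ((0 <= complex.Re z)%R%:R)%:C%C.

Lemma measurable_coords_compact (R : realType) (K : set (Cplx R)) : compact K ->
  measurable (coords K : set (measurableTypeR R * measurableTypeR R)).
Proof.
move=> cK; rewrite -[coords K]setCK; apply: measurableC; apply: open_measurable2.
have := compact_closed (@norm_hausdorff _ (Cplx R)) cK; rewrite -openC => oK.
exact: (open_comp (fun z _ => @continuous_cpx R z) oK).
Qed.

Lemma integrable_bounded_sub_box (R : realType) (A : set (measurableTypeR R * measurableTypeR R))
    (f : R * R -> R) (c : R * R) (s M : R) : measurable A -> A `<=` box c s -> mes2 f ->
  (forall p, box c s p -> `|f p| <= M) -> (@area R).-integrable A (EFin \o f).
Proof.
move=> mA As mf fM; apply: (integrableS (measurable_box c s)) => //.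
apply: measurable_bounded_integrable; [exact: measurable_box|exact: area_box_lty|exact: measurable_funTS|].
by exists M; split; rewrite ?num_real // => x Mx z zb /=; apply: le_trans (ltW Mx); exact: fM.
Qed.

Lemma L1_loc_bounded (R : realType) (Om : set (Cplx R)) (f : Cplx R -> Cplx R) (M : R) :
  Om `<=` @square R -> mes2 (re_part f) -> mes2 (im_part f) ->
  (forall p, box 0 1 p -> `|re_part f p| <= M /\ `|im_part f p| <= M) -> L1_loc Om f.
Proof.
move=> Os mr mi fM K cK KO; have mK := measurable_coords_compact cK.
have Kb : coords K `<=` box 0 1 by move=> p Kp; apply: coords_square_box; apply: Os; exact: KO.
by split; apply: (integrable_bounded_sub_box (M := M) mK Kb) => // p /fM[].
Qed.

Lemma L2_bounded (R : realType) (Om : set (Cplx R)) (f : Cplx R -> Cplx R) (M : R) :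
  open Om -> Om `<=` @square R -> mes2 (re_part f) -> mes2 (im_part f) ->
  (forall p, box 0 1 p -> `|re_part f p| <= M /\ `|im_part f p| <= M) -> L2 Om f.
Proof.
move=> oO Os mr mi fM; have mO := open_measurable2 (open_coords oO).
have Ob : coords Om `<=` box 0 1 by move=> p Op; apply: coords_square_box; exact: Os.
split; [exact: measurable_funTS|exact: measurable_funTS|].
have E : (fun p => cabs (f (cpx p)) ^+ 2) = fun p => re_part f p ^+ 2 + im_part f p ^+ 2.
  by apply/funext => p; exact: cabs_sqr.
have mE : mes2 (fun p => cabs (f (cpx p)) ^+ 2).
  by rewrite E; apply: measurable_funD; exact: measurable_funX.
have := @integrable_bounded_sub_box R _ (fun p => cabs (f (cpx p)) ^+ 2) 0 1 (2 * M ^+ 2) mO Ob mE.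
case/(_ _)/wrap => [p pb|].
  have [h1 h2] := fM p pb; have -> : cabs (f (cpx p)) ^+ 2 = re_part f p ^+ 2 + im_part f p ^+ 2 by exact: cabs_sqr.
  rewrite ger0_norm ?addr_ge0 ?sqr_ge0 // mulr_natl mulr2n.
  by apply: lerD; rewrite -[leLHS]real_normK ?num_real // lerXn2r // nnegrE // (le_trans _ h1).
move=> /integrableP[_]; apply: le_lt_trans; apply: ge0_le_integral => //.
- by move=> p _; rewrite lee_fin sqr_ge0.
- by apply/measurable_EFinP; exact: measurable_funTS.
- by apply/measurable_EFinP; apply: measurableT_comp => //; exact: measurable_funTS.
- by move=> p _; rewrite lee_fin ler_norm.
Qed.

Lemma cintegral_real (R : realType) (Om : set (Cplx R)) (f : Cplx R -> Cplx R) (u phi : R * R -> R) :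
  (forall p, f (cpx p) = (u p)%:C%C) -> (forall p, ~ coords Om p -> phi p = 0) ->
  cintegral Om (fun z => f z * (phi (complex.Re z, complex.Im z))%:C%C) =
  (\int[@area R]_w (u w * phi w))%:C%C.
Proof.
move=> fu out; rewrite /cintegral.
have e1 : re_part (fun z => f z * (phi (complex.Re z, complex.Im z))%:C%C) = fun w => u w * phi w.
  by apply/funext => w; rewrite /re_part fu /= -surjective_pairing mul0r subr0.
have e2 : im_part (fun z => f z * (phi (complex.Re z, complex.Im z))%:C%C) = cst 0.
  by apply/funext => w; rewrite /im_part fu /= mul0r mulr0 addr0.
rewrite e1 e2; congr (_ +i* _)%C; last by rewrite /Rintegral integral0_eq.
rewrite [LHS]Rintegral_mkcond; apply: eq_Rintegral => w _; rewrite patchE; case: ifPn => // /negP nO.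
by rewrite out ?mulr0 // => Ow; apply: nO; apply/mem_set.
Qed.

Lemma posC_weak_partial (R : realType) (Om : set (Cplx R)) (k : bool) : Om `<=` @square R ->
  is_weak_partial Om k (@posC R) (if k then cst 0 else @stepC R).
Proof.
move=> Os.
have Ob : coords Om `<=` box 0 1 by move=> p Op; apply: coords_square_box; exact: Os.
have c01 : 0 <= (1 : R) by [].
split.
- apply: (@L1_loc_bounded _ _ _ 1) => //.
  + exact: continuous_measurable2 (@continuous_posx R).
  + exact: measurable_cst.
  + move=> p /boxE; rewrite !subr0 => -[p1 _]; rewrite /im_part /= normr0; split=> //.
    rewrite /re_part /= ger0_norm ?le_max ?lexx // ge_max ler01 /=.
    exact: le_trans (ler_norm _) p1.
- case: k; apply: (@L1_loc_bounded _ _ _ 1) => //.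
  + exact: measurable_cst.
  + exact: measurable_cst.
  + by move=> p _; rewrite /re_part /im_part /= normr0.
  + exact: measurable_stepx.
  + exact: measurable_cst.
  + by move=> p _; rewrite /re_part /im_part /= normr0 normr_nat lern1 leq_b1.
move=> phi tphi; have [sp out dp cp cdp] := test_function_supp Ob tphi.
have out0 p (nO : ~ coords Om p) := (out p nO).1.
rewrite (@cintegral_real _ _ _ (@posx R)) //; last by move=> p nO; exact: (out p nO).2.
case: k.
  rewrite (@cintegral_real _ _ (cst 0) (cst 0)) // (@integral_posx_partial_y _ _ 1) //.
  by rewrite (_ : \int[@area R]_w (cst 0 w * phi w) = 0) ?oppr0 // /Rintegral integral0_eq //= => p _; rewrite mul0r.
rewrite (@cintegral_real _ _ _ (@stepx R)) // (@integral_posx_partial_x _ _ 1) //.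
by rewrite rmorphN.
Qed.
Lemma W12_posC (R : realType) (Om : set (Cplx R)) : open Om -> Om `<=` @square R ->
  W12 Om (@posC R).
Proof.
move=> oO Os; split; [|case].
- apply: (@L2_bounded _ _ _ 1) => //.
  + exact: continuous_measurable2 (@continuous_posx R).
  + exact: measurable_cst.
  + move=> p /boxE; rewrite !subr0 => -[p1 _]; rewrite /im_part /= normr0; split=> //.
    rewrite /re_part /= ger0_norm ?le_max ?lexx // ge_max ler01 /=.
    exact: le_trans (ler_norm _) p1.
- exists (cst 0); first exact: (posC_weak_partial true Os).
  apply: (@L2_bounded _ _ _ 1) => //.
  + exact: measurable_cst.
  + exact: measurable_cst.
  + by move=> p _; rewrite /re_part /im_part /= normr0.
- exists (@stepC R); first exact: (posC_weak_partial false Os).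
  apply: (@L2_bounded _ _ _ 1) => //.
  + exact: measurable_stepx.
  + exact: measurable_cst.
  + by move=> p _; rewrite /re_part /im_part /= normr0 normr_nat lern1 leq_b1.
Qed.

(** The weak derivatives are [stepC] and [0], so [h_z] and [h_zbar] both equal half of [stepC]
    almost everywhere. *)
Lemma posC_derivatives (R : realType) :
  ae_in (@square R) (fun z => cabs (dz (@square R) (@posC R) z) <= 1 /\
    cabs (dzbar (@square R) (@posC R) z) = cabs (dz (@square R) (@posC R) z)).
Proof.
have ss : @square R `<=` @square R by [].
have wx := posC_weak_partial false ss; have wy := posC_weak_partial true ss.
have gx : is_weak_partial (@square R) false (@posC R) (weak_partial (@square R) false (@posC R)).
  by apply: xgetPex; exists (@stepC R).
have gy : is_weak_partial (@square R) true (@posC R) (weak_partial (@square R) true (@posC R)).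
  by apply: xgetPex; exists (cst 0).
have ax := weak_partial_unique (@open_square R) gx wx.
have ay := weak_partial_unique (@open_square R) gy wy.
apply: (negligibleS _ (negligibleU ax ay)) => p /= /not_implyP[Op ne].
apply: contrapT => /not_orP[/contrapT /(_ Op) ex /contrapT /(_ Op) ey]; apply: ne.
have [h1 h2] := wirtinger_cpx (@stepC R (cpx p)) 0.
rewrite /dz /dzbar ex ey h1 h2 /= subr0 addr0 addr0 subr0 mul0r.
split; last by [].
apply: le_trans (cabs_le_sum _) _; rewrite /= normr0 addr0 ger0_norm ?divr_ge0 //.
by rewrite ler_pdivrMr // mul1r ler_nat; apply: leq_trans (leq_b1 _) _.
Qed.

(** * No representative is continuously differentiable *)

Lemma itv_not_null (R : realType) (a b : R) (N : set (measurableTypeR R)) : a < b ->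
  measurable N -> @lebesgue_measure R N = 0%E -> ~ (`]a, b[%classic `<=` N).
Proof.
move=> ab mN N0 sub.
have : (@lebesgue_measure R [set` `]a, b[%R] <= @lebesgue_measure R N)%E.
  by apply: le_measure; rewrite ?inE.
by rewrite N0 lebesgue_measure_itv /= lte_fin ab -EFinD lee_fin subr_le0 leNgt ab.
Qed.

(** By Tonelli almost every horizontal section of a null set is null, and []-1, 1[] is too large to
    consist of exceptions. It reduces equality almost everywhere in the plane to one line. *)
Lemma exists_null_section (R : realType) (Z : set (measurableTypeR R * measurableTypeR R)) :
  measurable Z -> @area R Z = 0%E ->
  exists2 y : R, `|y| < 1 & (@lebesgue_measure R).-negligible [set x | Z (x, y)].
Proof.
move=> mZ Z0.
pose f : measurableTypeR R * measurableTypeR R -> \bar R := fun p => (\1_Z p)%:E.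
have mf : measurable_fun setT f by apply/measurable_EFinP; exact: measurable_indic.
have f0 p : (0 <= f p)%E by rewrite lee_fin.
have I0 : (\int[@area R]_p f p = 0)%E by rewrite integral_indic // setIT Z0.
pose G (y : measurableTypeR R) : \bar R := (\int[@lebesgue_measure R]_x f (x, y))%E.
have mG : measurable_fun setT G.
  exact: (@measurable_fun_fubini_tonelli_G _ _ _ _ R (@lebesgue_measure R) f mf f0).
have G0 y : (0 <= G y)%E by apply: integral_ge0 => x _; exact: f0.
have IG : (\int[@lebesgue_measure R]_y `|G y| = 0)%E.
  rewrite -I0; apply/esym; apply: etrans (@fubini_tonelli2 _ _ _ _ R (@lebesgue_measure R) (@lebesgue_measure R) f mf f0) _.
  by apply: eq_integral => y _; rewrite gee0_abs.
have aG := (ae_eq_integral_abs (@lebesgue_measure R) measurableT mG).1 IG.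
have [y y1 Gy] : exists2 y : R, `|y| < 1 & G y = 0%E.
  apply: contrapT => no; have [N [mN N0 NP]] := aG.
  have sub : `](-1 : R), 1[%classic `<=` N.
    move=> y; rewrite /= in_itv /= => /andP[y1 y2]; apply: NP => /= h; apply: no.
    by exists y; [rewrite ltr_norml y1|exact: h].
  by apply: (itv_not_null _ mN N0 sub); lra.
exists y => //.
have mfy : measurable_fun setT (fun x : measurableTypeR R => f (x, y)).
  by apply: measurableT_comp mf _; exact: measurable_pair2.
have IGy : (\int[@lebesgue_measure R]_x `|f (x, y)| = 0)%E.
  by rewrite -Gy; apply: eq_integral => x _; rewrite gee0_abs.
have := (ae_eq_integral_abs (@lebesgue_measure R) measurableT mfy).1 IGy.
apply: negligibleS => x /= Zx; move=> /(_ Logic.I)/=; rewrite /f indicE mem_set // => -[] /eqP.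
by rewrite oner_eq0.
Qed.

(** If the values differed at [a], they would by continuity differ on a whole interval, which is not
    a null set. *)
Lemma ae_eq_continuous (R : realType) (f g : R -> R) (a : R) (e : R) : 0 < e ->
  {for a, continuous f} -> {for a, continuous g} ->
  (@lebesgue_measure R).-negligible [set x | `|x - a| < e /\ f x != g x] -> f a = g a.
Proof.
move=> e0 cf cg neg; apply: contrapT => /eqP fg.
have d0 : 0 < `|f a - g a| by rewrite normr_gt0 subr_eq0.
have c : (f x - g x) @[x --> a] --> f a - g a by exact: cvgB cf cg.
have [d /= dp dP] := (cvgrPdist_lt _ _).1 c _ d0.
pose r := Num.min d e; have r0 : 0 < r by rewrite lt_min dp.
have [N [mN N0 NP]] := neg.
have sub : `]a - r, a + r[%classic `<=` N.
  move=> x; rewrite /= in_itv /= => /andP[x1 x2].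
  have xr : `|x - a| < r by rewrite ltr_norml; apply/andP; split; lra.
  apply: NP => /=; split; first by apply: lt_le_trans xr _; rewrite ge_min lexx orbT.
  apply/eqP => fgx; have := dP x; rewrite /ball /= distrC => /(_ _)/wrap[].
    by apply: lt_le_trans xr _; rewrite ge_min lexx.
  by rewrite fgx subrr subr0 ltxx.
by apply: (itv_not_null _ mN N0 sub); lra.
Qed.

Lemma max0_not_derivable (R : realType) (f : R -> R) : (forall x, `|x| < 1 -> f x = Num.max 0 x) ->
  ~ derivable f (0 : R) 1.
Proof.
move=> fE df.
have f0 : f 0 = 0 by rewrite fE ?normr0 // maxxx.
have : (fun h : R => h^-1 *: (f (h *: (1 : R) + 0) - f 0)) @ 0^' --> 'D_1 f 0 := df.
set l := 'D_1 f 0 => cl.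
(* The difference quotients at [t] and [-t] are [1] and [0], which cannot both lie within [1/4] of
   the derivative. *)
have e4 : (0 : R) < 1 / 4 by lra.
have [d /= d0 dP] := (cvgrPdist_lt _ _).1 cl _ e4.
pose t := Num.min (d / 2) (1 / 2); have t0 : 0 < t by rewrite lt_min divr_gt0 //; lra.
have t2 : t <= 1 / 2 by rewrite ge_min lexx orbT.
have td : t <= d / 2 by rewrite ge_min lexx.
have h1 := dP t; have h2 := dP (- t).
rewrite /ball /= sub0r normrN gtr0_norm // in h1.
rewrite /ball /= sub0r opprK gtr0_norm // in h2.
have tdd : t < d by lra.
have tn0 : t != 0 by rewrite lt0r_neq0.
have tn1 : - t != 0 by rewrite oppr_eq0.
have {}h1 := h1 tdd tn0; have {}h2 := h2 tdd tn1.
rewrite f0 subr0 addr0 /= in h1; rewrite f0 subr0 addr0 /= in h2.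
have g1 : f (t *: (1 : R)) = t by rewrite /GRing.scale /= mulr1 fE ?gtr0_norm ?max_r ?ltW //; lra.
have g2 : f (- t *: (1 : R)) = 0.
  by rewrite /GRing.scale /= mulr1 fE ?normrN ?gtr0_norm ?max_l ?oppr_le0 ?ltW //; lra.
rewrite g1 in h1; rewrite g2 in h2.
move: h1 h2; rewrite /GRing.scale /= mulVf // mulr0 subr0 !ltr_norml => /andP[a1 a2] /andP[b1 b2]; lra.
Qed.
(** Every representative has to be excluded. On a suitable horizontal line it agrees almost
    everywhere with [max (x, 0)]; its partial derivability makes it continuous along that line,
    hence equal to [max (x, 0)] there, against derivability at [0]. *)
Lemma posC_not_C1 (R : realType) : ~ up_to_null (@square R) (class_C1 (@square R)) (@posC R).
Proof.
move=> [h' [Z [mZ Z0 ZP]] C1].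
have [y y1 ny] := exists_null_section mZ Z0.
have Oin (x : R) : `|x| < 1 -> coords (@square R) (x, y) by move=> x1; split.
pose f (x : R) := re_part h' (x, y).
have df (x : R) : `|x| < 1 -> derivable f x 1.
  move=> x1; have [d _] := C1 _ (or_introl erefl) false (x, y) (Oin x x1).
  exact: (derivable_line false (re_part h') (x, y)).1 d.
have cm : continuous (fun x : R => Num.max 0 x).
  by move=> x; apply: continuous_max; [exact: cvg_cst|exact: cvg_id].
apply: (@max0_not_derivable R f); last by apply: df; rewrite normr0.
move=> x x1; have e0 : 0 < 1 - `|x| by rewrite subr_gt0.
apply: (ae_eq_continuous e0) (cm x) _.
  by apply: differentiable_continuous; apply/derivable1_diffP; exact: df.
apply: negligibleS ny => t /= [tx ne]; apply: ZP => /= h; move/eqP: ne; apply.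
have t1 : `|t| < 1.
  by rewrite -{1}[t](subrK x); apply: le_lt_trans (ler_normD _ _) _; lra.
by rewrite /f /re_part (h (Oin t t1)).
Qed.

Lemma not_C1_part (R : realType) : exists (Om : set (Cplx R)) (Rad L M alpha : R)
      (H : Cplx R -> sphere R -> Cplx R) (h : Cplx R -> Cplx R),
    [/\ is_domain Om, 0 <= Rad, 0 <= L, 0 <= M & 0 < alpha < 1] /\
    [/\ H_continuous Om Rad H, H_lipschitz Om Rad L H &
        H_hoelder Om Rad M alpha H] /\
    [/\ W12 Om h, solution Om Rad H h,
        ae_in Om (fun z => 0 <= Jac Om h z) &
        ~ up_to_null Om (class_C1 Om) h].
Proof.
(* Since [|h_z| <= 1] almost everywhere, the choice [Rad = 1] empties the equation. The zero
   nonlinearity then allows [L = M = 0], and [1/2] is an arbitrary exponent. *)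
exists (@square R), 1, 0, 0, (1 / 2), (fun _ _ => 0), (@posC R); split; [|split].
- split=> //; last by apply/andP; split; lra.
  split; [|exact: open_square|exact: connected_square].
  by exists 0; rewrite /square /= normr0.
- split.
  + by apply: continuous_subspaceT => q; exact: cvg_cst.
  + by move=> z x1 x2 _ _ _; rewrite subrr cabs0 mul0r.
  + move=> xi _; rewrite -[X in (_ <= X%:E)%E]addr0 EFinD; apply: leeD.
      by apply: ub_ereal_sup => _ [z _ <-]; rewrite cabs0.
    by apply: ub_ereal_sup => _ [z _ <-]; rewrite subrr cabs0 mul0r.
split.
- by apply: W12_posC => //; exact: open_square.
- split.
    by move=> U oU _ UO; apply: W12_posC => //; exact: subset_trans (@subset_closure _ U) UO.
  apply: (ae_imp (@posC_derivatives R)) => p hp Op; have [h1 _] := hp Op.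
  by rewrite ltNge h1.
- apply: (ae_imp (@posC_derivatives R)) => p hp Op; have [_ h2] := hp Op.
  by rewrite /Jac h2 subrr.
- exact: posC_not_C1.
Qed.

Theorem theorem1p2 (R : realType) :
  (forall (Om : set (Cplx R)) (Rad L M alpha : R)
      (H : Cplx R -> sphere R -> Cplx R),
    is_domain Om -> 0 <= Rad -> 0 <= L -> 0 <= M -> 0 < alpha < 1 ->
    H_continuous Om Rad H -> H_lipschitz Om Rad L H ->
    H_hoelder Om Rad M alpha H ->
    forall h : Cplx R -> Cplx R,
      W12 Om h -> solution Om Rad H h ->
      ae_in Om (fun z => 0 <= Jac Om h z) ->
      up_to_null Om (locally_lipschitz Om) h)
  /\
  (exists (Om : set (Cplx R)) (Rad L M alpha : R)
      (H : Cplx R -> sphere R -> Cplx R) (h : Cplx R -> Cplx R),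
    [/\ is_domain Om, 0 <= Rad, 0 <= L, 0 <= M & 0 < alpha < 1] /\
    [/\ H_continuous Om Rad H, H_lipschitz Om Rad L H &
        H_hoelder Om Rad M alpha H] /\
    [/\ W12 Om h, solution Om Rad H h,
        ae_in Om (fun z => 0 <= Jac Om h z) &
        ~ up_to_null Om (class_C1 Om) h]).
Proof.
split; last exact: not_C1_part.
move=> Om Rad L M alpha H dom R0 L0 M0 a01 _ HL HH h.
exact: (local_lipschitz_part dom R0 L0 M0 a01 HL HH).
Qed.
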